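(* Let $(A,\mathfrak m)$ be an excellent two-dimensional normal local ring containing an algebraically closed field $k\cong A/\mathfrak m$, let $X\to\operatorname{Spec}A$ be a resolution of singularities, let $Z$ be a $p_g$-cycle on $X$, and let $Q$ be a minimal reduction of $I:=I_Z$. Then $I^n$ is integrally closed for all $n\ge1$, $I^2=IQ$, and $I\subset Q:I$.
   Context: A cycle is a divisor on $X$ supported in the exceptional divisor (the preimage of $\mathfrak m$). $I_Z=H^0(X,\mathcal O_X(-Z))\subset A$. A cycle $Z>0$ is a $p_g$-cycle if $\mathcal O_X(-Z)$ is generated by global sections and $\ell_A(H^1(X,\mathcal O_X(-Z)))=p_g(A)$, where $p_g(A)=\ell_A(H^1(X,\mathcal O_X))$ is the geometric genus. A minimal reduction of an $\mathfrak m$-primary ideal $I$ is a parameter ideal $Q\subset I$ with $I^{r+1}=QI^r$ for some $r\ge0$. *)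

(* Defs.v *)
From HB Require Import structures.
From mathcomp Require Import all_boot all_order all_algebra all_classical.
From mathcomp Require Import topology.

Set Implicit Arguments.
Unset Strict Implicit.
Unset Printing Implicit Defensive.

Import GRing.Theory.
Local Open Scope classical_set_scope.
Local Open Scope ring_scope.

(** * Modules and rings

    Notions are relative to a subring [S : set R] of an ambient ring [R], so
    that they apply verbatim to a whole ring ([S := [set: R]]) and to the local
    rings of an integral scheme, which are subrings of its function field. *)

Definition subring (R : comPzRingType) (S : set R) : Prop :=
  [/\ S 1, forall x y, S x -> S y -> S (x - y)
    & forall x y, S x -> S y -> S (x * y)].

Definition ring_hom_on (R R' : comPzRingType) (S : set R) (f : R -> R') : Prop :=
  [/\ f 1 = 1, forall x y, S x -> S y -> f (x - y) = f x - f y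
    & forall x y, S x -> S y -> f (x * y) = f x * f y].

(* M is an S-submodule of V *)
Definition submodule (R : comPzRingType) (V : lmodType R) (S : set R)
    (M : set V) : Prop :=
  [/\ M 0, forall u v, M u -> M v -> M (u + v)
    & forall s v, S s -> M v -> M (s *: v)].

Definition submodule_span (R : comPzRingType) (V : lmodType R) (S : set R) (E : set V) :
    set V :=
  [set v | forall M, submodule S M -> E `<=` M -> M v].

(* The S-module M/N has a composition series of length n *)
Definition quotient_has_length (R : comPzRingType) (V : lmodType R) (S : set R)
    (M N : set V) (n : nat) : Prop :=
  exists C : nat -> set V,
    [/\ C 0%N = N, C n = M,
        forall i, (i <= n)%N -> submodule S (C i)
      & forall i, (i < n)%N -> proper (C i) (C i.+1) /\
          forall W, submodule S W -> C i `<=` W -> W `<=` C i.+1 ->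
            W = C i \/ W = C i.+1].

Section Ideals.
Variables (R : comPzRingType) (S : set R).
Implicit Types (I J P Q : set R) (n : nat).

Definition ideal I : Prop := submodule S (I : set R^o) /\ I `<=` S.

Definition ideal_gen (E : set R) : set R := submodule_span S (E : set R^o).

Definition ideal_mul I J : set R :=
  ideal_gen [set z | exists x y, [/\ I x, J y & z = x * y]].

Definition ideal_pow I n : set R := iter n (ideal_mul I) S.

Definition prime_ideal P : Prop :=
  [/\ ideal P, ~ P 1 & forall x y, S x -> S y -> P (x * y) -> P x \/ P y].

(* Subrings of S containing S0 are S0-algebras; [S0 := range f] for a
   structure morphism f. *)
Definition subalgebra_gen (S0 : set R) (s : seq R) : set R :=
  [set x | forall T, subring T -> S0 `<=` T -> {in s, forall y, T y} -> T x].

Definition noetherian : Prop :=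
  forall I, ideal I -> exists s : seq R, I = ideal_gen [set` s].

Definition nonunits : set R :=
  [set x | S x /\ ~ exists2 y, S y & x * y = 1].

(* This excludes the zero ring, in which 0 is a unit. *)
Definition local_ring : Prop := ideal nonunits.

(* C 0 < C 1 < ... < C n *)
Definition prime_chain (C : nat -> set R) n : Prop :=
  (forall i, (i <= n)%N -> prime_ideal (C i)) /\
  (forall i, (i < n)%N -> proper (C i) (C i.+1)).

Definition saturated_prime_chain (C : nat -> set R) n : Prop :=
  prime_chain C n /\
  forall i, (i < n)%N -> forall T, prime_ideal T ->
    C i `<=` T -> T `<=` C i.+1 -> T = C i \/ T = C i.+1.

Definition krull_dim n : Prop :=
  (exists C, prime_chain C n) /\ ~ exists C, prime_chain C n.+1.

Definition regular_local : Prop :=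
  [/\ noetherian, local_ring
    & exists2 s : seq R, krull_dim (size s) & nonunits = ideal_gen [set` s]].

Definition catenary : Prop :=
  forall P Q, prime_ideal P -> prime_ideal Q -> P `<=` Q ->
  exists n,
    (forall C l, prime_chain C l -> C 0%N = P -> C l = Q -> (l <= n)%N) /\
    (forall C l, saturated_prime_chain C l -> C 0%N = P -> C l = Q -> l = n).

Definition m_primary I : Prop :=
  [/\ ideal I, I `<=` nonunits
    & forall x, nonunits x -> exists n, I (x ^+ n)].

Definition parameter_ideal I : Prop :=
  m_primary I /\
  exists2 s : seq R, krull_dim (size s) & I = ideal_gen [set` s].

Definition minimal_reduction I Q : Prop :=
  [/\ parameter_ideal Q, Q `<=` I
    & exists r, ideal_pow I r.+1 = ideal_mul Q (ideal_pow I r)].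

Definition integral_over_ideal I (x : R) : Prop :=
  exists n (a : nat -> R),
    [/\ (0 < n)%N, forall i, (0 < i <= n)%N -> ideal_pow I i (a i)
      & x ^+ n + \sum_(1 <= i < n.+1) a i * x ^+ (n - i) = 0].

Definition integrally_closed_ideal I : Prop :=
  forall x, S x -> integral_over_ideal I x -> I x.

Definition colon I J : set R := [set x | S x /\ forall y, J y -> I (x * y)].

End Ideals.

(** * Excellent rings *)

Section Excellent.

Definition is_localization (R S : comPzRingType) (P : set R)
    (f : {rmorphism R -> S}) : Prop :=
  [/\ forall s, ~ P s -> exists y, f s * y = 1,
      forall y, exists a s, ~ P s /\ f s * y = f a
    & forall a, f a = 0 -> exists s, ~ P s /\ s * a = 0].

Definition regular_at (R : comPzRingType) (P : set R) : Prop :=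
  forall (S : comPzRingType) (f : {rmorphism R -> S}),
    is_localization P f -> regular_local [set: S].

Definition regular_ring (R : comPzRingType) : Prop :=
  noetherian [set: R] /\
  forall P, prime_ideal [set: R] P -> regular_at P.

Definition finite_type_morphism (R B : comPzRingType) (f : {rmorphism R -> B}) :
    Prop :=
  exists s : seq B, subalgebra_gen (range f) s = [set: B].

(* c : R -> C is the I-adic completion of R: the induced maps
   R/I^n -> C/I^nC are bijective and C is separated and complete. *)
Definition is_completion (R C : comPzRingType) (I : set R)
    (c : {rmorphism R -> C}) : Prop :=
  let In n := ideal_pow [set: R] I n in
  let InC n := ideal_gen [set: C] (c @` In n) in
  [/\ forall n a, InC n (c a) -> In n a,
      forall n y, exists a, InC n (y - c a),
      forall y, (forall n, InC n y) -> y = 0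
    & forall u : nat -> C, (forall n, InC n (u n.+1 - u n)) ->
        exists l, forall n, InC n (l - u n)].

(* T is the tensor product of B and L over R. *)
Definition is_tensor_product (R B L T : comPzRingType) (b : {rmorphism R -> B})
    (g : {rmorphism R -> L}) (u : {rmorphism B -> T}) (v : {rmorphism L -> T}) :
    Prop :=
  u \o b =1 v \o g /\
  forall (T' : comPzRingType) (u' : {rmorphism B -> T'})
      (v' : {rmorphism L -> T'}), u' \o b =1 v' \o g ->
  exists w : {rmorphism T -> T'},
    [/\ w \o u =1 u', w \o v =1 v'
      & forall w' : {rmorphism T -> T'},
          w' \o u =1 u' -> w' \o v =1 v' -> w' =1 w].

(* L, with g : R -> L, is a finite extension of the residue field of R at q. *)
Definition finite_residue_extension (R : comPzRingType) (q : set R)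
    (L : fieldType) (g : {rmorphism R -> L}) : Prop :=
  q = [set a | g a = 0] /\
  exists s : seq L,
    submodule_span [set x | exists a b, x = g a / g b] ([set` s] : set L^o) = [set: L].

Definition geometrically_regular_fibres (R B : comPzRingType)
    (b : {rmorphism R -> B}) : Prop :=
  forall q, prime_ideal [set: R] q ->
  forall (L : fieldType) (g : {rmorphism R -> L}),
    finite_residue_extension q g ->
  forall (T : comPzRingType) (u : {rmorphism B -> T}) (v : {rmorphism L -> T}),
    is_tensor_product b g u v -> regular_ring T.

Definition G_ring (R : comPzRingType) : Prop :=
  forall P, prime_ideal [set: R] P ->
  forall (RP : comPzRingType) (f : {rmorphism R -> RP}), is_localization P f ->
  forall (C : comPzRingType) (c : {rmorphism RP -> C}),
    is_completion (nonunits [set: RP]) c -> geometrically_regular_fibres c.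

Definition universally_catenary (R : comPzRingType) : Prop :=
  forall (B : comPzRingType) (f : {rmorphism R -> B}),
    finite_type_morphism f -> catenary [set: B].

Definition open_regular_locus (B : comPzRingType) : Prop :=
  forall P, prime_ideal [set: B] P -> regular_at P ->
  exists2 h, ~ P h &
    forall Q, prime_ideal [set: B] Q -> ~ Q h -> regular_at Q.

Definition J2_ring (R : comPzRingType) : Prop :=
  forall (B : comPzRingType) (f : {rmorphism R -> B}),
    finite_type_morphism f -> open_regular_locus B.

Definition excellent (R : comPzRingType) : Prop :=
  [/\ noetherian [set: R], universally_catenary R, G_ring R & J2_ring R].

End Excellent.

Definition normal_domain (A : idomainType) : Prop :=
  forall x : {fraction A}, integralOver (@tofrac A) x -> range (@tofrac A) x.

(** * Integral schemes with a given function field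

    An integral scheme with function field K is presented by its space X and
    its local rings O x, which are subrings of K.  Its structure sheaf is the
    subsheaf U |-> \bigcap_(x in U) O x of the constant sheaf K. *)

Section Schemes.
Variables (K : fieldType) (X : topologicalType) (O : X -> set K).
Implicit Types (x y : X) (U V : set X).

Definition structure_sheaf U : set K := [set f | forall x, U x -> O x f].

(* The prime ideal of the sections over U that vanish at x *)
Definition prime_of_point U x : set K := structure_sheaf U `&` nonunits (O x).

(* x |-> prime_of_point U x is an isomorphism from U, with its structure sheaf,
   onto the spectrum of the ring of sections over U. *)
Definition affine_open U : Prop :=
  let B := structure_sheaf U in
  [/\ open U,
      forall f, exists a b, [/\ B a, B b, b != 0 & f = a / b],
      forall x y, U x -> U y -> prime_of_point U x = prime_of_point U y -> x = y,
      forall P, prime_ideal B P -> exists2 x, U x & prime_of_point U x = P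
    & (forall V, V `<=` U -> (open V <-> exists E : set K, E `<=` B /\
          V = [set x | U x /\ exists2 f, E f & ~ prime_of_point U x f])) /\
      forall x, U x -> prime_ideal B (prime_of_point U x) /\
        O x = [set f | exists a s,
                 [/\ B a, B s, ~ prime_of_point U x s & f = a / s]]].

Definition integral_scheme : Prop :=
  [/\ [set: X] !=set0,
      forall U V, open U -> open V -> U !=set0 -> V !=set0 -> U `&` V !=set0,
      forall x, subring (O x)
    & forall x, exists2 U, affine_open U & U x].

Definition regular_scheme : Prop := forall x, regular_local (O x).

End Schemes.

(** * Resolutions

    The function field of X is identified with the fraction field of A through
    the birational morphism X -> Spec A. *)

Section Resolutions.
Variables (A : idomainType) (X : topologicalType) (O : X -> set {fraction A}).
Local Notation K := {fraction A}.
Local Notation AK := (range (@tofrac A)).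
Implicit Types (x y : X) (U : set X).

Definition finite_type_over : Prop :=
  compact [set: X] /\
  forall x, exists U, [/\ affine_open O U, U x
    & exists s : seq K, structure_sheaf O U = subalgebra_gen AK s].

Definition valuation_ring (L : fieldType) (R : set L) : Prop :=
  subring R /\ forall z, R z \/ R z^-1.

(* Valuative criterion.  A morphism Spec L -> X is a point x with a local
   homomorphism psi : O x -> L, and a morphism Spec R -> X extending it is a
   specialization y of x such that psi restricts to a local homomorphism
   O y -> R. *)
Definition proper_over : Prop :=
  finite_type_over /\
  forall (L : fieldType) (R : set L), valuation_ring R ->
  forall x (psi : K -> L),
    ring_hom_on (O x) psi ->
    (forall f, nonunits (O x) f -> psi f = 0) ->
    (forall a : A, R (psi (tofrac a))) ->
  exists! y, [/\ closure [set x] y, forall f, O y f -> R (psi f)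
    & forall f, nonunits (O y) f -> nonunits R (psi f)].

Definition resolution : Prop :=
  [/\ integral_scheme O, forall x, AK `<=` O x, proper_over & regular_scheme O].

(* x lies over the maximal ideal of A. *)
Definition exceptional_point x : Prop :=
  forall a, nonunits [set: A] a -> nonunits (O x) (tofrac a).

(* Prime divisors are represented by their generic points. *)
Definition prime_divisor x : Prop := krull_dim (O x) 1.

Definition is_cycle (Z : X -> int) : Prop :=
  finite_set [set x | Z x != 0] /\
  forall x, Z x != 0 -> prime_divisor x /\ exceptional_point x.

Definition positive_cycle (Z : X -> int) : Prop :=
  [/\ is_cycle Z, forall x, 0 <= Z x & exists x, Z x != 0].

(* The order of f at x is at least n, for O x a discrete valuation ring. *)
Definition order_ge x (n : int) (f : K) : Prop :=
  exists pi u, [/\ nonunits (O x) = ideal_gen (O x) [set pi], O x u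
    & f = pi ^ n * u].

(* O_X(-Z) *)
Definition sheaf_of_cycle (Z : X -> int) U : set K :=
  [set f | forall x, U x -> prime_divisor x -> order_ge x (Z x) f].

Definition global_sections (F : set X -> set K) : set K := F [set: X].

Definition sheaf_stalk (F : set X -> set K) x : set K :=
  [set f | exists U, [/\ open U, U x & F U f]].

Definition globally_generated (F : set X -> set K) : Prop :=
  forall x, sheaf_stalk F x `<=` submodule_span (O x) (global_sections F : set K^o).

(* The first cohomology of a subsheaf F of the constant sheaf K, as the colimit
   of Cech cohomology over all open coverings (U x)_x with x in U x.  Cocycles
   take their values in K, and X being irreducible the cocycle condition on the
   nonempty set U x `&` U y `&` U z is an equation in K. *)
Definition pointed_cover (U : X -> set X) : Prop :=
  forall x, open (U x) /\ U x x.

Definition cech_cocycles (F : set X -> set K) : set (X -> X -> K^o) :=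
  [set f | (forall x y z, f x y + f y z = f x z) /\
     exists2 U : X -> set X, pointed_cover U & forall x y, F (U x `&` U y) (f x y)].

Definition cech_coboundaries (F : set X -> set K) : set (X -> X -> K^o) :=
  [set f | exists (U : X -> set X) (g : X -> K), [/\ pointed_cover U,
     forall x, F (U x) (g x) & forall x y, f x y = g y - g x]].

(* The length of H^1(X, F) as an A-module is n. *)
Definition H1_length (F : set X -> set K) (n : nat) : Prop :=
  quotient_has_length AK (cech_cocycles F) (cech_coboundaries F) n.

(* The geometric genus of A is p; it does not depend on the resolution. *)
Definition geometric_genus (p : nat) : Prop := H1_length (structure_sheaf O) p.

Definition pg_cycle (Z : X -> int) : Prop :=
  [/\ positive_cycle Z, globally_generated (sheaf_of_cycle Z)
    & exists2 p, geometric_genus p & H1_length (sheaf_of_cycle Z) p].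

Definition cycle_ideal (Z : X -> int) : set A :=
  [set a | global_sections (sheaf_of_cycle Z) (tofrac a)].

End Resolutions.

(* Main.v *)
Require Import Defs.
From HB Require Import structures.
From mathcomp Require Import all_boot all_order all_algebra all_classical.
From mathcomp Require Import topology.
From mathcomp Require Import ring.

Set Implicit Arguments.
Unset Strict Implicit.
Unset Printing Implicit Defensive.

Import GRing.Theory.
Local Open Scope classical_set_scope.
Local Open Scope ring_scope.

(* Replace the generators of Q by two general linear combinations a, b of them. Then X is covered
   by the opens X_a, on which b / a is regular and a generates O(-Z), and X_b, defined
   symmetrically. The zero locus of u = a / b is a curve C, the complement of X_a, which by
   genericity contains no exceptional divisor. So C meets the exceptional fibre in finitely many
   closed points, and the other points of C are finitely many generic points of prime divisors.

   Multiplication by a maps H^1(O) onto H^1(O(-Z)), because the cokernel would be the H^1 of a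
   sheaf on C and C is affine. Concretely: functions given at the closed points of C are
   approximated simultaneously, modulo u and a power of b, by one function that is regular at the
   generic points of C. Affineness comes from functions 1 / (t - l), with l in k general, which
   are integral over A along C, and from Chevalley's extension theorem together with the
   uniqueness of centers of valuations on X.

   As the two lengths agree, this surjection is injective. For w regular on X_b, the cocycle
   (b / a) w of the covering (X_a, X_b) becomes a coboundary after multiplication by a, hence
   (b / a) w = al + be with al regular on X_a and be regular on X_b. For f in
   I_(n+2) = H^0(O(-(n+2)Z)) and w = f / b^(n+2) this reads
   f = a (b^(n+1) be) + b (a b^n al), whence I_(n+2) = Q I_(n+1). Therefore I_n = I^n for n > 0,
   and I_n is integrally closed because X is normal. *)

(** * Subrings and ideals *)

(** Every ring is kept inside one field [K]: A is replaced by its image in its fraction field, and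
    the local rings of X are compared there with valuation rings. Properness becomes existence and
    uniqueness of centers, and Chevalley's theorem is what produces points of X. The dimension of
    the local rings of X is not given. It is bounded at points with residue field k, where a chart
    arises from A by adjoining functions vanishing at the point, one at a time, each preserving the
    bound 2. Finite length enters twice: besides the comparison of lengths, it makes a power b^p
    kill H^1(O(-Z)), so that a cocycle is the coboundary of a cochain divided by b^p; the poles of
    that cochain along C are what must be approximated. The obstacle is that a function chosen for
    one closed point of C may have poles at another. All choices are therefore made in one algebra R
    over A generated by functions integral modulo u: a single power b^c clears the poles of all of R
    modulo u, and the Chinese remainder theorem can be applied in R. *)

Lemma setT_subring (R : comPzRingType) : subring [set: R]. Proof. by []. Qed.

Section SubringTheory.
Variable R : comPzRingType.
Implicit Types (S T I J M : set R) (x y z : R).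

Section Closure.
Variable S : set R.
Hypothesis sS : subring S.

Lemma sr1 : S 1. Proof. by case: sS. Qed.
Lemma srB x y : S x -> S y -> S (x - y). Proof. by case: sS => _ h _; apply: h. Qed.
Lemma srM x y : S x -> S y -> S (x * y). Proof. by case: sS => _ _; apply. Qed.
Lemma sr0 : S 0. Proof. by rewrite -(subrr 1); apply: srB sr1 sr1. Qed.
Lemma srN x : S x -> S (- x). Proof. by move=> Sx; rewrite -sub0r; apply: srB sr0 Sx. Qed.
Lemma srD x y : S x -> S y -> S (x + y).
Proof. by move=> Sx Sy; rewrite -[y]opprK; apply: srB Sx (srN Sy). Qed.
Lemma srX x n : S x -> S (x ^+ n).
Proof. by move=> Sx; elim: n => [|n IH]; [exact: sr1 | rewrite exprS; apply: srM]. Qed.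
Lemma sr_sum (X : Type) (r : seq X) (P : pred X) (F : X -> R) :
  (forall i, P i -> S (F i)) -> S (\sum_(i <- r | P i) F i).
Proof. by move=> h; apply: (big_ind S) => //; [exact: sr0 | exact: srD]. Qed.
Lemma sr_prod (X : Type) (r : seq X) (P : pred X) (F : X -> R) :
  (forall i, P i -> S (F i)) -> S (\prod_(i <- r | P i) F i).
Proof. by move=> h; apply: (big_ind S) => //; [exact: sr1 | exact: srM]. Qed.

End Closure.

Lemma idealI S I : I `<=` S -> I 0 -> (forall x y, I x -> I y -> I (x + y)) ->
  (forall s x, S s -> I x -> I (s * x)) -> ideal S I.
Proof. by move=> IS I0 ID IM; split=> //; split. Qed.

Section Ideal.
Variables (S I : set R).
Hypothesis iI : ideal S I.

Lemma idS x : I x -> S x. Proof. by case: iI => _; apply. Qed.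
Lemma id0 : I 0. Proof. by case: iI => -[]. Qed.
Lemma idD x y : I x -> I y -> I (x + y).
Proof. by case: iI => -[_ h _] _; apply: h. Qed.
Lemma idM s x : S s -> I x -> I (s * x).
Proof. by case: iI => -[_ _ h] _; apply: h. Qed.
Lemma idMr s x : S s -> I x -> I (x * s).
Proof. by rewrite mulrC; apply: idM. Qed.
Lemma id_sum (X : Type) (r : seq X) (P : pred X) (F : X -> R) :
  (forall i, P i -> I (F i)) -> I (\sum_(i <- r | P i) F i).
Proof. by move=> h; apply: (big_ind I) => //; [exact: id0 | exact: idD]. Qed.

Hypothesis sS : subring S.
Lemma idN x : I x -> I (- x).
Proof. by move=> Ix; rewrite -mulN1r; apply: idM => //; exact: srN (sr1 _). Qed.
Lemma idB x y : I x -> I y -> I (x - y).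
Proof. by move=> Ix Iy; apply: idD => //; apply: idN. Qed.
Lemma idX x n : I x -> (0 < n)%N -> I (x ^+ n).
Proof. by case: n => // n Ix _; rewrite exprS; apply: idMr => //; apply: srX => //; apply: idS. Qed.
End Ideal.

Lemma ideal_gen_sub S (E : set R) : E `<=` ideal_gen S E.
Proof. by move=> x Ex M _; apply. Qed.

Lemma ideal_gen_min S (E I : set R) : ideal S I -> E `<=` I -> ideal_gen S E `<=` I.
Proof. by move=> [hI _] EI x; apply. Qed.

Lemma ideal_gen_submod S (E : set R) : submodule S (ideal_gen S E : set R^o).
Proof.
split=> [M [] // | u v hu hv M hM EM | s v Ss hv M hM EM].
- by case: (hM) => _ hD _; exact: (hD _ _ (hu _ hM EM) (hv _ hM EM)).
- by case: (hM) => _ _ hs; exact: (hs _ _ Ss (hv _ hM EM)).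
Qed.

Lemma ideal_gen_ideal S (E : set R) : subring S -> E `<=` S -> ideal S (ideal_gen S E).
Proof.
move=> sS ES; split; first exact: ideal_gen_submod.
move=> x; apply => //; split=> [|u v|s v]; [exact: sr0|exact: srD|exact: srM].
Qed.

Lemma ideal_genS S (E F : set R) : E `<=` F -> ideal_gen S E `<=` ideal_gen S F.
Proof. by move=> EF x hx M hM FM; apply: hx => //; apply: subset_trans FM. Qed.

Lemma ideal_genMl S (E : set R) s x : S s -> ideal_gen S E x -> ideal_gen S E (s * x).
Proof. by case: (ideal_gen_submod S E) => _ _; apply. Qed.

Lemma ideal_genD S (E : set R) x y :
  ideal_gen S E x -> ideal_gen S E y -> ideal_gen S E (x + y).
Proof. by case: (ideal_gen_submod S E) => _ h _; apply: h. Qed.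

Lemma ideal_gen0 S (E : set R) : ideal_gen S E 0.
Proof. by case: (ideal_gen_submod S E). Qed.

Lemma ideal_gen_nil S x : ideal_gen S [set` [::]] x <-> x = 0.
Proof.
split=> [h|->]; last exact: ideal_gen0.
by apply: (h [set 0]) => //; split=> [|u v -> ->|s v _ ->] //=; rewrite ?addr0 ?scaler0.
Qed.

Lemma ideal_gen_cons S (a : R) (s : seq R) x : subring S ->
  ideal_gen S [set` a :: s] x <->
  exists r y, [/\ S r, ideal_gen S [set` s] y & x = r * a + y].
Proof.
move=> sS; split=> [h|[r [y [Sr hy ->]]]].
- apply: (h [set x | exists r y, [/\ S r, ideal_gen S [set` s] y & x = r * a + y]]).
  + split.
    * by exists 0, 0; split; [exact: sr0|exact: ideal_gen0|rewrite mul0r addr0].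
    * move=> _ _ [r [y [Sr hy ->]]] [r' [y' [Sr' hy' ->]]].
      exists (r + r'), (y + y'); split; [exact: srD|exact: ideal_genD|by ring].
    * move=> c _ Sc [r [y [Sr hy ->]]]; exists (c * r), (c * y); split.
      - exact: srM.
      - exact: ideal_genMl.
      - by rewrite /GRing.scale /=; ring.
  + move=> z /=; rewrite inE => /orP[/eqP->|zs].
      by exists 1, 0; split; [exact: sr1|exact: ideal_gen0|rewrite mul1r addr0].
    by exists 0, z; split; [exact: sr0|exact: ideal_gen_sub|rewrite mul0r add0r].
- apply: ideal_genD.
    by apply: ideal_genMl => //; apply: ideal_gen_sub; rewrite /= inE eqxx.
  by apply: ideal_genS hy => z /= zs; rewrite inE zs orbT.
Qed.

Lemma ideal_gen1P S (a : R) x : subring S ->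
  ideal_gen S [set a] x <-> exists2 r, S r & x = r * a.
Proof.
move=> sS; split=> [h|[r Sr ->]]; last by apply: ideal_genMl => //; apply: ideal_gen_sub.
apply: (h [set x | exists2 r, S r & x = r * a]).
  split; first by exists 0; [exact: sr0|rewrite mul0r].
    by move=> _ _ [r Sr ->] [r' Sr' ->]; exists (r + r'); [exact: srD|rewrite mulrDl].
  move=> c _ Sc [r Sr ->]; exists (c * r); [exact: srM|exact: mulrA].
by move=> _ ->; exists 1; [exact: sr1|rewrite mul1r].
Qed.

Lemma ideal_gen_seq2P S (a b : R) x : subring S -> ideal_gen S [set` [:: a; b]] x <->
  exists c d, [/\ S c, S d & x = c * a + d * b].
Proof.
move=> sS; rewrite ideal_gen_cons //; split=> [[c [y [Sc]]]|[c [d [Sc Sd ->]]]].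
  rewrite ideal_gen_cons // => -[d [z [Sd /ideal_gen_nil -> ->]] ->].
  by exists c, d; rewrite addr0.
exists c, (d * b); split=> //; rewrite ideal_gen_cons //; exists d, 0.
by split=> //; [apply/ideal_gen_nil|rewrite addr0].
Qed.

Lemma ideal_sum S I J : subring S -> ideal S I -> ideal S J ->
  ideal S [set x | exists y z, [/\ I y, J z & x = y + z]].
Proof.
move=> sS iI iJ; apply: idealI.
- by move=> _ [y [z [Iy Jz ->]]]; apply: srD => //; [exact: idS Iy|exact: idS Jz].
- by exists 0, 0; split; [exact: (id0 iI)|exact: (id0 iJ)|rewrite addr0].
- move=> _ _ [y [z [Iy Jz ->]]] [y' [z' [Iy' Jz' ->]]].
  by exists (y + y'), (z + z'); split; [exact: (idD iI)|exact: (idD iJ)|ring].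
- move=> s _ Ss [y [z [Iy Jz ->]]]; exists (s * y), (s * z).
  by split; [exact: (idM iI)|exact: (idM iJ)|ring].
Qed.

Lemma ideal_whole S : subring S -> ideal S S.
Proof.
move=> sS; apply: idealI => //; [exact: sr0|exact: srD|exact: srM].
Qed.

Lemma ideal_zero S : subring S -> ideal S [set 0].
Proof.
by move=> sS; apply: idealI => [x ->||x y -> ->|s x _ ->] //=; rewrite ?addr0 ?mulr0 //; exact: sr0.
Qed.

Lemma ideal_principal S a : subring S -> S a -> ideal S [set x | exists2 r, S r & x = r * a].
Proof.
move=> sS Sa; suff -> : [set x | exists2 r, S r & x = r * a] = ideal_gen S [set a].
  by apply: ideal_gen_ideal => // x ->.
by apply/seteqP; split=> x; rewrite ideal_gen1P.
Qed.

Lemma prime_ideal_ideal S P : prime_ideal S P -> ideal S P. Proof. by case. Qed.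

Lemma primeX S P x n : subring S -> prime_ideal S P -> S x -> P (x ^+ n) -> P x.
Proof.
move=> sS [iP P1 Pm] Sx; elim: n => [|n IH]; first by rewrite expr0.
by rewrite exprS => /Pm[]//; apply: srX.
Qed.

Lemma exists_prime_avoiding S J (T : set R) : subring S -> ideal S J ->
  T 1 -> (forall x y, T x -> T y -> T (x * y)) -> T `<=` S -> (forall x, T x -> ~ J x) ->
  exists P, [/\ prime_ideal S P, J `<=` P & forall x, T x -> ~ P x].
Proof.
move=> sS iJ T1 TM TS TJ.
pose F := [set I : set R | I = set0 \/ [/\ ideal S I, J `<=` I & forall x, T x -> ~ I x]].
have [P [FP Pmax]] : exists P, F P /\ forall B, P `<` B -> ~ F B.
  apply: Zorn_bigcup => G GF Gtot.
  have [[I GI [x Ix]]|nG] := pselect (exists2 I, G I & I !=set0); last first.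
    left; apply/seteqP; split=> // x [I GI Ix].
    by apply: nG; exists I => //; exists x.
  have G' L y : G L -> L y -> [/\ ideal S L, J `<=` L & forall x, T x -> ~ L x].
    by move=> GL Ly; case: (GF _ GL) => // L0; rewrite L0 in Ly.
  have [iI JI TI] := G' _ _ GI Ix.
  right; split.
  - apply: idealI.
    + by move=> y [L GL Ly]; have [iL _ _] := G' _ _ GL Ly; apply: idS Ly.
    + by exists I => //; apply: id0 iI.
    + move=> y z [L GL Ly] [L' GL' Lz].
      have [iL _ _] := G' _ _ GL Ly; have [iL' _ _] := G' _ _ GL' Lz.
      case: (Gtot _ _ GL GL') => LL.
        by exists L' => //; apply: (idD iL') => //; apply: LL.
      by exists L => //; apply: (idD iL) => //; apply: LL.
    + move=> s y Ss [L GL Ly]; have [iL _ _] := G' _ _ GL Ly.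
      by exists L => //; apply: (idM iL).
  - by move=> y Jy; exists I => //; apply: JI.
  - by move=> y Ty [L GL Ly]; have [_ _ TL] := G' _ _ GL Ly; exact: TL Ty Ly.
have {FP} [iP JP TP] : [/\ ideal S P, J `<=` P & forall x, T x -> ~ P x].
  case: FP => // P0; exfalso; apply: (Pmax J); last by right; split.
  by rewrite P0; split=> // /(_ 0 (id0 iJ)).
exists P; split=> //; split=> //; first exact: TP.
have ext x : S x -> ~ P x -> exists t p r, [/\ T t, P p, S r & t = p + r * x].
  move=> Sx nPx; apply: contrapT => h.
  pose P' := [set y | exists p q, [/\ P p, [set y | exists2 r, S r & y = r * x] q & y = p + q]].
  have iP' : ideal S P' by apply: ideal_sum => //; apply: ideal_principal.
  have PP' : P `<=` P'.
    by move=> y Py; exists y, 0; split=> //; [exists 0; [exact: sr0|rewrite mul0r]|rewrite addr0].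
  apply: (Pmax P').
    split=> // /(_ x) h'; apply/nPx/h'; exists 0, x; split; [exact: id0 iP| |by rewrite add0r].
    by exists 1; [exact: sr1|rewrite mul1r].
  right; split=> //; first exact: subset_trans PP'.
  by move=> y Ty [p [_ [Pp [r Sr ->] yE]]]; apply: h; exists y, p, r.
move=> x y Sx Sy Pxy; apply: contrapT => /not_orP[nPx nPy].
have [t [p [r [Tt Pp Sr tE]]]] := ext _ Sx nPx.
have [t' [p' [r' [Tt' Pp' Sr' tE']]]] := ext _ Sy nPy.
apply: (TP (t * t')); first exact: TM.
have -> : t * t' = t' * p + (r * x) * p' + (r * r') * (x * y) by rewrite tE tE'; ring.
have St' : S t' by apply: TS.
apply: (idD iP); first apply: (idD iP); apply: (idM iP) => //; exact: srM.
Qed.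

Lemma radical_prime S J x : subring S -> ideal S J -> S x ->
  (forall P, prime_ideal S P -> J `<=` P -> P x) -> exists n, J (x ^+ n).
Proof.
move=> sS iJ Sx h; apply: contrapT => nJ.
have [|y z [n ->] [m ->]|y [n ->]|y [n ->] Jx|P [hP JP TP]] :=
  @exists_prime_avoiding S J [set y | exists n, y = x ^+ n] sS iJ.
- by exists 0%N.
- by exists (n + m)%N; rewrite exprD.
- exact: srX.
- by apply: nJ; exists n.
- by apply: (TP x); [exists 1%N|apply: h].
Qed.

(** The union of a nonempty chain of members is a finitely generated ideal whose generators already
    lie in one member; that member is the union, so Zorn's lemma applies. *)
Lemma noetherian_max S (F : set (set R)) : subring S -> noetherian S ->
  (forall I, F I -> ideal S I) -> F !=set0 ->
  exists I, F I /\ forall J, F J -> I `<=` J -> J = I.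
Proof.
move=> sS nS hF [I0 FI0].
pose F' := [set I : set R | I = set0 \/ F I].
have [I [FI Imax]] : exists P, F' P /\ forall B, P `<` B -> ~ F' B.
  apply: Zorn_bigcup => G GF Gtot.
  have [[I GI [x Ix]]|nG] := pselect (exists2 I, G I & I !=set0); last first.
    left; apply/seteqP; split=> // x [I GI Ix].
    by apply: nG; exists I => //; exists x.
  have G' L y : G L -> L y -> F L.
    by move=> GL Ly; case: (GF _ GL) => // L0; rewrite L0 in Ly.
  have FI := G' _ _ GI Ix.
  pose U := \bigcup_(X in G) X.
  have iU : ideal S U.
    apply: idealI.
    + by move=> y [L GL Ly]; apply: idS (hF _ (G' _ _ GL Ly)) _ _.
    + by exists I => //; apply: id0 (hF _ FI).
    + move=> y z [L GL Ly] [L' GL' Lz].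
      have iL := hF _ (G' _ _ GL Ly); have iL' := hF _ (G' _ _ GL' Lz).
      case: (Gtot _ _ GL GL') => LL.
        by exists L' => //; apply: (idD iL') => //; apply: LL.
      by exists L => //; apply: (idD iL) => //; apply: LL.
    + by move=> s y Ss [L GL Ly]; exists L => //; apply: idM (hF _ (G' _ _ GL Ly)) _ _ _ _.
  have [s Us] := nS _ iU.
  have [L GL sL] : exists2 L, G L & {subset s <= L} /\ L !=set0.
    have : [set` s] `<=` U by rewrite Us; apply: ideal_gen_sub.
    elim: s {Us} => [|a s IH] sU; first by exists I => //; split=> //; exists x.
    have [|L GL [sL L0]] := IH; first by move=> z zs; apply: sU; rewrite /= inE zs orbT.
    have [|L' GL' L'a] := sU a; first by rewrite /= inE eqxx.
    case: (Gtot _ _ GL GL') => LL.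
      exists L' => //; split; last by exists a.
      move=> z; rewrite inE => /orP[/eqP->|/sL]; rewrite ?inE //; exact: LL.
    exists L => //; split=> // z; rewrite inE => /orP[/eqP->|/sL//]; rewrite inE; exact: LL.
  have FL : F L by case: sL => _ [y Ly]; apply: G' Ly.
  right; suff -> : \bigcup_(X in G) X = L by [].
  rewrite -/U; apply/seteqP; split; last by move=> y Ly; exists L.
  rewrite Us; apply: ideal_gen_min; first exact: hF.
  by move=> z zs; case: sL => /(_ _ zs); rewrite inE.
have FI' : F I.
  case: FI => // I0'; exfalso; apply: (Imax I0); last by right.
  by rewrite I0'; split=> // /(_ 0); apply; apply: id0 (hF _ FI0).
exists I; split=> // J FJ IJ; apply: contrapT => nJI; apply: (Imax J); last by right.
by split=> // JI; apply: nJI; apply/seteqP.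
Qed.

End SubringTheory.

(** * Adjunction, localization and Chevalley's theorem *)

Section FieldSubrings.
Variable K : fieldType.
Implicit Types (S T I J V P : set K) (x y z t : K) (p q : {poly K}).

Definition coefs_in S p := forall i, S p`_i.

Lemma coefs_inC S x : S 0 -> S x -> coefs_in S x%:P.
Proof. by move=> S0 Sx i; rewrite coefC; case: ifP. Qed.

Lemma coefs_inX S : subring S -> coefs_in S 'X.
Proof. by move=> sS i; rewrite coefX; case: (_ == _); [exact: sr1|exact: sr0]. Qed.

Lemma coefs_inD S p q : (forall x y, S x -> S y -> S (x + y)) ->
  coefs_in S p -> coefs_in S q -> coefs_in S (p + q).
Proof. by move=> SD hp hq i; rewrite coefD; apply: SD. Qed.

Lemma coefs_inM S p q : subring S -> coefs_in S p -> coefs_in S q -> coefs_in S (p * q).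
Proof. by move=> sS hp hq i; rewrite coefM; apply: (sr_sum sS) => j _; apply: srM. Qed.

Lemma coefs_inMl S I p q : ideal S I -> coefs_in S p -> coefs_in I q -> coefs_in I (p * q).
Proof. by move=> iI hp hq i; rewrite coefM; apply: (id_sum iI) => j _; apply: (idM iI). Qed.

Lemma coefs_inN S p : subring S -> coefs_in S p -> coefs_in S (- p).
Proof. by move=> sS hp i; rewrite coefN; apply: srN. Qed.

Lemma horner_in S p x : subring S -> coefs_in S p -> S x -> S p.[x].
Proof.
move=> sS hp Sx; rewrite horner_coef; apply: (sr_sum sS) => i _.
by apply: srM => //; apply: srX.
Qed.

Lemma horner_inI S I p x : subring S -> ideal S I -> coefs_in I p -> S x -> I p.[x].
Proof.
move=> sS iI hp Sx; rewrite horner_coef; apply: (id_sum iI) => i _.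
by apply: (idMr iI) => //; apply: srX.
Qed.

Definition adjoin S t : set K := [set x | exists2 p, coefs_in S p & x = p.[t]].

Lemma adjoin_subring S t : subring S -> subring (adjoin S t).
Proof.
move=> sS; split.
- by exists 1; [apply: (coefs_inC (sr0 sS) (sr1 sS))|rewrite hornerC].
- move=> _ _ [p hp ->] [q hq ->]; exists (p - q); last by rewrite hornerD hornerN.
  by apply: coefs_inD => //; [exact: srD|exact: coefs_inN].
- move=> _ _ [p hp ->] [q hq ->]; exists (p * q); last by rewrite hornerM.
  exact: coefs_inM.
Qed.

Lemma adjoin_sub S t : subring S -> S `<=` adjoin S t.
Proof. by move=> sS x Sx; exists x%:P; [exact: coefs_inC (sr0 sS) Sx|rewrite hornerC]. Qed.

Lemma adjoin_gen S t : subring S -> adjoin S t t.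
Proof. by move=> sS; exists 'X; [exact: coefs_inX|rewrite hornerX]. Qed.

Lemma adjoin_min S T t : subring T -> S `<=` T -> T t -> adjoin S t `<=` T.
Proof. by move=> sT ST Tt _ [p hp ->]; apply: horner_in => // i; apply: ST. Qed.

Fixpoint adjoins S (s : seq K) : set K := if s is t :: s' then adjoins (adjoin S t) s' else S.

Lemma adjoins_subring S s : subring S -> subring (adjoins S s).
Proof. by elim: s S => //= t s IH S sS; apply/IH/adjoin_subring. Qed.

Lemma adjoins_sub S s : subring S -> S `<=` adjoins S s.
Proof.
elim: s S => [|t s IH] S sS /=; first by [].
apply: subset_trans (@adjoin_sub S t sS) _.
by apply/IH/adjoin_subring.
Qed.

Lemma adjoins_gen S s : subring S -> {in s, forall t, adjoins S s t}.
Proof.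
elim: s S => //= t s IH S sS x; rewrite inE => /orP[/eqP->|]; last first.
  exact: IH (adjoin_subring t sS) x.
by apply: adjoins_sub; [exact: adjoin_subring|exact: adjoin_gen].
Qed.

Lemma adjoins_min S T s : subring T -> S `<=` T -> {in s, forall t, T t} -> adjoins S s `<=` T.
Proof.
move=> sT; elim: s S => //= t s IH S ST Ts; apply: IH.
  by apply: adjoin_min => //; apply: Ts; rewrite inE eqxx.
by move=> x xs; apply: Ts; rewrite inE xs orbT.
Qed.

Lemma subalgebra_genE S s : subring S -> subalgebra_gen S s = adjoins S s.
Proof.
move=> sS; apply/seteqP; split=> x.
  by apply; [exact: adjoins_subring|exact: adjoins_sub|exact: adjoins_gen].
by move=> hx T sT ST Ts; apply: adjoins_min hx.
Qed.

(** Localization is formed inside [K], so that it can be compared with other subrings. For [P :=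
    [set 0]], membership says that f is a fraction of elements of [S]. *)
Definition loc S P : set K := [set f | exists a s, [/\ S a, S s, ~ P s & f = a / s]].

Lemma nonunitsE S x : subring S -> nonunits S x <-> S x /\ (x = 0 \/ ~ S x^-1).
Proof.
move=> sS; split=> -[Sx h]; split=> //.
  have [->|x0] := eqVneq x 0; [by left|right=> Sx1; apply: h].
  by exists x^-1 => //; rewrite divff.
case: h => [-> [y _ /esym/eqP]|h [y Sy xy]]; first by rewrite mul0r oner_eq0.
by apply: h; rewrite -[x^-1]mulr1 -xy mulKf //; apply: contra_eq_neq xy => ->; rewrite mul0r eq_sym oner_eq0.
Qed.

Lemma unit_inv S x : S x -> ~ nonunits S x -> x != 0 /\ S x^-1.
Proof.
move=> Sx nx; have [y Sy xy] : exists2 y, S y & x * y = 1.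
  by apply: contrapT => h; apply: nx.
have x0 : x != 0 by apply: contra_eq_neq xy => ->; rewrite mul0r eq_sym oner_eq0.
by split=> //; rewrite -[x^-1]mulr1 -xy mulKf.
Qed.

Lemma nonunits_inv S x : nonunits S x -> x != 0 -> ~ S x^-1.
Proof. by move=> [Sx h] x0 Sx1; apply: h; exists x^-1 => //; rewrite divff. Qed.

Lemma nonunits1 S : S 1 -> ~ nonunits S 1.
Proof. by move=> S1 [_]; apply; exists 1; rewrite ?mulr1. Qed.

Section Chevalley.
Variables (S : set K) (J : set K).
Hypotheses (sS : subring S) (JS : J `<=` S) (J1 : ~ ideal_gen S J 1).

Let F V := [/\ subring V, S `<=` V & ~ ideal_gen V J 1].

Lemma chevalley_max : exists V, F V /\ forall W, F W -> V `<=` W -> W `<=` V.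
Proof.
pose F' := [set V : set K | V = set0 \/ F V].
have [V [FV Vmax]] : exists P, F' P /\ forall B, P `<` B -> ~ F' B.
  apply: Zorn_bigcup => G GF Gtot.
  have [[V GV [x Vx]]|nG] := pselect (exists2 I, G I & I !=set0); last first.
    left; apply/seteqP; split=> // x [I GI Ix].
    by apply: nG; exists I => //; exists x.
  have G' L y : G L -> L y -> F L.
    by move=> GL Ly; case: (GF _ GL) => // L0; rewrite L0 in Ly.
  have [sV SV V1] := G' _ _ GV Vx.
  have Gmax L L' y y' : G L -> L y -> G L' -> L' y' -> exists M, [/\ G M, F M, L `<=` M & L' `<=` M].
    move=> GL Ly GL' Ly'; case: (Gtot _ _ GL GL') => LL.
      by exists L'; split=> //; apply: G' Ly'.
    by exists L; split=> //; apply: G' Ly.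
  right; split.
  - split.
    + by exists V => //; apply: sr1.
    + move=> y z [L GL Ly] [L' GL' Lz]; have [M [GM [sM _ _] LM LM']] := Gmax _ _ _ _ GL Ly GL' Lz.
      by exists M => //; apply: srB => //; [apply: LM|apply: LM'].
    + move=> y z [L GL Ly] [L' GL' Lz]; have [M [GM [sM _ _] LM LM']] := Gmax _ _ _ _ GL Ly GL' Lz.
      by exists M => //; apply: srM => //; [apply: LM|apply: LM'].
  - by move=> y Sy; exists V => //; apply: SV.
  - pose N := [set y | exists L, [/\ G L, F L & ideal_gen L J y]].
    have up L L' y : L `<=` L' -> ideal_gen L J y -> ideal_gen L' J y.
      move=> LL' h M [M0 MD MZ] JM; apply: h => //; split=> // s v Ls; apply: MZ; exact: LL'.
    suff NN : submodule (\bigcup_(X in G) X) (N : set K^o).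
      move=> h; have [|L [GL [_ _ L1] h1]] := h N NN; last exact: L1.
      by move=> y Jy; exists V; split=> //; apply: ideal_gen_sub.
    split.
    + by exists V; split=> //; apply: ideal_gen0.
    + move=> y z [L [GL FL Ly]] [L' [GL' FL' Lz]].
      have [sL _ _] := FL; have [sL' _ _] := FL'.
      have [M [GM FM LM LM']] := Gmax _ _ _ _ GL (sr1 sL) GL' (sr1 sL').
      by exists M; split=> //; apply: ideal_genD; [exact: up Ly|exact: up Lz].
    + move=> s y [L GL Ls] [L' [GL' FL' Lz]]; have [sL' _ _] := FL'.
      have [M [GM FM LM LM']] := Gmax _ _ _ _ GL Ls GL' (sr1 sL').
      by exists M; split=> //; apply: ideal_genMl; [exact: LM|exact: up Lz].
have FS : F S by split.
have FV' : F V.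
  case: FV => // V0; exfalso; apply: (Vmax S); last by right.
  by rewrite V0; split=> // /(_ 1 (sr1 sS)).
exists V; split=> // W FW VW; apply: contrapT => nWV.
by apply: (Vmax W); [split|right].
Qed.

(** [V] is maximal among the overrings in which [J] does not generate the unit ideal. If neither z
    nor 1/z were in [V], maximality would write 1 both as a polynomial in z and as one in 1/z, with
    coefficients in the ideal generated by [J]; the descent on degrees in [main] excludes this. *)
Lemma chevalley : exists V, [/\ valuation_ring V, S `<=` V & J `<=` nonunits V].
Proof.
have [V [[sV SV V1] Vmax]] := chevalley_max.
have JV : J `<=` V by apply: subset_trans SV.
pose G := ideal_gen V J; have iG : ideal V G by apply: ideal_gen_ideal.
exists V; split=> //; last first.
  move=> j Jj; split; first exact: JV.
  by move=> [y Vy jy]; apply: V1; rewrite -jy mulrC; apply: ideal_genMl => //; apply: ideal_gen_sub.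
have unitG a : G a -> 1 - a != 0 /\ V (1 - a)^-1.
  move=> Ga; have a1 : 1 - a != 0.
    by apply: contra_notN V1; rewrite subr_eq0 => /eqP ->.
  split=> //; set e := 1 - a.
  have Ve : V e by apply: srB => //; [exact: sr1|exact: idS Ga].
  (* [W'] is [V] with 1 - a inverted. Since 1 - a is 1 modulo [G], the ideal generated by [J] stays
     proper there, and maximality makes [W'] equal to [V]. *)
  pose W' := [set x | exists n, V (e ^+ n * x)].
  apply: (Vmax W'); last 2 first.
  - by move=> x Vx; exists 0%N; rewrite mul1r.
  - by exists 1%N; rewrite expr1 divff //; apply: sr1.
  have cl x n m : V (e ^+ n * x) -> V (e ^+ (n + m) * x).
    by move=> h; rewrite exprD mulrAC mulrC; apply: srM => //; apply: srX.
  split.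
  - split.
    + by exists 0%N; rewrite mul1r; apply: sr1.
    + move=> x y [n hx] [m hy]; exists (n + m)%N; rewrite mulrBr; apply: srB => //.
        exact: cl.
      by rewrite addnC; apply: cl.
    + move=> x y [n hx] [m hy]; exists (n + m)%N; rewrite exprD.
      have -> : e ^+ n * e ^+ m * (x * y) = (e ^+ n * x) * (e ^+ m * y) by ring.
      exact: srM.
  - by move=> x Sx; exists 0%N; rewrite mul1r; apply: SV.
  - move=> h; have [||n] := h [set x | exists n, G (e ^+ n * x)].
    + have cl' x n m : G (e ^+ n * x) -> G (e ^+ (n + m) * x).
        move=> hx; rewrite exprD mulrAC mulrC; apply: (idM iG) => //; exact: srX.
      split.
      * by exists 0%N; rewrite mulr0; apply: id0 iG.
      * move=> x y [n hx] [m hy]; exists (n + m)%N; rewrite mulrDr; apply: (idD iG).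
          exact: cl'.
        by rewrite addnC; apply: cl'.
      * move=> s x [m hs] [n hx]; exists (m + n)%N; rewrite exprD.
        have -> : e ^+ m * e ^+ n * (s *: x) = (e ^+ m * s) * (e ^+ n * x).
          by rewrite /GRing.scale /=; ring.
        exact: (idM iG).
    + by move=> j Jj; exists 0%N; rewrite mul1r; apply: ideal_gen_sub.
    + rewrite mulr1 => Gn; apply: V1.
      suff : G (1 - e ^+ n) by move=> /(idD iG)/(_ Gn); rewrite subrK.
      elim: n {Gn} => [|n IH]; first by rewrite subrr; apply: id0 iG.
      have -> : 1 - e ^+ n.+1 = a + e * (1 - e ^+ n) by rewrite exprS /e; ring.
      by apply: (idD iG) => //; apply: (idM iG).
have main N : forall z p q, z != 0 -> (size p + size q <= N)%N ->
    coefs_in G p -> coefs_in G q -> p.[z] = 1 -> q.[z^-1] = 1 -> False.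
  elim: N => [|N IH] z p q z0.
    rewrite leqn0 addn_eq0 size_poly_eq0 => /andP[/eqP -> _] _ _.
    by rewrite horner0 => /esym/eqP; rewrite oner_eq0.
  wlog spq : z p q z0 / (size q <= size p)%N.
    move=> W; case/orP: (leq_total (size q) (size p)) => [h|h sN hp hq p1 q1]; first exact: W.
    by apply: (W z^-1 q p) => //; rewrite ?invr_eq0 ?invrK // addnC.
  move=> sN hp hq p1 q1.
  have [c0 Vc] := unitG _ (hq 0%N); set c := 1 - q`_0 in c0 Vc.
  case En : (size p) => [|n].
    by move/eqP: En p1; rewrite size_poly_eq0 => /eqP ->; rewrite horner0 => /esym/eqP; rewrite oner_eq0.
  (* The relation q(1/z) = 1, multiplied by z^n, writes c z^n as the sum of the terms q_(n-j) z^j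
     with j < n; substituting this for the top term of p lowers its degree. *)
  pose r := \poly_(j < n) (p`_j + p`_n * (c^-1 * q`_(n - j))).
  apply: (IH z r q) => //.
  - move: sN; rewrite En addSn ltnS => sN; apply: leq_trans sN; rewrite leq_add2r.
    exact: size_poly.
  - move=> j; rewrite coef_poly; case: ifP => _; last exact: id0 iG.
    apply: (idD iG) => //; apply: (idM iG); first exact: (idS iG).
    by apply: (idM iG).
  rewrite horner_poly; under eq_bigr do rewrite mulrDl.
  rewrite big_split /=.
  have -> : \sum_(i < n) p`_n * (c^-1 * q`_(n - i)) * z ^+ i = p`_n * z ^+ n.
    have qE : c = \sum_(i < n) q`_(n - i) * z ^- (n - i).
      have -> : c = \sum_(i < n.+1) q`_i * z^-1 ^+ i - q`_0.
        rewrite /c -q1; congr (_ - _).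
        by rewrite (@horner_coef_wide _ n.+1) // -En.
      rewrite big_ord_recl expr0 mulr1 addrAC subrr add0r.
      rewrite (reindex_inj rev_ord_inj) /=; apply: eq_bigr => i _.
      by rewrite /bump /= add1n -subSn // subSS exprVn.
    under eq_bigr => i _.
      have -> : p`_n * (c^-1 * q`_(n - i)) * z ^+ i = p`_n * c^-1 * z ^+ n * (q`_(n - i) * z ^- (n - i)).
        have -> : z ^+ i = z ^+ n * z ^- (n - i).
          by rewrite -{2}(subnK (ltnW (ltn_ord i))) exprD mulrAC divff ?mul1r // expf_neq0.
        ring.
      over.
    rewrite -mulr_sumr -qE; field => //.
  by rewrite -p1 horner_coef En big_ord_recr.
split=> // z; have [z0|z0] := eqVneq z 0; first by left; rewrite z0; apply: sr0.
apply: contrapT => /not_orP[Vz Vz1].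
have ext w : ~ V w -> exists p, [/\ coefs_in G p & p.[w] = 1].
  move=> Vw; have sA := adjoin_subring w sV.
  have h : ideal_gen (adjoin V w) J 1.
    apply: contrapT => h; apply: Vw.
    apply: (Vmax (adjoin V w)); [|exact: adjoin_sub|exact: adjoin_gen].
    by split=> //; apply: subset_trans SV _; apply: adjoin_sub.
  have [||p hp p1] := h [set x | exists2 p, coefs_in G p & x = p.[w]].
  - split.
    + by exists 0; [move=> i; rewrite coef0; apply: id0 iG|rewrite horner0].
    + move=> _ _ [p hp ->] [q hq ->]; exists (p + q); last by rewrite hornerD.
      by apply: coefs_inD => //; apply: (idD iG).
    + move=> _ _ [p hp ->] [q hq ->]; exists (p * q); last by rewrite hornerM.
      exact: coefs_inMl iG _ _.
  - move=> j Jj; exists j%:P; last by rewrite hornerC.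
    apply: coefs_inC; [exact: id0 iG|exact: ideal_gen_sub].
  - by exists p.
have [p [hp p1]] := ext _ Vz; have [q [hq q1]] := ext _ Vz1.
exact: (main _ _ _ _ z0 (leqnn _) hp hq p1 q1).
Qed.

End Chevalley.
End FieldSubrings.

(** * Modules of finite length *)

Section Length.
Variables (R : comPzRingType) (V : lmodType R) (S : set R).
Hypothesis sS : subring S.
Implicit Types (M N D W : set V).

Lemma submoduleB D u v : submodule S D -> D u -> D v -> D (u - v).
Proof.
move=> [D0 DD DZ] Du Dv; apply: DD => //; rewrite -scaleN1r; apply: DZ => //.
exact: srN (sr1 sS).
Qed.

Lemma submodule_add D (w : V) : submodule S D ->
  submodule S [set u | exists c s, [/\ D c, S s & u = c + s *: w]].
Proof.
move=> [D0 DD DZ]; split.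
- by exists 0, 0; split; [|exact: sr0|rewrite scale0r addr0].
- move=> _ _ [c [s [Dc Ss ->]]] [c' [s' [Dc' Ss' ->]]]; exists (c + c'), (s + s').
  by split; [exact: DD|exact: srD|rewrite scalerDl addrACA].
- move=> r _ Sr [c [s [Dc Ss ->]]]; exists (r *: c), (r * s).
  by split; [exact: DZ|exact: srM|rewrite scalerDr scalerA].
Qed.

Variables (M N : set V) (n : nat) (C : nat -> set V).
Hypotheses (C0 : C 0%N = N) (Cn : C n = M).
Hypothesis subC : forall i, (i <= n)%N -> submodule S (C i).
Hypothesis simC : forall i, (i < n)%N -> proper (C i) (C i.+1) /\
          forall W, submodule S W -> C i `<=` W -> W `<=` C i.+1 ->
            W = C i \/ W = C i.+1.

Lemma composition_factor_simple i w v : (i < n)%N -> C i.+1 w -> ~ C i w -> C i.+1 v ->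
  exists c s, [/\ C i c, S s & v = c + s *: w].
Proof.
move=> ltin Cw nCw Cv.
pose W := [set u | exists c s, [/\ C i c, S s & u = c + s *: w]].
have [[CC _] sim] := simC ltin.
have [Ci0 CiD CiZ] := subC (ltnW ltin); have [Cj0 CjD CjZ] := subC ltin.
have [| | |WC|WC] := sim W.
- by apply: submodule_add; apply: subC; apply: ltnW.
- by move=> c Cc; exists c, 0; split=> //; [exact: sr0|rewrite scale0r addr0].
- by move=> _ [c [s [Cc Ss ->]]]; apply: CjD; [exact: CC|exact: CjZ].
- exfalso; apply: nCw; rewrite -WC; exists 0, 1; split=> //; first exact: sr1.
  by rewrite scale1r add0r.
- by move: Cv; rewrite -WC.
Qed.

(* The number of composition factors that D meets; a strictly monotone function of D. *)
Definition jumps D : nat :=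
  \sum_(i < n) (`[< exists v, [/\ D v, C i.+1 v & ~ C i v] >] : nat).

Lemma jumps_leq D : (jumps D <= n)%N.
Proof.
rewrite -[X in (_ <= X)%N]card_ord -sum1_card; apply: leq_sum => i _; exact: leq_b1.
Qed.

Lemma jumps_mono D D' : D `<=` D' -> (jumps D <= jumps D')%N.
Proof.
move=> DD'; apply: leq_sum => i _; case: asboolP => // -[v [Dv Cv nCv]].
by case: asboolP => // -[]; exists v; split=> //; apply: DD'.
Qed.

(** By induction on i, [D'] and [C i] meet inside [D]: once [D] meets the simple factor above [C i],
    an element of [D'] in [C i.+1] is moved into [C i] by subtracting a multiple of an element of
    [D]. *)
Lemma jumps_inj D D' : submodule S D -> submodule S D' -> N `<=` D -> D' `<=` M ->
  D `<=` D' -> jumps D = jumps D' -> D' `<=` D.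
Proof.
move=> sD sD' ND D'M DD' jE.
have jmp i (ltin : (i < n)%N) v : D' v -> C i.+1 v -> ~ C i v ->
    exists w, [/\ D w, C i.+1 w & ~ C i w].
  move=> D'v Cv nCv; apply: contrapT => h.
  suff : (jumps D < jumps D')%N by rewrite jE ltnn.
  rewrite /jumps (bigD1 (Ordinal ltin)) //= [X in (_ < X)%N](bigD1 (Ordinal ltin)) //=.
  case: asboolP => // _; case: asboolP => [_|[]]; last by exists v.
  rewrite add0n add1n ltnS; apply: leq_sum => j _; case: asboolP => // -[u [Du Cu nCu]].
  by case: asboolP => // -[]; exists u; split=> //; apply: DD'.
suff main i v : (i <= n)%N -> D' v -> C i v -> D v.
  by move=> v D'v; apply: (main n) => //; rewrite Cn; apply: D'M.
elim: i v => [|i IH] v ltin D'v Cv; first by apply: ND; rewrite -C0.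
have [Civ|nCiv] := pselect (C i v); first exact: IH (ltnW ltin) D'v Civ.
have [w [Dw Cw nCw]] := jmp _ ltin _ D'v Cv nCiv.
have [c [s [Cc Ss vE]]] := composition_factor_simple ltin Cw nCw Cv.
case: (sD) => _ DD DZ; rewrite vE; apply: DD; last exact: DZ.
apply: IH (ltnW ltin) _ Cc.
have -> : c = v - s *: w by rewrite vE addrK.
by apply: (submoduleB sD') => //; case: sD' => _ _; apply=> //; apply: DD'.
Qed.

End Length.

Section LengthTheory.
Variables (R : comPzRingType) (V : lmodType R) (S : set R).
Hypothesis sS : subring S.
Implicit Types (M N D W : set V).

Lemma length_chain_bound M N n (D : nat -> set V) : quotient_has_length S M N n ->
  (forall i, (i <= n.+1)%N -> submodule S (D i)) -> N `<=` D 0%N -> D n.+1 `<=` M ->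
  (forall i, (i <= n)%N -> proper (D i) (D i.+1)) -> False.
Proof.
move=> [C [C0 Cn subC simC]] sD ND DM pD.
have up i : (i <= n.+1)%N -> D i `<=` M /\ N `<=` D i.
  move=> lin; split.
    suff h k : (k <= n.+1)%N -> D (n.+1 - k)%N `<=` M.
      by have := h (n.+1 - i)%N (leq_subr _ _); rewrite subKn.
    elim: k => [|k IH] lk; first by rewrite subn0.
    have [|h _] := pD (n.+1 - k.+1)%N; first by rewrite subSS leq_subr.
    by apply: subset_trans h _; rewrite subnSK //; apply: IH; apply: ltnW.
  elim: i lin => [//|i IH] lin; apply: subset_trans (IH (ltnW lin)) _.
  by case: (pD i).
have jl i : (i <= n.+1)%N -> (i <= jumps n C (D i))%N.
  elim: i => [//|i IH] lin; apply: leq_ltn_trans (IH (ltnW lin)) _.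
  have [DD nDD] := pD i lin.
  rewrite ltn_neqAle jumps_mono // andbT; apply/eqP => E; apply: nDD.
  have [h1 h2] := up i (ltnW lin); have [h3 h4] := up i.+1 lin.
  exact: (jumps_inj sS C0 Cn subC simC (sD _ (ltnW lin)) (sD _ lin)).
by have := jl n.+1 (leqnn _); rewrite leqNgt ltnS jumps_leq.
Qed.

Lemma length_dcc M N n (D : nat -> set V) : quotient_has_length S M N n ->
  (forall i, submodule S (D i)) -> (forall i, N `<=` D i) -> (forall i, D i `<=` M) ->
  (forall i, D i.+1 `<=` D i) -> exists i, D i `<=` D i.+1.
Proof.
move=> [C [C0 Cn subC simC]] sD ND DM dD; apply: contrapT => h.
have lt i : (jumps n C (D i.+1) < jumps n C (D i))%N.
  rewrite ltn_neqAle jumps_mono // andbT; apply/eqP => E; apply: h; exists i.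
  exact: (jumps_inj sS C0 Cn subC simC (sD i.+1) (sD i)).
have : (n.+1 <= jumps n C (D 0%N))%N.
  suff : forall i, (i + jumps n C (D i) <= jumps n C (D 0%N))%N.
    by move=> /(_ n.+1); apply: leq_trans; rewrite leq_addr.
  by elim=> [//|i IH]; apply: leq_trans IH; rewrite addSn -addnS leq_add2l lt.
by rewrite leqNgt ltnS jumps_leq.
Qed.

Lemma local_unit (S' : set R) x : subring S' -> local_ring S' -> nonunits S' x ->
  exists2 y, S' y & (1 - x) * y = 1.
Proof.
move=> sS' lS nx; apply: contrapT => h; have : nonunits S' (1 - x).
  by split=> //; apply: srB => //; [exact: sr1|case: nx].
move=> /(idD lS)/(_ nx); rewrite subrK => -[_]; apply.
by exists 1; rewrite ?mulr1 //; apply: sr1.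
Qed.

(** A nonunit kills every simple factor: if b v were nonzero in one, then v = c + s b v with c in
    the smaller term of the series, and 1 - s b is invertible. *)
Lemma finite_length_nilpotent M N n b : local_ring S -> nonunits S b ->
  quotient_has_length S M N n -> forall v, M v -> N (b ^+ n *: v).
Proof.
move=> lS nb [C [C0 Cn subC simC]].
suff main i v : (i <= n)%N -> C i v -> C 0%N (b ^+ i *: v).
  by move=> v; rewrite -Cn -C0; apply: main.
elim: i v => [|i IH] v ltin Cv; first by rewrite scale1r.
rewrite exprSr -scalerA; apply: IH (ltnW ltin) _.
apply: contrapT => nC; have [Sb _] := nb.
have [Cj0 CjD CjZ] := subC _ ltin; have sCi := subC _ (ltnW ltin); have [Ci0 CiD CiZ] := sCi.
have [|c [s [Cc Ss vE]]] := @composition_factor_simple _ _ _ sS n C subC simC i _ v ltin _ nC Cv.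
  exact: CjZ.
have nbs : nonunits S (s * b) by apply: (idM lS).
have [y Sy yE] := local_unit sS lS nbs.
apply: nC; apply: (CiZ) => //.
have -> : v = y *: c; last exact: CiZ.
have -> : c = (1 - s * b) *: v by rewrite scalerBl scale1r -scalerA {1}vE addrK.
by rewrite scalerA mulrC yE scale1r.
Qed.

End LengthTheory.

(** * Noetherian local rings and the principal ideal theorem *)

Section IdealPowers.
Variables (R : comPzRingType) (S : set R).
Hypothesis sS : subring S.
Implicit Types (I J : set R) (x y : R).

Lemma ideal_mul_ideal I J : ideal S I -> ideal S J -> ideal S (ideal_mul S I J).
Proof.
move=> iI iJ; apply: ideal_gen_ideal => // _ [x [y [Ix Jy ->]]].
by apply: srM => //; [exact: idS Ix|exact: idS Jy].
Qed.

Lemma ideal_mulS I J x y : I x -> J y -> ideal_mul S I J (x * y).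
Proof. by move=> Ix Jy; apply: ideal_gen_sub; exists x, y. Qed.

Lemma ideal_mul_min I J M : ideal S M -> (forall x y, I x -> J y -> M (x * y)) ->
  ideal_mul S I J `<=` M.
Proof. by move=> iM h; apply: ideal_gen_min => // _ [x [y [Ix Jy ->]]]; apply: h. Qed.

Lemma ideal_pow_ideal I n : ideal S I -> ideal S (ideal_pow S I n).
Proof.
by move=> iI; elim: n => [|n IH]; [exact: ideal_whole|exact: ideal_mul_ideal].
Qed.

Lemma ideal_powX I x n : I x -> ideal_pow S I n (x ^+ n).
Proof.
move=> Ix; elim: n => [|n IH]; first exact: sr1.
by rewrite exprS; apply: ideal_mulS.
Qed.

Lemma ideal_powSsub I n : ideal S I -> ideal_pow S I n.+1 `<=` ideal_pow S I n.
Proof.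
move=> iI; apply: ideal_mul_min; first exact: ideal_pow_ideal.
by move=> x y Ix; apply: (idM (ideal_pow_ideal n iI)); apply: idS Ix.
Qed.

End IdealPowers.

Section LocalRings.
Variable K : fieldType.
Implicit Types (S I J M N P : set K) (x y : K).

Section Nakayama.
Variable S : set K.
Hypotheses (sS : subring S) (lS : local_ring S).

(** Generators of [M] modulo [N] are removed one at a time: the first satisfies a = n + m a + y with
    m a nonunit and y in the span of the others, and 1 - m is a unit. *)
Lemma nakayama_seq (s : seq K) M N : ideal S M -> ideal S N -> {in s, forall x, M x} ->
  (forall x, M x -> exists y z, [/\ N y, ideal_gen S [set` s] z & x = y + z]) ->
  (forall x, M x -> exists y z, [/\ N y, ideal_mul S (nonunits S) M z & x = y + z]) ->
  M `<=` N.
Proof.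
move=> iM iN sM hs hm; elim: s sM hs => [|a s IH] sM hs.
  by move=> x /hs[y [z [Ny /ideal_gen_nil -> ->]]]; rewrite addr0.
apply: IH; first by move=> x xs; apply: sM; rewrite inE xs orbT.
have aM : M a by apply: sM; rewrite inE eqxx.
have gS x : ideal_gen S [set` s] x -> S x.
  apply: ideal_gen_min => [|z zs]; first exact: ideal_whole.
  by apply: idS iM _ _; apply: sM; rewrite inE zs orbT.
have main z : ideal_mul S (nonunits S) M z ->
    exists n m y, [/\ N n, nonunits S m, ideal_gen S [set` s] y & z = n + m * a + y].
  move: z; apply: (@ideal_mul_min _ S (nonunits S) M [set z | exists n m y, [/\ N n, nonunits S m, ideal_gen S [set` s] y & z = n + m * a + y]]).
    apply: idealI.
    - move=> _ [n [m [y [Nn mm gy ->]]]]; apply: srD => //; last exact: gS.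
      apply: srD => //; [exact: idS Nn|apply: srM => //; [exact: idS mm|exact: idS aM]].
    - exists 0, 0, 0; split; [exact: id0 iN|exact: id0 lS|exact: ideal_gen0|by ring].
    - move=> _ _ [n [m [y [Nn mm gy ->]]]] [n' [m' [y' [Nn' mm' gy' ->]]]].
      exists (n + n'), (m + m'), (y + y').
      by split; [exact: (idD iN)|exact: (idD lS)|exact: ideal_genD|ring].
    - move=> c _ Sc [n [m [y [Nn mm gy ->]]]]; exists (c * n), (c * m), (c * y).
      by split; [exact: (idM iN)|exact: (idM lS)|exact: ideal_genMl|ring].
  move=> m x mm /hs[n [_ [Nn /(ideal_gen_cons _ _ _ sS)[r [y [Sr gy ->]]] ->]]].
  have Sm : S m by case: mm.
  exists (m * n), (r * m), (m * y); split.
  - exact: (idM iN).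
  - exact: (idM lS).
  - exact: ideal_genMl.
  - by ring.
have [n [m [y [Nn mm gy aE]]]] : exists n m y, [/\ N n, nonunits S m, ideal_gen S [set` s] y & a = n + m * a + y].
  have [n [z [Nn /main[n' [m [y [Nn' mm gy ->]]]] aE]]] := hm _ aM.
  by exists (n + n'), m, y; split=> //; [exact: (idD iN)|rewrite {1}aE; ring].
have [u Su uE] := local_unit sS lS mm.
have aE' : a = u * n + u * y.
  have -> : u * n + u * y = u * ((n + m * a + y) - m * a) by ring.
  by rewrite -aE -{1}[a]mul1r -uE; ring.
move=> x /hs[n' [_ [Nn' /(ideal_gen_cons _ _ _ sS)[r [y' [Sr gy' ->]]] ->]]].
exists (n' + r * (u * n)), (r * (u * y) + y'); split; last by rewrite {1}aE'; ring.
- by apply: (idD iN) => //; do 2!apply: (idM iN) => //.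
- by apply: ideal_genD => //; do 2!apply: ideal_genMl => //.
Qed.

Lemma nakayama M N : noetherian S -> ideal S M -> ideal S N ->
  (forall x, M x -> exists y z, [/\ N y, ideal_mul S (nonunits S) M z & x = y + z]) ->
  M `<=` N.
Proof.
move=> nS iM iN h; have [s sE] := nS _ iM.
apply: (nakayama_seq (s := s)) => // [x xs|x Mx].
  by rewrite sE; apply: ideal_gen_sub.
by exists 0, x; rewrite -sE add0r; split=> //; apply: id0 iN.
Qed.

(** An annihilator that is maximal among those of nonzero elements of S/J is prime: this is the
    existence of an associated prime. *)
Lemma maximal_colon_prime J : noetherian S -> ideal S J -> ~ J 1 ->
  exists2 f, S f /\ ~ J f & prime_ideal S [set x | S x /\ J (x * f)].
Proof.
move=> nS iJ J1; pose C f := [set x | S x /\ J (x * f)].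
have iC f : S f -> ideal S (C f).
  move=> Sf; apply: idealI.
  - by move=> x [].
  - by split; [exact: sr0|rewrite mul0r; apply: id0 iJ].
  - by move=> x y [Sx Jx] [Sy Jy]; split; [exact: srD|rewrite mulrDl; apply: (idD iJ)].
  - move=> s x Ss [Sx Jx]; split; first exact: srM.
    by rewrite -mulrA; apply: (idM iJ).
have [||_ [[f [Sf nJf ->] fmax]]] :=
  @noetherian_max _ S [set I | exists f, [/\ S f, ~ J f & I = C f]] sS nS.
- by move=> _ [f [Sf _ ->]]; apply: iC.
- by exists (C 1), 1; split=> //; apply: sr1.
exists f => //; split; [exact: iC|by rewrite /C /= mul1r => -[]|].
move=> x y Sx Sy [_ Jxy]; have [Jyf|nJyf] := pselect (J (y * f)); [by right|left].
suff : C f x by [].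
have -> : C f = C (y * f).
  apply/esym; apply: fmax.
    by exists (y * f); split=> //; apply: srM.
  move=> z [Sz Jz]; split=> //.
  have -> : z * (y * f) = y * (z * f) by ring.
  exact: (idM iJ).
by split; rewrite // mulrA.
Qed.

(** Let I be a maximal counterexample. An associated prime of S/I contains all nonunits, so I + (f)
    over I is a simple factor, and it can be put below a composition series of S over I + (f). *)
Lemma finite_length_primary J : noetherian S -> ideal S J ->
  (forall x, nonunits S x -> exists n, J (x ^+ n)) ->
  exists n, quotient_has_length S (S : set K^o) J n.
Proof.
move=> nS iJ hJ; apply: contrapT => nlJ.
have [||I [[iI JI nlI] Imax]] := @noetherian_max _ S
  [set I | [/\ ideal S I, J `<=` I & ~ exists n, quotient_has_length S (S : set K^o) I n]] sS nS.
- by move=> I [].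
- by exists J; split.
have [I1|I1] := pselect (I 1).
  apply: nlI; exists 0%N, (fun=> I); split=> //.
    apply/seteqP; split=> x; first exact: idS iI x.
    by move=> Sx; rewrite -[x]mulr1; apply: (idM iI).
  by move=> i _; case: iI.
have [f [Sf nIf] [iC C1 Cm]] := maximal_colon_prime nS iI I1.
have mf x : nonunits S x -> I (x * f).
  move=> mx; have [n Jn] := hJ _ mx.
  suff [] : [set x | S x /\ I (x * f)] x by [].
  apply: (primeX (n := n) sS) => //; first by case: mx.
  by split; [apply: srX => //; case: mx|apply: (idMr iI) => //; apply: JI].
pose I' : set K := [set x | exists y z, [/\ I y, [set y | exists2 r, S r & y = r * f] z & x = y + z]].
have iI' : ideal S I' by apply: ideal_sum => //; apply: ideal_principal.
have II' : I `<=` I'.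
  move=> x Ix; exists x, 0; split=> //; last by rewrite addr0.
  by exists 0; rewrite ?mul0r //; apply: sr0.
have I'f : I' f.
  exists 0, f; split; [exact: id0 iI| |by rewrite add0r].
  by exists 1; rewrite ?mul1r //; apply: sr1.
have [n [C [C0 Cn subC simC]]] : exists n, quotient_has_length S (S : set K^o) I' n.
  apply: contrapT => nlI'; apply: nIf; rewrite -(Imax I') //.
  by split=> //; apply: subset_trans II'.
apply: nlI; exists n.+1, (fun i => if i is j.+1 then C j else I); split=> //.
  by case=> [_|i lin]; [case: iI|exact: subC].
case=> [_|i lin]; last exact: simC.
rewrite C0; split; first by split=> // /(_ f I'f).
move=> W sW IW WI'; have [WI|nWI] := pselect (W `<=` I).
  by left; apply/seteqP.
right; apply/seteqP; split=> //.
have [w [Ww nIw]] : exists w, W w /\ ~ I w.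
  by apply: contrapT => h; apply: nWI => w Ww; apply: contrapT => nIw; apply: h; exists w.
case: (sW) => W0 WD WZ.
have [y [_ [Iy [r Sr ->] wE]]] := WI' _ Ww.
have Wrf : W (r * f).
  have -> : r * f = w + (- 1) *: (y : K^o) by rewrite wE scaleN1r [y + _]addrC addrK.
  by apply: WD => //; apply: WZ; [exact: srN (sr1 sS)|exact: IW].
have nr : ~ nonunits S r by move=> mr; apply: nIw; rewrite wE; apply: (idD iI) => //; apply: mf.
have [r0 Sr1] := unit_inv Sr nr.
have Wf : W f by have := WZ _ _ Sr1 Wrf; rewrite /GRing.scale /= mulKf.
move=> _ [y' [_ [Iy' [r' Sr' ->] ->]]]; apply: WD; [exact: IW|exact: WZ].
Qed.

End Nakayama.

Section Localization.
Variables (S P : set K).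
Hypotheses (sS : subring S) (pP : prime_ideal S P).

Let iP : ideal S P. Proof. by case: pP. Qed.
Let P1 : ~ P 1. Proof. by case: pP. Qed.
Let PM x y : S x -> S y -> P (x * y) -> P x \/ P y. Proof. by case: pP => _ _; apply. Qed.

Lemma notinM x y : S x -> S y -> ~ P x -> ~ P y -> ~ P (x * y).
Proof. by move=> Sx Sy nx ny /(PM Sx Sy)[]. Qed.

Lemma notin_neq0 x : ~ P x -> x != 0.
Proof. by move=> nx; apply/eqP => x0; apply: nx; rewrite x0; apply: id0 iP. Qed.

Lemma loc_sub : S `<=` loc S P.
Proof. by move=> x Sx; exists x, 1; split=> //; [exact: sr1|rewrite divr1]. Qed.

Lemma loc_subring : subring (loc S P).
Proof.
split; first by apply: loc_sub; apply: sr1.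
- move=> _ _ [a [s [Sa Ss nPs ->]]] [b [t [Sb St nPt ->]]].
  exists (a * t - b * s), (s * t); split; [|exact: srM|exact: notinM|].
    by apply: srB => //; exact: srM.
  by field; rewrite !notin_neq0.
- move=> _ _ [a [s [Sa Ss nPs ->]]] [b [t [Sb St nPt ->]]].
  exists (a * b), (s * t); split; [exact: srM|exact: srM|exact: notinM|].
  by field; rewrite !notin_neq0.
Qed.

Definition ext I : set K := [set f | exists a s, [/\ I a, S s, ~ P s & f = a / s]].

Lemma ext_ideal I : ideal S I -> ideal (loc S P) (ext I).
Proof.
move=> iI; apply: idealI.
- move=> _ [a [s [Ia Ss nPs ->]]]; exists a, s; split=> //; exact: idS Ia.
- by exists 0, 1; split; [exact: id0 iI|exact: sr1|exact: P1|rewrite mul0r].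
- move=> _ _ [a [s [Sa Ss nPs ->]]] [b [t [Sb St nPt ->]]].
  exists (t * a + s * b), (s * t); split; [|exact: srM|exact: notinM|].
    by apply: (idD iI); apply: (idM iI).
  by field; rewrite !notin_neq0.
- move=> _ _ [a [s [Sa Ss nPs ->]]] [b [t [Sb St nPt ->]]].
  exists (a * b), (s * t); split; [exact: (idM iI)|exact: srM|exact: notinM|].
  by field; rewrite !notin_neq0.
Qed.

Lemma ext_prime Q : prime_ideal S Q -> Q `<=` P -> prime_ideal (loc S P) (ext Q).
Proof.
move=> [iQ Q1 QM] QP; split; first exact: ext_ideal.
- move=> [a [s [Qa Ss nPs E]]]; apply: (nPs); apply: QP.
  have s0 : s != 0 by exact: notin_neq0 nPs.
  by have -> : s = a by rewrite -[LHS]mul1r E divfK.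
- move=> _ _ [a [s [Sa Ss nPs ->]]] [b [t [Sb St nPt ->]]] [c [r [Qc Sr nPr E]]].
  have : Q (a * b * r).
    have -> : a * b * r = (s * t) * c.
      have -> : a * b = (c / r) * (s * t) by rewrite -E; field; rewrite !notin_neq0.
      by field; rewrite !notin_neq0.
    by apply: (idM iQ) => //; apply: srM.
  move=> /QM[||/QM[|||]|/QP //] //; first exact: srM.
    by move=> Qa; left; exists a, s.
  by move=> Qb; right; exists b, t.
Qed.

Lemma ext_contract Q : prime_ideal S Q -> Q `<=` P -> forall x, S x -> ext Q x -> Q x.
Proof.
move=> [iQ Q1 QM] QP x Sx [a [s [Qa Ss nPs E]]].
have : Q (x * s) by rewrite E divfK // notin_neq0.
by move=> /QM[|||/QP].
Qed.

Lemma ext_sub I : I `<=` ext I.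
Proof. by move=> x Ix; exists x, 1; split=> //; [exact: sr1|rewrite divr1]. Qed.

Lemma loc_nonunits : nonunits (loc S P) = ext P.
Proof.
apply/seteqP; split=> x.
- move=> [[a [s [Sa Ss nPs ->]]] h]; exists a, s; split=> //; apply: contrapT => nPa.
  by apply: h; exists (s / a); [exists s, a|field; rewrite !notin_neq0].
- move=> [a [s [Pa Ss nPs ->]]].
  have Sa : S a by apply: idS Pa.
  split; first by exists a, s.
  move=> [_ [b [t [Sb St nPt ->]]] E]; apply: (notinM Ss St nPs nPt).
  have -> : s * t = b * a.
    by rewrite -[s * t]mul1r -E; field; rewrite !notin_neq0.
  exact: (idM iP).
Qed.

Lemma loc_local : local_ring (loc S P).
Proof. by rewrite /local_ring loc_nonunits; apply: ext_ideal. Qed.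

Lemma ideal_loc_contract I : ideal (loc S P) I -> ideal S (I `&` S).
Proof.
move=> iI; apply: idealI.
- by move=> x [].
- by split; [exact: id0 iI|exact: sr0].
- by move=> x y [Ix Sx] [Iy Sy]; split; [exact: (idD iI)|exact: srD].
- by move=> s x Ss [Ix Sx]; split; [apply: (idM iI) => //; exact: loc_sub|exact: srM].
Qed.

Lemma loc_noetherian : noetherian S -> noetherian (loc S P).
Proof.
move=> nS I iI; have [s sE] := nS _ (ideal_loc_contract iI); exists s.
have sI : [set` s] `<=` I by move=> x xs; have [] : (I `&` S) x by rewrite sE; apply: ideal_gen_sub.
apply/seteqP; split; last exact: ideal_gen_min.
move=> x Ix; have [a [t [Sa St nPt xE]]] := idS iI Ix.
have : (I `&` S) a.
  split=> //; have -> : a = t * x by rewrite xE mulrC divfK // notin_neq0.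
  by apply: (idM iI) => //; apply: loc_sub.
rewrite sE => ga.
have -> : x = t^-1 * a by rewrite xE mulrC.
apply: ideal_genMl; first by exists 1, t; split=> //; [exact: sr1|rewrite div1r].
by move=> M [M0 MD MZ] sM; apply: ga => //; split=> // c y Sc; apply: MZ; apply: loc_sub.
Qed.

End Localization.

Lemma prime_contract S S' P : subring S -> S `<=` S' -> prime_ideal S' P ->
  prime_ideal S (P `&` S).
Proof.
move=> sS SS' [iP P1 PM]; split.
- apply: idealI.
  + by move=> x [].
  + by split; [exact: id0 iP|exact: sr0].
  + by move=> x y [Ix Sx] [Iy Sy]; split; [exact: (idD iP)|exact: srD].
  + by move=> s x Ss [Ix Sx]; split; [apply: (idM iP) => //; exact: SS'|exact: srM].
- by move=> [].
- move=> x y Sx Sy [Pxy _].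
  by case: (PM x y (SS' _ Sx) (SS' _ Sy) Pxy); [left|right].
Qed.

Section PrincipalIdealTheorem.
Variable S : set K.
Hypotheses (sS : subring S) (nS : noetherian S).

(* Krull's argument: the relative symbolic powers of P' become stationary modulo P + (q),
   hence stationary by Nakayama, so P' is nilpotent modulo P after localization. *)
Lemma local_principal_ideal_theorem P P' q : local_ring S -> prime_ideal S P ->
  prime_ideal S P' -> P `<=` P' -> ~ P' `<=` P -> nonunits S q -> ~ P' q ->
  exists Q, [/\ prime_ideal S Q, P `<=` Q, Q q & ~ nonunits S `<=` Q].
Proof.
move=> lS pP pP' PP' nPP' mq nP'q; apply: contrapT => nQ; apply: nPP'.
have [iP P1 PM] := pP; have [iP' P'1 P'M] := pP'; have [Sq _] := mq.
pose J : set K := [set x | exists y z, [/\ P y, [set y | exists2 r, S r & y = r * q] z & x = y + z]].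
have iJ : ideal S J by apply: ideal_sum => //; apply: ideal_principal.
have PJ : P `<=` J.
  move=> x Px; exists x, 0; split=> //; last by rewrite addr0.
  by exists 0; rewrite ?mul0r //; apply: sr0.
have Jq : J q.
  exists 0, q; split; [exact: id0 iP| |by rewrite add0r].
  by exists 1; rewrite ?mul1r //; apply: sr1.
(* By the assumption [nQ], a prime over [J] contains every nonunit; hence [J] is primary to the
   maximal ideal and S/J has finite length. *)
have [l hl] : exists n, quotient_has_length S (S : set K^o) J n.
  apply: finite_length_primary => // x mx; apply: (radical_prime sS iJ); first by case: mx.
  move=> Q pQ JQ; apply: contrapT => nQx; apply: nQ; exists Q; split=> //.
  - exact: subset_trans JQ.
  - exact: JQ.
  - by move/(_ _ mx).
pose Y n : set K := [set f | S f /\ exists c g p,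
  [/\ S c, ~ P' c, ideal_pow S P' n g, P p & c * f = g + p]].
have iPn n : ideal S (ideal_pow S P' n) by apply: ideal_pow_ideal.
have iY n : ideal S (Y n).
  apply: idealI.
  - by move=> x [].
  - split; first exact: sr0.
    by exists 1, 0, 0; split; rewrite ?mulr0 ?addr0 //; [exact: sr1|exact: id0 (iPn n)|exact: id0 iP].
  - move=> x y [Sx [c [g [p [Sc nc hg Pp E]]]]] [Sy [c' [g' [p' [Sc' nc' hg' Pp' E']]]]].
    split; first exact: srD.
    exists (c * c'), (c' * g + c * g'), (c' * p + c * p'); split.
    + exact: srM.
    + exact: (notinM pP').
    + by apply: (idD (iPn n)); apply: (idM (iPn n)).
    + by apply: (idD iP); apply: (idM iP).
    + have -> : c * c' * (x + y) = c' * (c * x) + c * (c' * y) by ring.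
      by rewrite E E'; ring.
  - move=> s x Ss [Sx [c [g [p [Sc nc hg Pp E]]]]]; split; first exact: srM.
    exists c, (s * g), (s * p); split=> //; [exact: (idM (iPn n))|exact: (idM iP)|].
    by rewrite mulrCA E mulrDr.
have YP n : P `<=` Y n.
  move=> x Px; split; first exact: idS Px.
  by exists 1, 0, x; split=> //; [exact: sr1|exact: id0 (iPn n)|rewrite mul1r add0r].
have YS n : Y n.+1 `<=` Y n.
  move=> x [Sx [c [g [p [Sc nc hg Pp E]]]]]; split=> //; exists c, g, p; split=> //.
  exact: (ideal_powSsub sS iP').
pose D n : set K := [set x | exists y z, [/\ Y n y, J z & x = y + z]].
have [n Dn] : exists n, D n `<=` D n.+1.
  apply: (@length_dcc _ K^o S sS S J l D) => // n.
  - by have [] : ideal S (D n) by apply: ideal_sum.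
  - by move=> x Jx; exists 0, x; split=> //; [exact: id0 (iY n)|rewrite add0r].
  - move=> _ [y [z [Yy Jz ->]]]; apply: srD => //; [exact: (idS (iY n))|exact: (idS iJ)].
  - by move=> _ [y [z [Yy Jz ->]]]; exists y, z; split=> //; apply: YS.
have Yn : Y n `<=` Y n.+1.
  apply: (nakayama sS lS nS) => // f Yf.
  have [g [_ [Yg [p [_ [Pp [r Sr ->] ->]]] fE]]] : D n.+1 f.
    by apply: Dn; exists f, 0; split=> //; [exact: id0 iJ|rewrite addr0].
  exists (g + p), (q * r); split; last by rewrite fE; ring.
    by apply: (idD (iY n.+1)) => //; apply: YP.
  apply: ideal_mulS => //.
  (* As q is outside [P'], an element r q of [Y n] has r in [Y n]; the error term thus lies in q
     times [Y n], as Nakayama's lemma requires. *)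
  have : Y n (r * q).
    have -> : r * q = f + (- g - p) by rewrite fE; ring.
    by apply: (idD (iY n)) => //; apply: (idB (iY n) sS); [apply: (idN (iY n) sS); exact: YS|exact: YP].
  move=> [_ [c [g' [p' [Sc nc hg Pp' E]]]]]; split=> //.
  exists (c * q), g', p'; split=> //; [exact: srM|exact: (notinM pP')|by rewrite -E; ring].
have MN : ext S P' (ideal_pow S P' n) `<=` ext S P' P.
  have sL := loc_subring sS pP'; have lL := loc_local sS pP'.
  apply: (nakayama sL lL (loc_noetherian sS pP' nS)).
  - exact: ext_ideal.
  - exact: ext_ideal.
  move=> _ [g [s [hg Ss ns ->]]].
  have [_ [c [g' [p [Sc nc hg' Pp E]]]]] : Y n.+1 g.
    apply: Yn; split; first exact: (idS (iPn n)).
    by exists 1, g, 0; split=> //; [exact: sr1|exact: id0 iP|rewrite mul1r addr0].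
  have c0 := notin_neq0 pP' nc; have s0 := notin_neq0 pP' ns.
  have ncs : ~ P' (c * s) by apply: (notinM pP').
  have Scs : S (c * s) by apply: srM.
  exists (p / (c * s)), (g' / (c * s)); split.
  - by exists p, (c * s).
  - rewrite (loc_nonunits pP') mulrC; apply: ideal_genMl.
      by exists 1, (c * s); split=> //; [exact: sr1|rewrite div1r].
    move: hg' => /= hg' M [M0 MD MZ] hM; apply: hg'.
      by split=> // r v Sr; apply: MZ; apply: loc_sub.
    move=> _ [x [y [P'x hy ->]]]; apply: hM; exists x, y; split=> //; exact: ext_sub.
  - have -> : p / (c * s) + g' / (c * s) = (c * g) / (c * s) by rewrite E -mulrDl addrC.
    by field; rewrite c0 s0.
move=> x P'x; apply: (primeX (n := n) sS pP); first exact: idS P'x.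
apply: (@ext_contract S P' pP' P pP PP'); first by apply: srX => //; exact: idS P'x.
by apply/MN/ext_sub => //; apply: ideal_powX.
Qed.

End PrincipalIdealTheorem.

(** Localization at [P''] reduces this to the local case. It serves to move chains of primes: a
    middle term avoiding q is exchanged for one that contains q. *)
Lemma principal_ideal_theorem S P P' P'' q : subring S -> noetherian S -> prime_ideal S P -> prime_ideal S P' ->
  prime_ideal S P'' -> P `<=` P' -> ~ P' `<=` P -> P' `<=` P'' -> P'' q -> ~ P' q ->
  exists Q, [/\ prime_ideal S Q, P `<=` Q, Q q, Q `<=` P'' & ~ P'' `<=` Q].
Proof.
move=> sS nS pP pP' pP'' PP' nPP' PP'' P''q nP'q.
have [iP'' P''1 _] := pP''; have Sq : S q by apply: idS P''q.
have sL := loc_subring sS pP''; have SL : S `<=` loc S P'' by apply: loc_sub.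
have PP : P `<=` P'' by apply: subset_trans PP''.
have [||||||||Q [pQ PQ Qq nQ]] :=
  @local_principal_ideal_theorem (loc S P'') sL _ (ext S P'' P) (ext S P'' P') q.
- exact: loc_noetherian.
- exact: loc_local.
- exact: ext_prime.
- exact: ext_prime.
- by move=> _ [a [s [Pa Ss ns ->]]]; exists a, s; split=> //; apply: PP'.
- move=> h; apply: nPP' => x P'x.
  have Sx : S x by case: pP' => i _ _; apply: idS P'x.
  by apply: (@ext_contract S P'' pP'' P pP PP) => //; apply/h/ext_sub.
- by rewrite (loc_nonunits pP''); apply: ext_sub.
- by move=> h; apply: nP'q; apply: (@ext_contract S P'' pP'' P' pP' PP'').
have [iQ Q1 QM] := pQ.
have QL x : Q x -> nonunits (loc S P'') x.
  move=> Qx; split; first exact: idS Qx.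
  by move=> [y Ly E]; apply: Q1; rewrite -E; apply: (idMr iQ).
exists (Q `&` S); split.
- exact: prime_contract pQ.
- move=> x Px; split; first by apply/PQ/ext_sub.
  by case: pP => i _ _; apply: idS Px.
- by [].
- move=> x [/QL + Sx]; rewrite (loc_nonunits pP'').
  exact: (@ext_contract S P'' pP'' P'' pP'').
- move=> h; apply: nQ; rewrite (loc_nonunits pP'') => _ [a [s [Pa Ss ns ->]]].
  rewrite mulrC; apply: (idM iQ); last by case: (h _ Pa).
  by exists 1, s; split=> //; [exact: sr1|rewrite div1r].
Qed.

End LocalRings.

(** * Finitely generated extensions *)

Section Dimension.
Variable K : fieldType.
Implicit Types (S B I J N P Q : set K) (x y t : K) (p : {poly K}).

(** Hilbert's basis theorem, with t possibly algebraic over [S]: the ideals [L n] of top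
    coefficients are formed from polynomials of bounded size whose value at t lies in the ideal, and
    the division is carried out on polynomials rather than on elements of S[t]. *)
Lemma noetherian_adjoin S t : subring S -> noetherian S -> noetherian (adjoin S t).
Proof.
move=> sS nS J iJ; have sA := adjoin_subring t sS.
have S0 := sr0 sS.
have At p : coefs_in S p -> adjoin S t p.[t] by move=> hp; exists p.
pose L n : set K := [set c | exists p, [/\ coefs_in S p, (size p <= n.+1)%N, J p.[t] & p`_n = c]].
have iL n : ideal S (L n).
  apply: idealI.
  - by move=> _ [p [hp _ _ <-]].
  - by exists 0; split; rewrite ?coef0 ?horner0 ?size_poly0 //; [move=> i; rewrite coef0|exact: id0 iJ].
  - move=> _ _ [p [hp sp Jp <-]] [q [hq sq Jq <-]]; exists (p + q); split.
    + by apply: coefs_inD => //; apply: (srD sS).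
    + by rewrite (leq_trans (size_polyD _ _)) // geq_max sp sq.
    + by rewrite hornerD; apply: (idD iJ).
    + by rewrite coefD.
  - move=> s _ Ss [p [hp sp Jp <-]]; exists (s%:P * p); split.
    + by apply: coefs_inM => //; apply: coefs_inC.
    + by rewrite mul_polyC (leq_trans (size_scale_leq _ _)).
    + by rewrite hornerM hornerC; apply: (idM iJ) => //; apply: adjoin_sub.
    + by rewrite mul_polyC coefZ.
have coefs_XnM p m : coefs_in S p -> coefs_in S (p * 'X^m).
  by move=> hp i; rewrite coefMXn; case: ifP.
have LS n m : (n <= m)%N -> L n `<=` L m.
  move=> nm _ [p [hp sp Jp <-]]; exists (p * 'X^(m - n)); split.
  - exact: coefs_XnM.
  - have [->|p0] := eqVneq p 0; first by rewrite mul0r size_poly0.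
    by rewrite size_mulXn // (leq_trans (leq_add (leqnn _) sp)) // addnS subnK.
  - rewrite hornerM hornerXn; apply: (idMr iJ) => //; apply: srX => //; exact: adjoin_gen.
  - by rewrite coefMXn ltnNge leq_subr /= subKn.
have [||_ [[M _ <-] Mmax]] := @noetherian_max _ S [set I | exists2 n, True & L n = I] sS nS.
- by move=> _ [n _ <-].
- by exists (L 0%N), 0%N.
have LM m : (M <= m)%N -> L m = L M by move=> Mm; apply: Mmax; [exists m|exact: LS].
pose ok (n : nat) (s : seq K) := forall c, L n c -> exists p,
  [/\ coefs_in S p, (size p <= n.+1)%N, ideal_gen (adjoin S t) [set` s] p.[t] & p`_n = c].
have okS n (s s' : seq K) : {subset s <= s'} -> ok n s -> ok n s'.
  move=> ss' os c /os[p [hp sp gp pc]]; exists p; split=> //.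
  by apply: ideal_genS gp => z /=; apply: ss'.
have lift n : exists2 s : seq K, {in s, forall z, J z} & ok n s.
  have [s sE] := nS _ (iL n).
  have [s' s'J hs'] : exists2 s' : seq K, {in s', forall z, J z} & {in s, forall a, exists p,
     [/\ coefs_in S p, (size p <= n.+1)%N, ideal_gen (adjoin S t) [set` s'] p.[t] & p`_n = a]}.
    have : {in s, forall a, L n a} by move=> a sa; rewrite sE; apply: ideal_gen_sub.
    elim: s {sE} => [|a s IH] sL; first by exists [::].
    have [|s' s'J hs'] := IH; first by move=> b bs; apply: sL; rewrite inE bs orbT.
    have [|p [hp sp Jp pa]] := sL a; first by rewrite inE eqxx.
    exists (p.[t] :: s'); first by move=> z; rewrite inE => /orP[/eqP->|/s'J].
    move=> b; rewrite inE => /orP[/eqP->|/hs'[q [hq sq gq qb]]].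
      by exists p; split=> //; apply: ideal_gen_sub; rewrite /= inE eqxx.
    exists q; split=> //; apply: ideal_genS gq => z /= zs; by rewrite inE zs orbT.
  exists s' => // c; rewrite sE; move: c.
  apply: (@ideal_gen_min _ S _ [set c | exists p, [/\ coefs_in S p, (size p <= n.+1)%N,
    ideal_gen (adjoin S t) [set` s'] p.[t] & p`_n = c]]); last exact: hs'.
  apply: idealI.
  - by move=> _ [p [hp _ _ <-]].
  - exists 0; split; rewrite ?coef0 ?horner0 ?size_poly0 //; last exact: ideal_gen0.
    by move=> i; rewrite coef0.
  - move=> _ _ [p [hp sp Jp <-]] [q [hq sq Jq <-]]; exists (p + q); split.
    + by apply: coefs_inD => //; apply: (srD sS).
    + by rewrite (leq_trans (size_polyD _ _)) // geq_max sp sq.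
    + by rewrite hornerD; apply: ideal_genD.
    + by rewrite coefD.
  - move=> r _ Sr [p [hp sp Jp <-]]; exists (r%:P * p); split.
    + by apply: coefs_inM => //; apply: coefs_inC.
    + by rewrite mul_polyC (leq_trans (size_scale_leq _ _)).
    + by rewrite hornerM hornerC; apply: ideal_genMl => //; apply: adjoin_sub.
    + by rewrite mul_polyC coefZ.
have [s sJ os] : exists2 s : seq K, {in s, forall z, J z} & forall n, (n <= M)%N -> ok n s.
  elim: M {Mmax LM} => [|m [s sJ os]].
    by have [s sJ os] := lift 0%N; exists s => // n; rewrite leqn0 => /eqP ->.
  have [s' s'J os'] := lift m.+1; exists (s ++ s').
    by move=> z; rewrite mem_cat => /orP[/sJ|/s'J].
  move=> n; rewrite leq_eqVlt => /orP[/eqP->|].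
    by apply: okS os' => z zs; rewrite mem_cat zs orbT.
  by rewrite ltnS => /os; apply: okS => z zs; rewrite mem_cat zs.
exists s; apply/seteqP; split; last exact: ideal_gen_min.
suff main n p : (size p <= n)%N -> coefs_in S p -> J p.[t] -> ideal_gen (adjoin S t) [set` s] p.[t].
  by move=> x Jx; have [p hp xE] := idS iJ Jx; rewrite xE; apply: (main (size p)) => //; rewrite -xE.
elim: n p => [|n IH] p sp hp Jp.
  by move: sp; rewrite leqn0 size_poly_eq0 => /eqP ->; rewrite horner0; apply: ideal_gen0.
have [q [hq sq gq qn]] : exists q, [/\ coefs_in S q, (size q <= n.+1)%N,
    ideal_gen (adjoin S t) [set` s] q.[t] & q`_n = p`_n].
  have Lp : L n p`_n by exists p.
  have [nM|Mn] := leqP n M; first exact: os.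
  have [q [hq sq gq qn]] : exists q, [/\ coefs_in S q, (size q <= M.+1)%N,
    ideal_gen (adjoin S t) [set` s] q.[t] & q`_M = p`_n].
    by apply: (os M (leqnn _)); rewrite -(LM n) // ltnW.
  exists (q * 'X^(n - M)); split.
  - exact: coefs_XnM.
  - have [->|q0] := eqVneq q 0; first by rewrite mul0r size_poly0.
    by rewrite size_mulXn // (leq_trans (leq_add (leqnn _) sq)) // addnS subnK // ltnW.
  - rewrite hornerM hornerXn mulrC; apply: ideal_genMl => //.
    by apply: srX => //; apply: adjoin_gen.
  - by rewrite coefMXn ltnNge leq_subr /= subKn // ltnW.
rewrite -[p](subrK q) hornerD; apply: ideal_genD => //; apply: IH.
- apply/leq_sizeP => j; rewrite leq_eqVlt => /orP[/eqP<-|nj].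
    by rewrite coefB qn subrr.
  by rewrite coefB !nth_default ?subrr // ?(leq_trans sq) ?(leq_trans sp).
- by apply: coefs_inD; [exact: (srD sS)|by []|exact: coefs_inN].
- rewrite hornerD hornerN; apply: (idB iJ sA) => //.
  exact: (ideal_gen_min iJ sJ).
Qed.

Lemma zero_prime S : subring S -> prime_ideal S [set 0].
Proof.
move=> sS; split; [exact: ideal_zero| |].
  by move=> /= /eqP; rewrite oner_eq0.
by move=> x y _ _ /= /eqP; rewrite mulf_eq0 => /orP[/eqP|/eqP]; [left|right].
Qed.

(* Together with the zero ideal, a chain of length 3 *)
Definition chain3 S N := exists P1 P2 P3,
  [/\ prime_ideal S P1, prime_ideal S P2 & prime_ideal S P3] /\
  [/\ exists2 x, P1 x & x != 0, proper P1 P2, proper P2 P3 & P3 `<=` N].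

(* Moving the chain so that P1 contains t = f / g, it contracts to a chain of B, because
   B and B[t] have the same image modulo t. *)
Lemma dimension_adjoin B t N : subring B -> noetherian B -> loc B [set 0] t ->
  prime_ideal (adjoin B t) N -> N t -> ~ chain3 B (N `&` B) -> ~ chain3 (adjoin B t) N.
Proof.
move=> sB nB [f [g [Bf Bg g0 tE]]] pN Nt nc [P1 [P2 [P3 [[pP1 pP2 pP3]]]]].
move=> [[z P1z z0] [P12 nP12] [P23 nP23] P3N]; apply: nc.
have sA := adjoin_subring t sB; have nA := @noetherian_adjoin B t sB nB.
have BA := @adjoin_sub K B t sB.
have [t0|t0] := eqVneq t 0.
  have AB : adjoin B t = B.
    by apply/seteqP; split=> //; apply: adjoin_min => //; rewrite t0; apply: sr0.
  exists P1, P2, P3; split; first by rewrite -AB.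
  split=> //; first by exists z.
  move=> x P3x; split; first exact: P3N.
  by rewrite -AB; case: pP3 => i _ _; apply: idS P3x.
have P2N : P2 `<=` N by apply: subset_trans P3N.
have nNP2 : ~ N `<=` P2 by move=> h; apply: nP23; apply: subset_trans h.
(* The new chain ends at [N], which contains t; that [N] lies strictly above [P2] comes from
   [P3]. *)
have [Q2 [pQ2 PQ2 nQP2 Q2t [Q2N nNQ2]]] : exists Q2,
    [/\ prime_ideal (adjoin B t) Q2, P1 `<=` Q2, ~ Q2 `<=` P1, Q2 t & Q2 `<=` N /\ ~ N `<=` Q2].
  have [P2t|nP2t] := pselect (P2 t); first by exists P2.
  have [Q [pQ PQ Qt QN nQ]] := principal_ideal_theorem sA nA pP1 pP2 pN P12 nP12 P2N Nt nP2t.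
  by exists Q; split=> // /(_ _ Qt)/P12.
have [Q1 [pQ1 Q1t Q12 nQ12]] : exists Q1,
    [/\ prime_ideal (adjoin B t) Q1, Q1 t, Q1 `<=` Q2 & ~ Q2 `<=` Q1].
  have [P1t|nP1t] := pselect (P1 t); first by exists P1.
  have [||Q [pQ PQ Qt QN nQ]] := principal_ideal_theorem sA nA (zero_prime sA) pP1 pQ2 _ _ PQ2 Q2t nP1t.
  - by move=> _ ->; case: pP1 => i _ _; apply: id0 i.
  - by move=> /(_ _ P1z)/eqP; apply/negP.
  - by exists Q.
have split_t x : adjoin B t x -> exists b y, [/\ B b, adjoin B t y & x = b + t * y].
  move=> [p hp ->]; exists p`_0, (\poly_(i < (size p).-1) p`_i.+1).[t]; split=> //.
    exists (\poly_(i < (size p).-1) p`_i.+1) => // i; rewrite coef_poly.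
    by case: ifP => // _; apply: sr0.
  set r := \poly_(i < _) _; have {1}-> : p = (p`_0)%:P + r * 'X; last first.
    by rewrite hornerD hornerC hornerM hornerX [t * _]mulrC.
  apply/polyP => i; rewrite coefD coefMX coefC; case: i => [|i] /=; first by rewrite addr0.
  rewrite add0r coef_poly; case: ltnP => // h; rewrite nth_default //.
  by rewrite (leq_trans (leqSpred _)).
have strict Q Q' : prime_ideal (adjoin B t) Q -> prime_ideal (adjoin B t) Q' ->
    Q t -> Q `<=` Q' -> ~ Q' `<=` Q -> proper (Q `&` B) (Q' `&` B).
  move=> [iQ _ _] [iQ' _ _] Qt QQ' nQQ'; split; first by move=> x [/QQ' Qx Bx].
  move=> h; apply: (nQQ') => x Q'x; have [b [y [Bb Ay xE]]] := split_t _ (idS iQ' Q'x).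
  rewrite xE; apply: (idD iQ); last exact: (idMr iQ).
  have [] // : (Q `&` B) b; apply: h; split=> //.
  have -> : b = x - t * y by rewrite xE addrK.
  by apply: (idB iQ' sA) => //; apply: (idMr iQ') => //; apply: QQ'.
exists (Q1 `&` B), (Q2 `&` B), (N `&` B); split; first by split; apply: (prime_contract sB BA).
split; [|exact: strict|exact: strict|by []].
exists f; last first.
  by apply: contra_neq t0 => f0; rewrite tE f0 mul0r.
split=> //; have -> : f = g * t by rewrite tE mulrC divfK //; apply/eqP.
by case: pQ1 => i _ _; apply: (idM i) => //; apply: BA.
Qed.

Lemma dimension_adjoins B s N : subring B -> noetherian B -> {in s, forall t, loc B [set 0] t} ->
  prime_ideal (adjoins B s) N -> {in s, forall t, N t} ->
  ~ chain3 B (N `&` B) -> ~ chain3 (adjoins B s) N.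
Proof.
elim: s B => [|t s IH] B sB nB hs pN Ns nc /=.
  suff -> : N = N `&` B by [].
  by apply/seteqP; split=> x; [move=> Nx; split=> //; case: pN => i _ _; apply: idS Nx|case].
have sA := adjoin_subring t sB.
apply: IH => //.
- exact: noetherian_adjoin.
- move=> x xs; have [|f [g [Bf Bg g0 ->]]] := hs x; first by rewrite inE xs orbT.
  by exists f, g; split=> //; apply: adjoin_sub.
- by move=> x xs; apply: Ns; rewrite inE xs orbT.
have Nt : N t by apply: Ns; rewrite inE eqxx.
apply: dimension_adjoin => //.
- by apply: hs; rewrite inE eqxx.
- by apply: prime_contract pN => //; apply: adjoins_sub.
- by split=> //; apply: adjoin_gen.
suff -> : N `&` adjoin B t `&` B = N `&` B by [].
apply/seteqP; split=> [x [[]]//|x [Nx Bx]]; split=> //; split=> //; exact: adjoin_sub.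
Qed.

End Dimension.

(** * Regular local rings of dimension at most two *)

Section RegularLocal.
Variable K : fieldType.
Implicit Types (S I J M P Q : set K) (x y f p s t : K).

Definition height_one S P := [/\ prime_ideal S P, exists2 x, P x & x != 0
  & forall Q, prime_ideal S Q -> (exists2 x, Q x & x != 0) -> Q `<=` P -> P `<=` Q].

Lemma prime_sub_nonunits S P : subring S -> prime_ideal S P -> P `<=` nonunits S.
Proof.
move=> sS [iP P1 _] x Px; split; first exact: idS Px.
by move=> [y Sy xy]; apply: P1; rewrite -xy; apply: (idMr iP).
Qed.

Lemma nonunits_prime S : subring S -> local_ring S -> prime_ideal S (nonunits S).
Proof.
move=> sS lS; split=> //; first by apply: nonunits1; apply: sr1.
move=> x y Sx Sy nxy; apply: contrapT => /not_orP[nx ny].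
have [x0 Sx1] := unit_inv Sx nx; have [y0 Sy1] := unit_inv Sy ny.
apply: (nonunits_inv nxy); first by rewrite mulf_neq0.
by rewrite invfM; apply: srM.
Qed.

Lemma strict_nonzero S P Q : ideal S P -> proper P Q -> exists2 x, Q x & x != 0.
Proof.
move=> iP [PQ nQP]; apply: contrapT => h; apply: nQP => x Qx.
have -> : x = 0; last exact: id0 iP.
by apply: contrapT => /eqP x0; apply: h; exists x.
Qed.

(** Modulo s the ring behaves like a discrete valuation ring with uniformizer t. The image of [P] is
    generated by t^j for the largest j with [P] inside (s, t^j), and an element p0 of [P] reaching
    this order generates [P] modulo s P, because s is not in [P]. Nakayama's lemma concludes. *)
Lemma regular_height_one_principal2 S s t P : subring S -> noetherian S -> local_ring S ->
  nonunits S = [set x | exists a b, [/\ S a, S b & x = a * s + b * t]] ->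
  ~ chain3 S (nonunits S) -> prime_ideal S P -> (exists2 x, P x & x != 0) ->
  ~ nonunits S `<=` P -> ~ P s ->
  exists2 p, P p & forall x, P x -> exists2 r, S r & x = r * p.
Proof.
move=> sS nS lS mE nc pP P0 nmP nPs.
have [iP P1 PM] := pP; have S0 := sr0 sS; have S1 := sr1 sS.
have pm := nonunits_prime sS lS.
have Pm := prime_sub_nonunits sS pP.
have ms : nonunits S s by rewrite mE; exists 1, 0; split=> //; ring.
have mt : nonunits S t by rewrite mE; exists 0, 1; split=> //; ring.
have Ss : S s by case: ms.
have St : S t by case: mt.
have mQ Q : prime_ideal S Q -> Q s -> Q t -> nonunits S `<=` Q.
  move=> [iQ _ _] Qs Qt; rewrite mE => _ [a [b [Sa Sb ->]]].
  by apply: (idD iQ); apply: (idM iQ).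
(* Otherwise a prime Q over P and s that avoids t would give the chain 0, P, Q, m of length 3. *)
have [N [p [r [Pp Sr tN]]]] : exists N p r, [/\ P p, S r & t ^+ N = p + r * s].
  pose J : set K := [set x | exists y z, [/\ P y, [set y | exists2 r, S r & y = r * s] z & x = y + z]].
  have iJ : ideal S J by apply: ideal_sum => //; apply: ideal_principal.
  have [Q pQ JQ|N [p [_ [Pp [r Sr ->] E]]]] := radical_prime sS iJ St; last by exists N, p, r.
  have [iQ _ _] := pQ.
  have PQ : P `<=` Q.
    move=> x Px; apply: JQ; exists x, 0; split=> //; last by rewrite addr0.
    by exists 0; rewrite ?mul0r.
  have Qs : Q s.
    apply: JQ; exists 0, s; split; [exact: id0 iP| |by rewrite add0r].
    by exists 1; rewrite ?mul1r.
  apply: contrapT => nQt; apply: nc; exists P, Q, (nonunits S); split=> //; split=> //.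
    by split=> // h; apply/nPs/h.
  by split; [exact: prime_sub_nonunits|move/(_ _ mt)].
(* The principal ideal theorem gives a prime over s other than m; if s divided a power of t, this
   prime would contain t too, hence all of m. *)
have nts n : ~ exists2 r, S r & t ^+ n = r * s.
  move=> [r' Sr' E].
  have [||Q [pQ _ Qs _ nmQ]] := principal_ideal_theorem sS nS (zero_prime sS) pP pm _ _ Pm ms nPs.
  - by move=> _ ->; apply: id0 iP.
  - by case: P0 => x Px x0 /(_ _ Px)/eqP; apply/negP.
  apply: nmQ; apply: mQ => //; apply: (primeX (n := n) sS pQ St).
  by rewrite E; case: pQ => iQ _ _; apply: (idM iQ).
pose I j : set K := [set x | exists a b, [/\ S a, S b & x = a * s + b * t ^+ j]].
have [j PIj nPIj] : exists2 j, P `<=` I j & ~ P `<=` I j.+1.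
  apply: contrapT => h.
  have PI j : P `<=` I j.
    elim: j => [|j IH].
      by move=> x Px; exists 0, x; split=> //; [exact: idS Px|rewrite expr0; ring].
    by apply: contrapT => nI; apply: h; exists j.
  have [a [b [Sa Sb E]]] := PI N.+1 _ Pp.
  have [u Su uE] := local_unit sS lS (idM lS Sb mt).
  apply: (nts N); exists (u * (a + r)); first by apply: srM => //; apply: srD.
  have -> : t ^+ N = u * (t ^+ N - b * t ^+ N.+1).
    have -> : u * (t ^+ N - b * t ^+ N.+1) = t ^+ N * ((1 - b * t) * u) by rewrite exprS; ring.
    by rewrite uE mulr1.
  by rewrite tN E; ring.
have [p0 [Pp0 nIp0]] : exists x, P x /\ ~ I j.+1 x.
  by apply: contrapT => h; apply: nPIj => x Px; apply: contrapT => nI; apply: h; exists x.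
have [a [b [Sa Sb p0E]]] := PIj _ Pp0.
have nb : ~ nonunits S b.
  rewrite mE => -[b1 [b2 [Sb1 Sb2 bE]]]; apply: nIp0; exists (a + b1 * t ^+ j), b2; split=> //.
    by apply: srD => //; apply: srM => //; apply: srX.
  by rewrite p0E bE exprS; ring.
have [b0 Sb1] := unit_inv Sb nb.
exists p0 => // x.
suff : P `<=` [set x | exists2 r, S r & x = r * p0] by apply.
apply: (nakayama sS lS nS) => //; first by apply: ideal_principal => //; apply: idS Pp0.
move=> y Py; have [a' [b' [Sa' Sb' yE]]] := PIj _ Py.
have Sc : S (b' / b) by apply: srM.
exists (b' / b * p0), (s * (a' - b' / b * a)); split.
- by exists (b' / b).
- apply: ideal_mulS => //.
  have Sd : S (a' - b' / b * a) by apply: srB => //; apply: srM.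
  case: (PM s (a' - b' / b * a)) => //.
  have -> : s * (a' - b' / b * a) = y - b' / b * p0 by rewrite yE p0E; field.
  by apply: (idB iP sS) => //; apply: (idM iP).
- by rewrite yE p0E; field.
Qed.

Lemma regular_dim_le2 S : subring S -> regular_local S -> ~ chain3 S (nonunits S) ->
  exists s : seq K, [/\ (size s <= 2)%N, krull_dim S (size s) & nonunits S = ideal_gen S [set` s]].
Proof.
move=> sS [nS lS [s ds ms]] nc; exists s; split=> //; rewrite leqNgt; apply/negP => lt2.
apply: nc; have [[C [pC ltC]] _] := ds.
have p1 : prime_ideal S (C 1%N) by apply: pC; apply: leq_trans lt2.
have p2 : prime_ideal S (C 2%N) by apply: pC; apply: leq_trans lt2.
have p3 : prime_ideal S (C 3%N) by apply: pC.
exists (C 1%N), (C 2%N), (C 3%N); split=> //; split.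
- apply: (@strict_nonzero S (C 0%N)); first by have [] := pC 0%N isT.
  by apply: ltC; apply: leq_trans lt2.
- by apply: ltC; apply: leq_trans lt2.
- by apply: ltC.
- exact: prime_sub_nonunits.
Qed.

Lemma krull_dim1_height_one S P : subring S -> local_ring S -> krull_dim S 1 ->
  prime_ideal S P -> (exists2 x, P x & x != 0) -> P = nonunits S.
Proof.
move=> sS lS [_ nc] pP [x Px x0]; apply/seteqP; split; first exact: prime_sub_nonunits.
apply: contrapT => nmP; apply: nc.
exists (fun i => if i is j.+1 then if j is 0 then P else nonunits S else [set 0]).
split; first by case=> [|[|[|]]] //= _; [exact: zero_prime|exact: nonunits_prime].
case=> [|[|]] //= _; split=> //.
- by move=> _ ->; case: pP => i _ _; apply: id0 i.
- by move=> /(_ _ Px)/eqP; apply/negP.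
- exact: prime_sub_nonunits.
Qed.

(** * Factoriality, lowest terms and normality in dimension at most two *)

Section FactorialLocal.
Variable S : set K.
Hypotheses (sS : subring S) (rS : regular_local S) (nc : ~ chain3 S (nonunits S)).

Let nS : noetherian S. Proof. by case: rS. Qed.
Let lS : local_ring S. Proof. by case: rS. Qed.
Let pm : prime_ideal S (nonunits S). Proof. exact: nonunits_prime. Qed.

(** The number of generators of the maximal ideal is the dimension. If there are two, [P] is not
    maximal and so misses one of them, which takes the role of s in the previous argument. *)
Lemma height_one_principal P : height_one S P ->
  exists2 p, P p & forall x, P x -> exists2 r, S r & x = r * p.
Proof.
move=> [pP P0 Pmin]; have [l [ll ds mE]] := regular_dim_le2 sS rS nc.
case: l ll ds mE => [|p [|q [|r l //]]] _ ds mE.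
- case: P0 => x Px /eqP x0; case: x0; have := prime_sub_nonunits sS pP Px.
  by rewrite mE => /ideal_gen_nil.
- rewrite (krull_dim1_height_one sS lS ds pP P0) mE.
  exists p; first by apply: ideal_gen_sub; rewrite /= inE.
  move=> x; rewrite ideal_gen_cons // => -[r [y [Sr /ideal_gen_nil -> ->]]].
  by exists r; rewrite ?addr0.
have nmP : ~ nonunits S `<=` P.
  move=> mP; have [[C [pC ltC]] _] := ds.
  have C0 : exists2 x, C 1%N x & x != 0.
    by apply: (@strict_nonzero S (C 0%N)); [have [] := pC 0%N isT|apply: ltC].
  have p1 : prime_ideal S (C 1%N) by apply: pC.
  have CP : C 1%N `<=` P by apply: subset_trans mP; apply: prime_sub_nonunits.
  have [_ nC] := ltC 1%N isT; apply: nC; apply: subset_trans (Pmin _ p1 C0 CP).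
  by apply: subset_trans mP; apply: prime_sub_nonunits => //; apply: pC.
have mE' a b : nonunits S = ideal_gen S [set` [:: a; b]] ->
    nonunits S = [set x | exists c d, [/\ S c, S d & x = c * a + d * b]].
  by move=> ->; apply/seteqP; split=> x; rewrite ideal_gen_seq2P //.
have [nPp|Pp] := pselect (~ P p).
  exact: (regular_height_one_principal2 sS nS lS (mE' _ _ mE)).
apply: (@regular_height_one_principal2 S q p) => //; last first.
  move=> Pq; apply: nmP; rewrite mE => x; rewrite ideal_gen_seq2P // => -[c [d [Sc Sd ->]]].
  by have [iP _ _] := pP; apply: (idD iP); apply: (idM iP) => //; apply: contrapT.
apply: mE'; rewrite mE; apply/seteqP; split=> x; rewrite !ideal_gen_seq2P //;
  by move=> [c [d [Sc Sd ->]]]; exists d, c; rewrite addrC.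
Qed.

(** In dimension two the principal ideal theorem provides a prime over b other than the maximal
    ideal. It has height one, since a smaller nonzero prime would complete a chain of length 3. *)
Lemma exists_height_one b : nonunits S b -> b != 0 -> exists2 P, height_one S P & P b.
Proof.
move=> mb b0; have [l [ll ds mE]] := regular_dim_le2 sS rS nc.
case: l ll ds mE => [|p [|q [|r l //]]] _ ds mE.
- by move: mb; rewrite mE => /ideal_gen_nil /eqP; rewrite (negPf b0).
- exists (nonunits S) => //; split=> //; first by exists b.
  by move=> Q pQ Q0 _; rewrite (krull_dim1_height_one sS lS ds pQ Q0).
have [[C [pC ltC]] _] := ds.
have p1 : prime_ideal S (C 1%N) by apply: pC.
have C0 : exists2 x, C 1%N x & x != 0.
  by apply: (@strict_nonzero S (C 0%N)); [have [] := pC 0%N isT|apply: ltC].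
have nmC : ~ nonunits S `<=` C 1%N.
  move=> mC; have [_ nC] := ltC 1%N isT; apply: nC; apply: subset_trans mC.
  by apply: prime_sub_nonunits => //; apply: pC.
have [Q [pQ Qb nmQ]] : exists Q, [/\ prime_ideal S Q, Q b & ~ nonunits S `<=` Q].
  have [Cb|nCb] := pselect (C 1%N b); first by exists (C 1%N).
  have [||Q [pQ _ Qs _ nmQ]] := principal_ideal_theorem sS nS (zero_prime sS) p1 pm _ _ (prime_sub_nonunits sS p1) mb nCb.
  - by move=> _ ->; case: p1 => i _ _; apply: id0 i.
  - by case: C0 => x Px x0 /(_ _ Px)/eqP; apply/negP.
  - by exists Q.
exists Q => //; split=> //; first by exists b.
move=> Q' pQ' Q'0 Q'Q; apply: contrapT => nQQ'; apply: nc.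
exists Q', Q, (nonunits S); split=> //; split=> //.
by split=> //; apply: prime_sub_nonunits.
Qed.

Hypothesis fS : forall f, loc S [set 0] f.

(** Lowest terms obtained by noetherianity: (b) is maximal among the principal ideals generated by
    denominators of f. If a prime factor p of b also divided b f, it could be cancelled, and b / p
    would generate a larger ideal. *)
Lemma irreducible_fraction f : ~ S f ->
  exists P a b, [/\ height_one S P, S a, P b, ~ P a & b != 0 /\ f = a / b].
Proof.
move=> nSf.
have [||_ [[b [Sb b0 Sbf <-]] bmax]] := @noetherian_max _ S
  [set I | exists b, [/\ S b, b != 0, S (b * f) & [set x | exists2 r, S r & x = r * b] = I]] sS nS.
- by move=> _ [b [Sb _ _ <-]]; apply: ideal_principal.
- have [a [s [Sa Ss /eqP s0 fE]]] := fS f.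
  exists [set x | exists2 r, S r & x = r * s], s; split=> //.
  by rewrite fE mulrC divfK.
have mb : nonunits S b.
  split=> // -[y Sy by1]; apply: nSf.
  have -> : f = y * (b * f) by rewrite mulrA [y * b]mulrC by1 mul1r.
  exact: srM.
have [P hP Pb] := exists_height_one mb b0.
have [p Pp pE] := height_one_principal hP.
have [pP _ _] := hP; have [iP _ _] := pP; have Sp : S p by apply: idS Pp.
exists P, (b * f), b; split=> //; last by split=> //; field.
move=> /pE[a' Sa' aE]; have [b' Sb' bE] := pE _ Pb.
have p0 : p != 0 by apply: contra_neq b0 => p0; rewrite bE p0 mulr0.
have b'0 : b' != 0 by apply: contra_neq b0 => b'0; rewrite bE b'0 mul0r.
have E : [set x | exists2 r, S r & x = r * b'] = [set x | exists2 r, S r & x = r * b].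
  apply: bmax.
    exists b'; split=> //.
    have -> : b' * f = a' by apply: (mulIf p0); rewrite -aE bE; ring.
    by [].
  move=> _ [r Sr ->]; exists (r * p); first exact: srM.
  by rewrite bE; ring.
have [r Sr b'E] : [set x | exists2 r, S r & x = r * b] b'.
  by rewrite -E; exists 1; [exact: sr1|rewrite mul1r].
have [_] := prime_sub_nonunits sS pP Pp; apply; exists r => //.
by apply: (mulIf b'0); rewrite mul1r {2}b'E bE; ring.
Qed.

Lemma hartogs f : (forall P, height_one S P -> loc S P f) -> S f.
Proof.
move=> h; apply: contrapT => /irreducible_fraction[P [a [b [hP Sa Pb nPa [b0 fE]]]]].
have [c [s [Sc Ss nPs fE']]] := h _ hP; have [pP _ _] := hP; have [iP _ PM] := pP.
have s0 := notin_neq0 pP nPs.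
have E : a * s = c * b.
  have -> : a = (c / s) * b by rewrite -fE' fE divfK.
  by field.
have [] // := PM a s Sa Ss; rewrite E; exact: (idM iP).
Qed.

(** With f = a / b in lowest terms and [P] a prime factor of b, clearing denominators in the
    integral equation would put a^n in [P]. *)
Lemma integrally_closed_local f n (c : nat -> K) :
  (forall i, (0 < i <= n)%N -> S (c i)) -> f ^+ n + \sum_(1 <= i < n.+1) c i * f ^+ (n - i) = 0 ->
  (0 < n)%N -> S f.
Proof.
move=> Sc E n0; apply: contrapT => /irreducible_fraction[P [a [b [hP Sa Pb nPa [b0 fE]]]]].
have [pP _ _] := hP; have [iP _ _] := pP; apply: nPa.
have Sb : S b by apply: idS Pb.
apply: (primeX (n := n) sS pP Sa).
have -> : a ^+ n = - \sum_(1 <= i < n.+1) c i * (b ^+ i * a ^+ (n - i)).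
  apply/eqP; rewrite -subr_eq0 opprK; apply/eqP.
  have : b ^+ n * (f ^+ n + \sum_(1 <= i < n.+1) c i * f ^+ (n - i)) = 0 by rewrite E mulr0.
  rewrite mulrDr fE expr_div_n mulrCA divff ?expf_neq0 // mulr1 => {2}<-.
  rewrite mulr_sumr; congr (_ + _); rewrite !big_seq; apply: eq_bigr => i.
  rewrite mem_index_iota => /andP[_]; rewrite ltnS => lin.
  rewrite expr_div_n -{2}(subnK lin) exprD; field.
  by rewrite expf_neq0.
apply: (idN iP sS); rewrite big_seq; apply: (id_sum iP) => i; rewrite mem_index_iota => /andP[i0 lin].
apply: (idM iP); first by apply: Sc; rewrite i0.
by apply: (idMr iP); [exact: srX|exact: (idX iP)].
Qed.

End FactorialLocal.
End RegularLocal.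

(** * Valuation rings *)

Section Valuations.
Variable K : fieldType.
Implicit Types (S V : set K) (x y : K).

Lemma valuation_local V : valuation_ring V -> local_ring V.
Proof.
move=> [sV tV]; apply: idealI.
- by move=> x [].
- by split; [exact: sr0|move=> [y _ /eqP]; rewrite mul0r eq_sym oner_eq0].
- move=> x y nx ny; have [Vx _] := nx; have [Vy _] := ny.
  have [->|x0] := eqVneq x 0; first by rewrite add0r.
  have [->|y0] := eqVneq y 0; first by rewrite addr0.
  wlog Vxy : x y nx ny Vx Vy x0 y0 / V (x / y).
    move=> W; case: (tV (x / y)) => [|h]; first exact: W.
    by rewrite addrC; apply: W => //; move: h; rewrite invfM invrK mulrC.
  apply/nonunitsE => //; split; first exact: srD.
  have [->|xy0] := eqVneq (x + y) 0; [by left|right=> h].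
  apply: (nonunits_inv ny y0); have -> : y^-1 = (x + y)^-1 * (1 + x / y) by field; rewrite y0.
  by apply: srM => //; apply: srD => //; exact: sr1.
- move=> s x Vs nx; have [Vx _] := nx; apply/nonunitsE => //; split; first exact: srM.
  have [->|s0] := eqVneq s 0; first by left; rewrite mul0r.
  have [->|x0] := eqVneq x 0; first by left; rewrite mulr0.
  right=> h; apply: (nonunits_inv nx x0); have -> : x^-1 = s * (s * x)^-1 by field; rewrite s0 x0.
  exact: srM.
Qed.

Lemma dominating_valuation S : subring S -> local_ring S ->
  exists V, [/\ valuation_ring V, S `<=` V & nonunits S `<=` nonunits V].
Proof.
move=> sS lS; apply: chevalley => //; first by move=> x [].
move=> h; apply: (@nonunits1 _ S); first exact: sr1.
exact: (ideal_gen_min lS (fun x h => h)).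
Qed.

Lemma nonunits_dominated S V x : S `<=` V -> nonunits S `<=` nonunits V -> S x ->
  nonunits V x -> nonunits S x.
Proof. by move=> SV _ Sx [_ h]; split=> // -[y Sy E]; apply: h; exists y => //; apply: SV. Qed.

Lemma valuation_prime V : valuation_ring V -> prime_ideal V (nonunits V).
Proof. by move=> vV; apply: nonunits_prime; [case: vV|exact: valuation_local]. Qed.

Lemma valuation_inv V x : valuation_ring V -> ~ V x -> nonunits V x^-1.
Proof.
move=> [sV tV] nVx; have Vx1 : V x^-1 by case: (tV x).
by apply/nonunitsE => //; split=> //; right; rewrite invrK.
Qed.

(** Zorn's lemma downwards, read on complements because [Zorn_bigcup] speaks of unions; [set0] again
    accounts for the empty chain. *)
Lemma minimal_valuation (F : set (set K)) : (forall V, F V -> valuation_ring V) -> F !=set0 ->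
  (forall G : set (set K), G `<=` F -> total_on G subset -> G !=set0 -> F (\bigcap_(V in G) V)) ->
  exists V, F V /\ forall W, F W -> W `<=` V -> V `<=` W.
Proof.
move=> vF [V0 FV0] capF.
pose F' := [set C : set K | C = set0 \/ F (~` C)].
have [C [FC Cmax]] : exists C, F' C /\ forall D, C `<` D -> ~ F' D.
  apply: Zorn_bigcup => G GF Gtot.
  have [[D GD [x Dx]]|nG] := pselect (exists2 D, G D & D !=set0); last first.
    left; apply/seteqP; split=> // x [D GD Dx].
    by apply: nG; exists D => //; exists x.
  right; pose G' := [set V | F V /\ G (~` V)].
  have -> : ~` (\bigcup_(X in G) X) = \bigcap_(V in G') V.
    rewrite setC_bigcup; apply/seteqP; split=> y hy E.
      by move=> [FE GE]; have := hy _ GE; rewrite setCK.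
    move=> GE; case: (GF _ GE) => [->|FE]; first by rewrite setC0.
    by apply: hy; split=> //; rewrite setCK.
  apply: capF; first by move=> V [].
    move=> V W [_ GV] [_ GW]; case: (Gtot _ _ GV GW) => /subsetC; rewrite !setCK; [right|left]; tauto.
  exists (~` D); split; last by rewrite setCK.
  by case: (GF _ GD) => // D0; rewrite D0 in Dx.
have {FC} FC : F (~` C).
  case: FC => // C0.
  have V0T : V0 = setT.
    apply: contrapT => nT; apply: (Cmax (~` V0)); last by right; rewrite setCK.
    rewrite C0; split=> // h; apply: nT; apply/seteqP; split=> // x _.
    by apply: contrapT => nx; apply: (h x).
  by move: FV0; rewrite V0T C0 setC0.
exists (~` C); split=> // W FW WV x nCx; apply: contrapT => nWx.
apply: (Cmax (~` W)); last by right; rewrite setCK.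
split; first by move=> y Cy Wy; apply: (WV y).
by move/(_ _ nWx).
Qed.

End Valuations.

(** * Points and primes of a scheme *)

(** The closures of those points of [s] that do not specialize to x are removed. *)
Lemma avoiding_nbhd (X : topologicalType) x (s : seq X) :
  exists W, [/\ open W, W x & forall y, y \in s -> W y -> closure [set y] x].
Proof.
elim: s => [|y s [W [oW Wx hW]]]; first by exists setT; split=> //; exact: openT.
have [cyx|ncyx] := pselect (closure [set y] x).
  by exists W; split=> // z; rewrite inE => /orP[/eqP->|/hW].
exists (W `&` ~` closure [set y]); split=> //.
  by apply: openI => //; apply: closed_openC; apply: closed_closure.
move=> z; rewrite inE => /orP[/eqP->|zs] [Wz ncz]; last exact: hW.
by exfalso; apply: ncz; apply: subset_closure.
Qed.

Section AffineOpens.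
Variables (K : fieldType) (X : topologicalType) (O : X -> set K).
Hypothesis sO : forall x, subring (O x).
Implicit Types (U V W : set X) (x y z : X) (f s : K).

Lemma structure_sheaf_subring U : subring (structure_sheaf O U).
Proof.
split; first by move=> x _; apply: sr1.
- by move=> f g hf hg x Ux; apply: srB => //; [apply: hf|apply: hg].
- by move=> f g hf hg x Ux; apply: srM => //; [apply: hf|apply: hg].
Qed.

Section Affine.
Variable U : set X.
Hypothesis aU : affine_open O U.
Local Notation G := (structure_sheaf O U).
Local Notation pr := (prime_of_point O U).

Lemma affine_is_open : open U. Proof. by case: aU. Qed.

Lemma affine_prime x : U x -> prime_ideal G (pr x).
Proof. by case: aU => _ _ _ _ [_ h] /h[]. Qed.

Lemma affine_local x : U x -> O x = loc G (pr x).
Proof. by case: aU => _ _ _ _ [_ h] /h[]. Qed.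

Lemma affine_surj P : prime_ideal G P -> exists2 x, U x & pr x = P.
Proof. by case: aU => _ _ _ h _; apply: h. Qed.

Lemma affine_basis V : V `<=` U -> (open V <-> exists E : set K, E `<=` G /\
          V = [set x | U x /\ exists2 f, E f & ~ pr x f]).
Proof. by case: aU => _ _ _ _ [h _]; apply: h. Qed.

Lemma affine_basic_open s : G s -> open [set x | U x /\ ~ nonunits (O x) s].
Proof.
move=> Gs; apply/affine_basis; first by move=> x [].
exists [set s]; split; first by move=> _ ->.
apply/seteqP; split=> x [Ux h]; split=> //; first by exists s => // -[].
by case: h => _ -> ns ms; apply: ns.
Qed.

Lemma affine_specialization x y : U y ->
  closure [set x] y <-> U x /\ pr x `<=` pr y.
Proof.
move=> Uy; split=> [cxy|[Ux Pxy] W].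
  have Ux : U x.
    by have [z [-> //]] := cxy U (open_nbhs_nbhs (conj affine_is_open Uy)).
  split=> // s [Gs ms]; split=> //; apply: contrapT => nms.
  have [z [-> [_ h]]] := cxy _ (open_nbhs_nbhs (conj (affine_basic_open Gs) (conj Uy nms))).
  exact: h.
rewrite nbhsE => -[V [oV Vy] VW].
have oVU : open (V `&` U) by apply: openI => //; exact: affine_is_open.
have [E [EG VE]] := (affine_basis (@subIsetr _ V U)).1 oVU.
have : (V `&` U) y by [].
rewrite {1}VE => -[_ [f Ef npf]]; exists x; split=> //; apply: VW.
suff : (V `&` U) x by case.
by rewrite VE; split=> //; exists f => // /Pxy.
Qed.

End Affine.

Hypothesis affineO : forall x, exists2 U, affine_open O U & U x.

Lemma specialization_sub x y : closure [set x] y -> O y `<=` O x.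
Proof.
have [U aU Uy] := affineO y; rewrite (affine_specialization aU) // => -[Ux Pxy].
rewrite (affine_local aU Uy) (affine_local aU Ux) => _ [a [s [Ga Gs ns ->]]].
by exists a, s; split=> // /Pxy.
Qed.

(* The generization of x given by a prime of O x *)
Lemma prime_point x Q : prime_ideal (O x) Q -> exists y, [/\ closure [set y] x,
  forall f, O x f -> (nonunits (O y) f <-> Q f) & O y = loc (O x) Q].
Proof.
move=> pQ; have [U aU Ux] := affineO x.
have sG := structure_sheaf_subring U.
have GO : structure_sheaf O U `<=` O x by move=> f; apply.
have pP := prime_contract sG GO pQ.
have [y Uy yE] := affine_surj aU pP.
have [iQ Q1 QM] := pQ.
have cyx : closure [set y] x.
  apply/(affine_specialization aU y Ux); split=> //; rewrite yE => f [Qf Gf]; split=> //.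
  exact: (prime_sub_nonunits (sO x) pQ).
have OxE := affine_local aU Ux; have OyE := affine_local aU Uy.
have s0 z s : U z -> ~ prime_of_point O U z s -> s != 0.
  by move=> Uz; apply: notin_neq0; exact: (affine_prime aU Uz).
have iff f : O x f -> (nonunits (O y) f <-> Q f).
  move=> Oxf; move: (Oxf); rewrite {1}OxE => -[a [s [Ga Gs ns fE]]].
  have sx0 := s0 _ _ Ux ns.
  have Osi : O x s^-1 by rewrite OxE; exists 1, s; split=> //; [exact: sr1|rewrite div1r].
  have nQs : ~ Q s.
    by move=> Qs; apply: Q1; rewrite -(divff sx0); apply: (idMr iQ).
  have aE : a = f * s by rewrite fE divfK.
  have Oyi := specialization_sub cyx Osi.
  have mE : nonunits (O y) = ext (structure_sheaf O U) (prime_of_point O U y) (prime_of_point O U y).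
    by rewrite {1}OyE loc_nonunits //; exact: (affine_prime aU Uy).
  split=> [mf|Qf].
    have : prime_of_point O U y a.
      split=> //; have : local_ring (O y) by rewrite OyE; apply: loc_local => //; apply: (affine_prime aU Uy).
      by move=> lO; rewrite aE; apply: (idMr lO) => //; apply: Gs.
    by rewrite yE aE => -[/QM[] //]; apply: GO.
  have : prime_of_point O U y a.
    by rewrite yE; split=> //; rewrite aE; apply: (idMr iQ) => //; apply: GO.
  move=> pa; rewrite mE; exists a, s; split=> //.
  by rewrite yE => -[].
exists y; split=> //; apply/seteqP; split=> f.
  rewrite OyE => -[a [s [Ga Gs ns ->]]]; exists a, s; split=> //; [exact: GO|exact: GO|].
  by move=> Qs; apply: ns; rewrite yE.
move=> [a [s [Oa Os nQs ->]]].
have nms : ~ nonunits (O y) s by move=> /(iff _ Os).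
have [_ Osi] := unit_inv (specialization_sub cyx Os) nms.
apply: srM => //; exact: specialization_sub Oa.
Qed.

Lemma local_O x : local_ring (O x).
Proof.
have [U aU Ux] := affineO x; rewrite (affine_local aU Ux); apply: loc_local.
  exact: structure_sheaf_subring.
exact: affine_prime.
Qed.

Lemma specialization_loc x y : closure [set y] x ->
  O y = loc (O x) (nonunits (O y) `&` O x).
Proof.
move=> cyx; have OO := specialization_sub cyx.
apply/seteqP; split=> f.
  have [U aU Ux] := affineO x; have [Uy Pyx] := (affine_specialization aU y Ux).1 cyx.
  rewrite {1}(affine_local aU Uy) => -[a [s [Ga Gs ns ->]]].
  exists a, s; split=> //; [exact: Ga|exact: Gs|].
  by move=> [ms _]; apply: ns.
move=> [a [s [Oa Os ns ->]]].
have nms : ~ nonunits (O y) s by move=> h; apply: ns.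
by have [_ Osi] := unit_inv (OO _ Os) nms; apply: srM => //; apply: OO.
Qed.

Lemma prime_nonunits x : prime_ideal (O x) (nonunits (O x)).
Proof. by apply: nonunits_prime => //; apply: local_O. Qed.

Lemma specialization_prime x y : closure [set y] x ->
  prime_ideal (O x) (nonunits (O y) `&` O x).
Proof.
by move=> cyx; apply: prime_contract (prime_nonunits y) => //; apply: specialization_sub.
Qed.

Lemma open_domain f : open [set x | O x f].
Proof.
rewrite openE => x Oxf; have [U aU Ux] := affineO x.
have := Oxf; rewrite /= (affine_local aU Ux) => -[a [s [Ga Gs ns fE]]].
have oD := affine_basic_open aU Gs.
rewrite /interior /= nbhsE; exists [set z | U z /\ ~ nonunits (O z) s]; first by split=> //; split=> // ms; apply: ns.
move=> z [Uz nz]; rewrite /= (affine_local aU Uz); exists a, s; split=> // -[_]; exact: nz.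
Qed.

(** The point e belongs to the zero prime of some [O x]. By irreducibility any nonempty open set
    meets the chart of e, and a nonempty open subset of that chart is defined by a function that is
    nonzero somewhere, hence nonzero at e. *)
Lemma generic_point : [set: X] !=set0 ->
  (forall U V, open U -> open V -> U !=set0 -> V !=set0 -> U `&` V !=set0) ->
  (forall x f, loc (O x) [set 0] f) ->
  exists e, O e = setT /\ forall y, closure [set e] y.
Proof.
move=> [x _] irr fO.
have [e [cex me Oe]] := prime_point (zero_prime (sO x)).
have OeT : O e = setT by rewrite Oe; apply/seteqP; split=> // f _; apply: fO.
exists e; split=> // y W; rewrite nbhsE => -[V [oV Vy] VW].
have [U aU Ue] := affineO e.
have [||z [Uz Vz]] := irr U V (affine_is_open aU) oV; [by exists e|by exists y|].
have oVU : open (V `&` U) by apply: openI => //; exact: affine_is_open.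
have [E [EG VE]] := (affine_basis aU (@subIsetr _ V U)).1 oVU.
have : (V `&` U) z by [].
rewrite {1}VE => -[_ [f Ef npf]]; exists e; split=> //; apply: VW.
suff : (V `&` U) e by case.
rewrite VE; split=> //; exists f => // -[_ mf]; apply: npf.
have -> : f = 0.
  apply: contrapT => /eqP f0; by apply: (nonunits_inv mf f0); rewrite OeT.
by case: (affine_prime aU Uz) => i _ _; apply: id0 i.
Qed.

End AffineOpens.

(** * Resolutions of a two-dimensional normal local ring *)

(** A is seen inside its fraction field, so that it can be compared with the local rings of X as
    subsets of [K]; [base_dim] says that its dimension is at most 2. *)
Record base_ring (K : fieldType) (B : set K) (k : closedFieldType)
    (iota : {rmorphism k -> K}) : Prop := BaseRing {
  base_subring : subring B;
  base_noetherian : noetherian B;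
  base_local : local_ring B;
  base_dim : forall N, ~ chain3 B N;
  base_normal : forall p x, coefs_in B p -> p \is monic -> root p x -> B x;
  base_const : forall c, B (iota c);
  base_residue : forall x, B x -> exists c, nonunits B (x - iota c);
  base_fraction : forall f, loc B [set 0] f }.

(** Properness is kept as quasi-compactness and as the valuative criterion for valuation rings of
    [K] itself, where the lifted closed point is the center, that is, the point whose local ring is
    dominated. *)
Record resolved_by (K : fieldType) (B : set K) (X : topologicalType) (O : X -> set K) : Prop :=
 ResolvedBy {
  res_subring : forall x, subring (O x);
  res_base : forall x, B `<=` O x;
  res_affine : forall x, exists U s,
    [/\ affine_open O U, U x & structure_sheaf O U = adjoins B s];
  res_regular : forall x, regular_local (O x);
  res_compact : compact [set: X];
  res_center : forall V, valuation_ring V -> B `<=` V ->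
    exists y, O y `<=` V /\ nonunits (O y) `<=` nonunits V;
  res_center_unique : forall V y z, valuation_ring V ->
    O y `<=` V -> nonunits (O y) `<=` nonunits V ->
    O z `<=` V -> nonunits (O z) `<=` nonunits V -> y = z }.

Section ConstantField.
Variables (K : fieldType) (k : closedFieldType) (iota : {rmorphism k -> K}).
Implicit Types (S P : set K) (t : K).

Lemma iota_neq0 c : c != 0 -> iota c != 0. Proof. by rewrite fmorph_eq0. Qed.

(** Over the algebraically closed field k, q splits into linear factors, and a prime that contains a
    product of factors [t - iota c] contains one of them. *)
Lemma prime_poly_root S P (q : {poly k}) t : subring S -> prime_ideal S P ->
  (forall c, S (iota c)) -> S t -> q != 0 -> P (map_poly iota q).[t] ->
  exists2 c, root q c & P (t - iota c).
Proof.
move=> sS [iP P1 PM] Sc St; move: {2}(size q) (leqnn (size q)) => n.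
elim: n q => [|n IH] q sq q0 Pq.
  by move: sq; rewrite leqn0 size_poly_eq0 (negPf q0).
have [s1|s1] := eqVneq (size q) 1%N.
  move/eqP: s1 => /size_poly1P[c c0 qE]; case: P1.
  move: Pq; rewrite qE map_polyC hornerC /= => Pc.
  rewrite -(mulVf (iota_neq0 c0)); apply: (idM iP) => //.
  by rewrite -fmorphV.
have [c rc] := closed_rootP q s1.
have [q' qE] := factor_theorem _ _ rc.
have q'0 : q' != 0 by apply: contra_neq q0 => q'0; rewrite qE q'0 mul0r.
have sq' : (size q' <= n)%N.
  by move: sq; rewrite qE size_Mmonic ?monicXsubC // size_XsubC addn2.
have S' (r : {poly k}) : S (map_poly iota r).[t].
  by apply: horner_in => // i; rewrite coef_map; apply: Sc.
move: Pq; rewrite qE rmorphM /= hornerM map_polyXsubC hornerXsubC => /PM[|||h].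
- exact: S'.
- exact: srB.
- by move=> /(IH _ sq' q'0)[d rd h]; exists d => //; rewrite rootM rd.
- by exists c => //; rewrite -qE.
Qed.

Lemma bad_values (q : {poly k}) : q != 0 -> exists s : seq k, forall c, c \notin s -> ~~ root q c.
Proof.
move=> q0; have [s qE] := closed_field_poly_normal q; exists s => c.
by rewrite {1}qE rootZ ?lead_coef_eq0 // root_prod_XsubC.
Qed.

(** An algebraically closed field is infinite: 1 plus the product of the X - a has a root, and no a
    is one. *)
Lemma exists_notin (s : seq k) : exists c, c \notin s.
Proof.
pose q : {poly k} := \prod_(a <- s) ('X - a%:P) + 1.
have [->|s1] := eqVneq s [::]; first by exists 0.
have sq : size q = (size s).+1.
  by rewrite size_addl size_prod_XsubC // size_polyC oner_eq0 ltnS lt0n size_eq0.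
have /closed_rootP[c] : size q != 1%N by rewrite sq eqSS size_eq0.
rewrite /root hornerD hornerC => /eqP E; exists c; rewrite -root_prod_XsubC /root.
by apply/eqP => E0; move: E; rewrite E0 add0r => /eqP; rewrite oner_eq0.
Qed.

End ConstantField.

(** * Centers of valuations and specialization to rational points *)

Section Resolution.
Variables (K : fieldType) (B : set K) (k : closedFieldType) (iota : {rmorphism k -> K}).
Variables (X : topologicalType) (O : X -> set K).
Hypotheses (bB : base_ring B iota) (rO : resolved_by B O).
Implicit Types (x y z : X) (V S P Q : set K) (f t : K).

Let sB := base_subring bB.
Let sO := res_subring rO.
Let BO := res_base rO.

Lemma affineO x : exists2 U, affine_open O U & U x.
Proof. by have [U [s [aU Ux _]]] := res_affine rO x; exists U. Qed.

Lemma O_const x c : O x (iota c).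
Proof. by apply: BO; apply: base_const bB _. Qed.

Lemma O_fraction x f : loc (O x) [set 0] f.
Proof.
have [a [s [Ba Bs s0 fE]]] := base_fraction bB f.
by exists a, s; split=> //; apply: BO.
Qed.

(** A valuation ring that dominates the common local ring has both points as centers. *)
Lemma O_inj x y : O x = O y -> x = y.
Proof.
move=> E; have [V [vV OV mV]] := dominating_valuation (sO x) (local_O sO affineO x).
by apply: (res_center_unique rO vV) => //; rewrite -E.
Qed.

Lemma specialization_unique x y z : closure [set y] x -> closure [set z] x ->
  nonunits (O y) `&` O x = nonunits (O z) `&` O x -> y = z.
Proof.
move=> cy cz E; apply: O_inj.
by rewrite (specialization_loc sO affineO cy) (specialization_loc sO affineO cz) E.
Qed.

(* The center of V lies in the closure of x: compose V with the valuation ring of an overring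
   of V that dominates O x. *)
Lemma center_specialization V x y : valuation_ring V -> O y `<=` V ->
  nonunits (O y) `<=` nonunits V -> nonunits (O x) `<=` nonunits V -> closure [set x] y.
Proof.
move=> vV OV mV mx; have sV : subring V by case: vV.
have lV := valuation_local vV; have lx := local_O sO affineO x.
(* [N] is the largest [O x]-module inside m_V and [T] is its multiplier ring. [T] contains both [V]
   and [O x], while the ideal generated by m_x in [T] stays inside [N] and is therefore proper. *)
pose N : set K := [set w : K | forall g, O x g -> nonunits V (g * w)].
pose T : set K := [set f | forall w : K, N w -> N (f * w)].
have sT : subring T.
  split; first by move=> z Nz; rewrite mul1r.
  - move=> f g Tf Tg z Nz h Oh; rewrite mulrBl mulrBr.
    by apply: (idB lV sV); [apply: Tf|apply: Tg].
  - by move=> f g Tf Tg z Nz; rewrite -mulrA; apply/Tf/Tg.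
have VT : V `<=` T.
  by move=> v Vv z Nz g Og; rewrite mulrCA; apply: (idM lV) => //; apply: Nz.
have OT : O x `<=` T.
  by move=> f Of z Nz g Og; rewrite mulrA; apply: Nz; apply: (srM (sO x)).
have mN : nonunits (O x) `<=` N.
  by move=> f mf g Og; apply: mx; apply: (idM lx).
have [||V1 [vV1 TV1 mV1]] := @chevalley _ T (nonunits (O x)) sT.
- by move=> f [Of _]; apply: OT.
- move=> h; have : N 1.
    apply: h => //; split.
    + by move=> g Og; rewrite mulr0; apply: id0 lV.
    + by move=> u v Nu Nv g Og; rewrite mulrDr; apply: (idD lV); [apply: Nu|apply: Nv].
    + by move=> s v Ts Nv; apply: Ts.
  move=> /(_ 1 (sr1 (sO x))); rewrite mulr1; apply: nonunits1; exact: sr1.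
have VV1 : V `<=` V1 by apply: subset_trans TV1.
have OV1 : O y `<=` V1 by apply: subset_trans VV1.
have pQ : prime_ideal (O y) (nonunits V1 `&` O y).
  by apply: prime_contract (valuation_prime vV1).
have [z [czy mz Oz]] := prime_point sO affineO pQ.
suff -> : x = z by [].
apply: (res_center_unique rO vV1) => //.
- by apply: subset_trans TV1.
- rewrite Oz => _ [a [s [Oa Os ns ->]]].
  have nVs : ~ nonunits V1 s by move=> ms; apply: ns.
  have [_ V1i] := unit_inv (OV1 _ Os) nVs.
  by apply: srM => //; [case: vV1|apply: OV1].
- move=> f mf; have Of : O z f by case: mf.
  have lV1 := valuation_local vV1.
  move: Of; rewrite Oz => -[a [s [Oa Os ns fE]]].
  have nVs : ~ nonunits V1 s by move=> ms; apply: ns.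
  have [s0 V1i] := unit_inv (OV1 _ Os) nVs.
  have lz := local_O sO affineO z.
  have : nonunits (O z) a.
    have -> : a = f * s by rewrite fE divfK.
    apply: (idMr lz) => //; exact: (specialization_sub affineO czy).
  move/(mz _ Oa) => [ma _]; rewrite fE; exact: (idMr lV1).
Qed.

Definition exceptional x := nonunits B `<=` nonunits (O x).
Definition rational_point x := forall t, O x t -> exists c, nonunits (O x) (t - iota c).

Lemma residue_poly p : coefs_in B p -> exists2 q : {poly k}, (size q <= size p)%N &
  forall i, nonunits B (p`_i - iota q`_i).
Proof.
move=> hp; have /choice[c hc] : forall i, exists c, nonunits B (p`_i - iota c).
  by move=> i; apply: base_residue bB _ _.
exists (\poly_(i < size p) c i); first exact: size_poly.
move=> i; rewrite coef_poly; case: ltnP => [_|h]; first exact: hc.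
by rewrite nth_default // rmorph0 subr0; apply: id0 (base_local bB).
Qed.

Lemma residue_horner S P (p : {poly K}) (q : {poly k}) t : subring S -> B `<=` S -> ideal S P ->
  nonunits B `<=` P -> S t -> (forall i, nonunits B (p`_i - iota q`_i)) ->
  P (p.[t] - (map_poly iota q).[t]).
Proof.
move=> sS BS iP mP St h; rewrite -hornerN -hornerD.
apply: (horner_inI sS iP) => // i; rewrite coefD coefN coef_map; exact: mP.
Qed.

(** The point y is the center of a valuation ring that is minimal among those dominating [B] and
    having m_x among their nonunits. Minimality forces its residue field to be k, and [O y] inherits
    this. *)
Lemma exists_rational_specialization x :
  exists y, [/\ closure [set x] y, exceptional y & rational_point y].
Proof.
have lx := local_O sO affineO x; have lB := base_local bB.
pose F := [set V | [/\ valuation_ring V, B `<=` V, nonunits B `<=` nonunits V &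
  nonunits (O x) `<=` nonunits V]].
have [|||V [[vV BV mBV mxV] Vmin]] := @minimal_valuation K F.
- by move=> V [].
(* The family is nonempty: in B + m_x, the maximal ideals of [B] and of [O x] generate a proper
   ideal, since otherwise m_x would contain a unit of [B]. *)
- pose S0 : set K := [set f | exists b m, [/\ B b, nonunits (O x) m & f = b + m]].
  have sS0 : subring S0.
    split; first by exists 1, 0; rewrite addr0; split=> //; [exact: sr1|exact: id0 lx].
    - move=> _ _ [b [m [Bb mm ->]]] [b' [m' [Bb' mm' ->]]]; exists (b - b'), (m - m').
      by split; [exact: srB|exact: (idB lx (sO x))|ring].
    - move=> _ _ [b [m [Bb mm ->]]] [b' [m' [Bb' mm' ->]]].
      exists (b * b'), (b * m' + (b' + m') * m); split; [exact: srM| |ring].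
      have Om' : O x m' by case: mm'.
      apply: (idD lx); apply: (idM lx) => //; first exact: BO.
      by apply: (srD (sO x)) => //; apply: BO.
  have BS0 : B `<=` S0 by move=> b Bb; exists b, 0; rewrite addr0; split=> //; exact: id0 lx.
  have mS0 : nonunits (O x) `<=` S0.
    by move=> m mm; exists 0, m; rewrite add0r; split=> //; exact: sr0.
  pose J := nonunits B `|` nonunits (O x).
  have [||V [vV SV JV]] := @chevalley _ S0 J sS0.
  + by move=> f [[Bf _]|mf]; [exact: BS0|exact: mS0].
  + move=> h; have [||b [m [mb mm E]]] := h [set f | exists b m, [/\ nonunits B b, nonunits (O x) m & f = b + m]].
    * split.
      - by exists 0, 0; rewrite addr0; split=> //; [exact: id0 lB|exact: id0 lx].
      - move=> _ _ [b [m [mb mm ->]]] [b' [m' [mb' mm' ->]]]; exists (b + b'), (m + m').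
        by split; [exact: (idD lB)|exact: (idD lx)|ring].
      - move=> _ _ [b [m [Bb mm ->]]] [b' [m' [mb' mm' ->]]].
        exists (b * b'), (b * m' + (b' + m') * m); split; [exact: (idM lB)| |by rewrite /GRing.scale /=; ring].
        have Om' : O x m' by case: mm'.
        apply: (idD lx); apply: (idM lx) => //; first exact: BO.
        by apply: (srD (sO x)) => //; apply: BO; case: mb'.
    * move=> f [mf|mf].
        by exists f, 0; rewrite addr0; split=> //; exact: id0 lx.
      by exists 0, f; rewrite add0r; split=> //; exact: id0 lB.
    have [y By yE] := local_unit sB lB mb.
    case: mm => _; apply; exists y; first exact: BO.
    by rewrite -yE E; ring.
  exists V; split=> //.
  + exact: subset_trans SV.
  + by move=> f mf; apply: JV; left.
  + by move=> f mf; apply: JV; right.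
(* The intersection of a chain is again a valuation ring: if z is missing from one member, then 1/z
   lies in all of them. *)
- move=> G GF Gtot [W GW]; have [vW BW mBW mxW] := GF _ GW.
  have sW : subring W by case: vW.
  have sG : subring (\bigcap_(V in G) V).
    split; first by move=> V /GF[[sV _] _ _ _]; apply: sr1.
    - by move=> f g hf hg V GV; have [[sV _] _ _ _] := GF _ GV; apply: srB => //; [apply: hf|apply: hg].
    - by move=> f g hf hg V GV; have [[sV _] _ _ _] := GF _ GV; apply: srM => //; [apply: hf|apply: hg].
  have mG f : (forall V, G V -> nonunits V f) -> nonunits (\bigcap_(V in G) V) f.
    move=> h; split; first by move=> V /h[].
    by move=> [g hg E]; have [_] := h _ GW; apply; exists g => //; apply: hg.
  split.
  + split=> // z; have [|] := pselect ((\bigcap_(V in G) V) z); first by left.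
    move=> /existsNP[V /not_implyP[GV nVz]]; right=> V' GV'.
    have [[sV tV] _ _ _] := GF _ GV; have [[sV' tV'] _ _ _] := GF _ GV'.
    case: (Gtot _ _ GV GV') => h; first by apply: h; case: (tV z).
    by case: (tV' z) => // /h.
  + by move=> b Bb V /GF[_ h _ _]; apply: h.
  + by move=> b mb; apply: mG => V /GF[_ _ h _]; apply: h.
  + by move=> b mb; apply: mG => V /GF[_ _ _ h]; apply: h.
have sV : subring V by case: vV.
have lV := valuation_local vV; have pV := valuation_prime vV.
have Vc c : V (iota c) by apply/BV/(base_const bB).
have resV t : V t -> exists c, nonunits V (t - iota c).
  move=> Vt; apply: contrapT => nc.
  (* A residue outside k is transcendental over k, so t and m_V generate a proper ideal of B[t] +
     m_V. A valuation ring with this ideal among its nonunits lies inside [V], and by minimality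
     equals [V]; then t would have residue 0. *)
  pose S1 : set K := [set f | exists p m, [/\ coefs_in B p, nonunits V m & f = p.[t] + m]].
  have Vp p : coefs_in B p -> V p.[t] by move=> hp; apply: horner_in => // i; apply: BV.
  have B0 := sr0 sB.
  have sS1 : subring S1.
    split.
    - exists 1, 0; rewrite hornerC addr0; split=> //; last exact: id0 lV.
      by apply: coefs_inC => //; apply: sr1.
    - move=> _ _ [p [m [hp mm ->]]] [p' [m' [hp' mm' ->]]]; exists (p - p'), (m - m').
      split; [|exact: (idB lV sV)|by rewrite hornerD hornerN; ring].
      by apply: coefs_inD => //; [exact: (srD sB)|exact: coefs_inN].
    - move=> _ _ [p [m [hp mm ->]]] [p' [m' [hp' mm' ->]]].
      exists (p * p'), (p.[t] * m' + (p'.[t] + m') * m).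
      split; [exact: coefs_inM| |by rewrite hornerM; ring].
      apply: (idD lV); apply: (idM lV) => //; first exact: Vp.
      by apply: srD => //; [exact: Vp|case: mm'].
  have mS1 : nonunits V `<=` S1.
    move=> m mm; exists 0, m; rewrite horner0 add0r; split=> //.
    by move=> i; rewrite coef0.
  pose J := [set t] `|` nonunits V.
  pose N : set K := [set f | exists p m, [/\ coefs_in B p, nonunits V m & f = t * p.[t] + m]].
  have N1 : ~ N 1.
    move=> [p [m [hp mm E]]].
    have hq : coefs_in B (1 - 'X * p).
      apply: coefs_inD; [exact: (srD sB)|by apply: coefs_inC => //; exact: sr1|].
      by apply: coefs_inN => //; apply: coefs_inM => //; apply: coefs_inX.
    have [q sq hq'] := residue_poly hq.
    have q0 : q != 0.
      apply/eqP => q0; have := hq' 0%N.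
      rewrite q0 coef0 rmorph0 subr0 coefB coefC coefXM subr0 /=.
      by apply: nonunits1; apply: sr1.
    have := residue_horner sV BV lV mBV Vt hq'.
    have -> : (1 - 'X * p).[t] = m by rewrite !hornerE E; ring.
    move=> /(idB lV sV mm); rewrite subKr => mq.
    by have [c _ mc] := prime_poly_root sV pV Vc Vt q0 mq; apply: nc; exists c.
  have [||V' [vV' SV' JV']] := @chevalley _ S1 J sS1.
  - move=> f [->|]; last exact: mS1.
    exists 'X, 0; rewrite hornerX addr0; split=> //; [exact: coefs_inX|exact: id0 lV].
  - move=> h; apply: N1; apply: h.
      split.
      - by exists 0, 0; rewrite horner0 mulr0 addr0; split=> //; [move=> i; rewrite coef0|exact: id0 lV].
      - move=> _ _ [p [m [hp mm ->]]] [p' [m' [hp' mm' ->]]]; exists (p + p'), (m + m').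
        split; [|exact: (idD lV)|by rewrite hornerD; ring].
        by apply: coefs_inD => //; exact: (srD sB).
      - move=> _ _ [p [m [hp mm ->]]] [p' [m' [hp' mm' ->]]].
        exists (p * p'), (p.[t] * m' + (t * p'.[t] + m') * m).
        split; [exact: coefs_inM| |by rewrite hornerM /GRing.scale /=; ring].
        apply: (idD lV); apply: (idM lV) => //; first exact: Vp.
        by apply: srD => //; [apply: srM => //; exact: Vp|case: mm'].
    move=> f [->|mf].
      exists 1, 0; rewrite hornerC mulr1 addr0; split=> //; last exact: id0 lV.
      by apply: coefs_inC => //; apply: sr1.
    by exists 0, f; rewrite horner0 mulr0 add0r; split=> // i; rewrite coef0.
  have mV' : nonunits V `<=` nonunits V' by move=> f mf; apply: JV'; right.
  have V'V : V' `<=` V.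
    move=> f V'f; apply: contrapT => nVf.
    have := mV' _ (valuation_inv vV nVf); have f0 : f != 0.
      by apply/eqP => f0; apply: nVf; rewrite f0; apply: sr0.
    by move=> h; apply: (nonunits_inv h); rewrite ?invr_eq0 ?invrK.
  have VV' : V `<=` V'.
    apply: Vmin => //; split=> //.
    + apply: subset_trans SV' => b Bb; exists b%:P, 0; rewrite hornerC addr0; split=> //.
        exact: coefs_inC.
      exact: id0 lV.
    + exact: subset_trans mV'.
    + exact: subset_trans mV'.
  apply: nc; exists 0; rewrite rmorph0 subr0.
  by apply: (nonunits_dominated (V := V') VV') => //; apply: JV'; left.
have [y [OyV myV]] := res_center rO vV BV.
exists y; split.
- exact: (center_specialization vV).
- move=> b mb; apply: (nonunits_dominated OyV myV); last exact: mBV.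
  by apply: BO; case: mb.
- move=> t Ot; have [c mc] := resV _ (OyV _ Ot); exists c.
  apply: (nonunits_dominated OyV myV) => //.
  by apply: (srB (sO y)) => //; apply: O_const.
Qed.

End Resolution.

(** * Contraction of primes from a localization *)

Section Dimension.
Variable K : fieldType.
Implicit Types (B P Q N : set K).

Lemma loc_contract_proper B P Q1 Q2 : subring B -> prime_ideal B P ->
  prime_ideal (loc B P) Q1 -> prime_ideal (loc B P) Q2 -> proper Q1 Q2 ->
  proper (Q1 `&` B) (Q2 `&` B).
Proof.
move=> sB pP pQ1 pQ2 [Q12 nQ21]; have [iQ1 _ _] := pQ1; have [iQ2 _ _] := pQ2.
have BL := loc_sub sB pP.
split; first by move=> f [/Q12 Qf Bf].
move=> h; apply: nQ21 => f Q2f; have [a [s [Ba Bs ns fE]]] := idS iQ2 Q2f.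
have s0 := notin_neq0 pP ns.
have Q2a : Q2 a.
  have -> : a = s * f by rewrite fE mulrC divfK.
  by apply: (idM iQ2) => //; apply: BL.
have [Q1a _] := h _ (conj Q2a Ba).
rewrite fE mulrC; apply: (idM iQ1) => //.
by exists 1, s; split=> //; [exact: sr1|rewrite div1r].
Qed.

Lemma loc_contract_nonzero B P Q : subring B -> prime_ideal B P ->
  prime_ideal (loc B P) Q -> (exists2 f, Q f & f != 0) -> exists2 f, (Q `&` B) f & f != 0.
Proof.
move=> sB pP [iQ _ _] [f Qf f0]; have [a [s [Ba Bs ns fE]]] := idS iQ Qf.
exists a; last by apply: contra_neq f0 => a0; rewrite fE a0 mul0r.
split=> //; have -> : a = s * f by rewrite fE mulrC divfK // (notin_neq0 pP ns).
by apply: (idM iQ) => //; apply: loc_sub.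
Qed.

Lemma loc_prime_contract B P Q : subring B -> prime_ideal B P -> prime_ideal (loc B P) Q ->
  prime_ideal B (Q `&` B) /\ Q `&` B `<=` P.
Proof.
move=> sB pP pQ; have sL := loc_subring sB pP.
split; first exact: prime_contract (loc_sub sB pP) pQ.
move=> f [Qf Bf]; have := prime_sub_nonunits sL pQ Qf; rewrite (loc_nonunits pP).
exact: (ext_contract pP pP).
Qed.

Lemma chain3_loc B P N : subring B -> prime_ideal B P -> chain3 (loc B P) N -> chain3 B P.
Proof.
move=> sB pP [P1 [P2 [P3 [[p1 p2 p3] [h0 h12 h23 _]]]]].
have [q1 _] := loc_prime_contract sB pP p1; have [q2 _] := loc_prime_contract sB pP p2.
have [q3 q3P] := loc_prime_contract sB pP p3.
exists (P1 `&` B), (P2 `&` B), (P3 `&` B); split=> //; split=> //.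
- exact: (loc_contract_nonzero sB pP p1).
- exact: (loc_contract_proper sB pP p1).
- exact: (loc_contract_proper sB pP p2).
Qed.

End Dimension.

(** * Dimension, divisors and closed points of X *)

Section Points.
Variables (K : fieldType) (B : set K) (k : closedFieldType) (iota : {rmorphism k -> K}).
Variables (X : topologicalType) (O : X -> set K).
Hypotheses (bB : base_ring B iota) (rO : resolved_by B O).
Implicit Types (x y z : X) (V S P Q : set K) (f t : K).

Let sB := base_subring bB.
Let sO := res_subring rO.
Let BO := res_base rO.
Let aO := affineO rO.

(** The values at y, which lie in k, are subtracted from the algebra generators, so that these
    vanish at y as [dimension_adjoins] requires. *)
Lemma rational_chart y : exceptional B O y -> rational_point iota O y -> exists U s,
  [/\ affine_open O U, U y, structure_sheaf O U = adjoins B s & {in s, forall t, nonunits (O y) t}].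
Proof.
move=> ey ry; have [U [s [aU Uy UE]]] := res_affine rO y.
have Gs : {in s, forall t, O y t}.
  move=> t ts; suff h : structure_sheaf O U t by apply: h.
  by rewrite UE; apply: adjoins_gen.
suff [s' sE' ms] : exists2 s', adjoins B s = adjoins B s' & {in s', forall t, nonunits (O y) t}.
  by exists U, s'; split=> //; rewrite UE.
have : forall t, exists c, O y t -> nonunits (O y) (t - iota c).
  move=> t; have [Ot|nOt] := pselect (O y t); last by exists 0.
  by have [c] := ry _ Ot; exists c.
move=> /choice[c hc]; exists [seq t - iota (c t) | t <- s]; last first.
  by move=> _ /mapP[t ts ->]; apply/hc/Gs.
have Bc S t : B `<=` S -> S (iota (c t)) by apply; apply: base_const bB _.
have sA s' : subring (adjoins B s') by apply: adjoins_subring.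
have BA s' : B `<=` adjoins B s' by apply: adjoins_sub.
apply/seteqP; split; apply: adjoins_min => //.
  move=> t ts; rewrite -[t](subrK (iota (c t))); apply: srD => //; last exact: Bc.
  by apply: adjoins_gen => //; apply/mapP; exists t.
move=> _ /mapP[t ts ->]; apply: srB => //; last exact: Bc.
exact: adjoins_gen.
Qed.

Lemma dimension_chart y U s : affine_open O U -> U y -> structure_sheaf O U = adjoins B s ->
  {in s, forall t, nonunits (O y) t} -> ~ chain3 (structure_sheaf O U) (prime_of_point O U y).
Proof.
move=> aU Uy UE ms; have pP := affine_prime aU Uy; rewrite UE.
apply: dimension_adjoins => //; last exact: base_dim bB _.
- exact: base_noetherian bB.
- by move=> t _; apply: base_fraction bB _.
- by rewrite -UE.
- by move=> t ts; split; [rewrite UE; apply: adjoins_gen|apply: ms].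
Qed.

(** The bound is obtained at a rational specialization of x, whose chart is generated over [B] by
    functions vanishing there, and passes to x by localization. *)
Lemma point_dim x : ~ chain3 (O x) (nonunits (O x)).
Proof.
have [y [cxy ey ry]] := exists_rational_specialization bB rO x.
have [U [s [aU Uy UE ms]]] := rational_chart ey ry.
rewrite {1}(specialization_loc sO aO cxy) => /(chain3_loc (sO y) (specialization_prime sO aO cxy)).
rewrite {1}(affine_local aU Uy) => /(chain3_loc (structure_sheaf_subring sO U) (affine_prime aU Uy)).
exact: (dimension_chart aU Uy UE ms).
Qed.

Definition divisor_point x := krull_dim (O x) 1.

Lemma point_dims x : exists s : seq K,
  [/\ (size s <= 2)%N, krull_dim (O x) (size s) & nonunits (O x) = ideal_gen (O x) [set` s]].
Proof. by apply: (regular_dim_le2 (sO x) (res_regular rO x)); apply: point_dim. Qed.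

Lemma point_hartogs_prime x f : (forall P, height_one (O x) P -> loc (O x) P f) -> O x f.
Proof.
apply: hartogs; [exact: sO|exact: (res_regular rO x)|exact: point_dim|exact: (O_fraction bB rO)].
Qed.

(** Dimension zero is excluded by the nonzero prime [P]; a chain of length two in [O y] would
    contract to a nonzero prime strictly inside [P]. *)
Lemma height_one_divisor x P : height_one (O x) P -> exists y,
  [/\ closure [set y] x, divisor_point y, nonunits (O y) `&` O x = P & O y = loc (O x) P].
Proof.
move=> [pP P0 Pmin]; have [y [cyx my OyE]] := prime_point sO aO pP.
have [iP _ _] := pP.
have mE : nonunits (O y) `&` O x = P.
  by apply/seteqP; split=> [f [mf Of]|f Pf]; [apply/my|split; [apply/my => //|]; exact: idS Pf].
exists y; split=> //; have [s [ls ds ms]] := point_dims y.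
have P0' : exists2 f, nonunits (O y) f & f != 0.
  by have [f Pf f0] := P0; exists f => //; apply/my => //; apply: idS Pf.
case: s ls ds ms => [|p [|q [|]]] //= _ ds ms.
  by case: P0' => f; rewrite ms => /ideal_gen_nil ->; rewrite eqxx.
have [[C [pC ltC]] _] := ds; move: pC ltC; rewrite OyE => pC ltC.
have c0 := pC 0%N isT; have c1 := pC 1%N isT; have c2 := pC 2%N isT.
have [q1 q1P] := loc_prime_contract (sO x) pP c1.
have [q2 q2P] := loc_prime_contract (sO x) pP c2.
have [_ []] := loc_contract_proper (sO x) pP c1 c2 (ltC 1%N isT).
apply: subset_trans q2P _; apply: Pmin => //.
apply: (loc_contract_nonzero (sO x) pP c1); apply: (@strict_nonzero _ (loc (O x) P) _ _ _ (ltC 0%N isT)).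
by case: c0.
Qed.

Lemma divisor_height_one x y : closure [set y] x -> divisor_point y ->
  height_one (O x) (nonunits (O y) `&` O x).
Proof.
move=> cyx dy; have pP := specialization_prime sO aO cyx.
have OyE := specialization_loc sO aO cyx.
have [[C [pC ltC]] _] := dy.
have [f Cf f0] : exists2 f, C 1%N f & f != 0.
  by apply: (@strict_nonzero _ (O y) (C 0%N)); [case: (pC 0%N isT)|exact: ltC].
have mf := prime_sub_nonunits (sO y) (pC 1%N isT) Cf.
split=> //.
  have := @loc_contract_nonzero _ (O x) _ (nonunits (O y)) (sO x) pP.
  rewrite -OyE; apply; [exact: prime_nonunits|by exists f].
move=> Q pQ [g Qg g0] QP; have pE := ext_prime (sO x) pP pQ QP.
have E : ext (O x) (nonunits (O y) `&` O x) Q = nonunits (O y).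
  apply: krull_dim1_height_one => //; [exact: local_O|by rewrite {1}OyE|].
  by exists g => //; apply: (ext_sub (sO x) pP).
move=> h [mh Oh]; apply: (ext_contract pP pQ QP) => //; by rewrite E.
Qed.

Lemma point_hartogs x f : (forall y, closure [set y] x -> divisor_point y -> O y f) -> O x f.
Proof.
move=> h; apply: point_hartogs_prime => P /height_one_divisor[y [cyx dy _ <-]].
exact: h.
Qed.

Lemma point_normal x f n (c : nat -> K) :
  (forall i, (0 < i <= n)%N -> O x (c i)) -> f ^+ n + \sum_(1 <= i < n.+1) c i * f ^+ (n - i) = 0 ->
  (0 < n)%N -> O x f.
Proof.
apply: integrally_closed_local; [exact: sO|exact: (res_regular rO x)|exact: point_dim|exact: (O_fraction bB rO)].
Qed.

(** The height one prime of [O x] that y defines is principal; its generator is a local equation of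
    the divisor at x and also a uniformizer of [O y]. *)
Lemma divisor_uniformizer x y : closure [set y] x -> divisor_point y -> exists p,
  [/\ O x p, p != 0, nonunits (O y) = ideal_gen (O y) [set p]
    & forall f, nonunits (O y) f -> O x f -> exists2 r, O x r & f = r * p].
Proof.
move=> cyx dy; have hP := divisor_height_one cyx dy.
have [p [mp Op] pE] := height_one_principal (sO x) (res_regular rO x) (@point_dim x) hP.
have [pP [g [mg Og] g0] _] := hP.
exists p; split=> //; last by move=> f mf Of; apply: pE.
  apply/eqP => p0; have [r _ gE] := pE _ (conj mg Og).
  by move: g0; rewrite gE p0 mulr0 eqxx.
apply/seteqP; split=> f; rewrite ideal_gen1P //.
  move=> mf; have Of : O y f by case: mf.
  move: Of; rewrite {1}(specialization_loc sO aO cyx) => -[a [s [Oa Os ns fE]]].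
  have OO := specialization_sub aO cyx.
  have nms : ~ nonunits (O y) s by move=> h; apply: ns.
  have [s0 Osi] := unit_inv (OO _ Os) nms.
  have [r Or aE] : exists2 r, O x r & a = r * p.
    apply: pE; split=> //; have -> : a = f * s by rewrite fE divfK.
    by apply: (idMr (local_O sO aO y)) => //; apply: OO.
  exists (r / s); first by apply: (srM (sO y)) => //; apply: OO.
  by rewrite fE aE mulrAC.
by move=> [r Or ->]; apply: (idM (local_O sO aO y)).
Qed.

Lemma divisor_distinct x y z : closure [set y] x -> divisor_point y ->
  closure [set z] x -> divisor_point z ->
  nonunits (O y) `&` O x `<=` nonunits (O z) `&` O x -> y = z.
Proof.
move=> cy dy cz dz h; apply: (specialization_unique rO cy cz); apply/seteqP; split=> //.
have [p1 p2 _] := divisor_height_one cy dy; have [_ _ hm] := divisor_height_one cz dz.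
exact: hm.
Qed.

Section ClosedPoints.
Variable b : K.
Hypotheses (mb : nonunits B b) (b0 : b != 0).

Lemma exceptional_dim2 x : exceptional B O x -> ~ divisor_point x -> krull_dim (O x) 2.
Proof.
move=> ex ndx; have [s [ls ds ms]] := point_dims x.
case: s ls ds ms => [|p [|q [|]]] //= _ ds ms.
by have := ex _ mb; rewrite ms => /ideal_gen_nil /eqP; rewrite (negPf b0).
Qed.

(** If m_y were not inside the contraction of [C 2], it would prolong the contracted chain to one of
    length 3 in [O y]. *)
Lemma dim2_closed x y : krull_dim (O x) 2 -> closure [set x] y -> y = x.
Proof.
move=> [[C [pC ltC]] _] cxy; have pQ := specialization_prime sO aO cxy.
have OxE := specialization_loc sO aO cxy.
have [c0 c1 c2] : [/\ prime_ideal (O x) (C 0%N), prime_ideal (O x) (C 1%N) & prime_ideal (O x) (C 2%N)].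
  by split; apply: pC.
have C1n : exists2 f, C 1%N f & f != 0.
  by apply: (@strict_nonzero _ (O x) (C 0%N)); [case: c0|exact: ltC].
have lt12 := ltC 1%N isT.
move: (c1) (c2); rewrite {1 2}OxE => d1 d2.
have [e1 _] := loc_prime_contract (sO y) pQ d1.
have [e2 e2P] := loc_prime_contract (sO y) pQ d2.
have pr := loc_contract_proper (sO y) pQ d1 d2 lt12.
have [my|nmy] := pselect (nonunits (O y) `<=` C 2%N `&` O y); last first.
  exfalso; apply: (@point_dim y); exists (C 1%N `&` O y), (C 2%N `&` O y), (nonunits (O y)).
  split; first by split=> //; exact: prime_nonunits.
  split=> //; first exact: (loc_contract_nonzero (sO y) pQ d1 C1n).
  by split=> //; apply: (prime_sub_nonunits (sO y) e2).
have cyy : closure [set y] y by apply: subset_closure.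
apply: (specialization_unique rO cyy cxy); apply/seteqP; split=> f [mf Of]; split=> //.
  by have [] := e2P _ (my _ mf).
apply: contrapT => nmf; have [f0 Ofi] := unit_inv Of nmf.
by apply: (nonunits_inv mf f0); apply: (specialization_sub aO cxy).
Qed.

Lemma exceptional_closed x y : exceptional B O x -> ~ divisor_point x ->
  closure [set x] y -> y = x.
Proof. by move=> ex ndx; apply: dim2_closed; apply: exceptional_dim2. Qed.

Lemma exceptional_rational x : exceptional B O x -> ~ divisor_point x -> rational_point iota O x.
Proof.
move=> ex ndx; have [y [cxy _ ry]] := exists_rational_specialization bB rO x.
by rewrite -(exceptional_closed ex ndx cxy).
Qed.

End ClosedPoints.
End Points.

(** * The sheaf of a cycle *)

Section NormalValuations.
Variables (K : fieldType) (B : set K) (k : closedFieldType) (iota : {rmorphism k -> K}).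
Hypothesis bB : base_ring B iota.
Let sB := base_subring bB.

Lemma common_denominator P (c : nat -> K) n : prime_ideal B P -> (forall i, loc B P (c i)) ->
  exists s, [/\ B s, ~ P s & forall i, (i < n)%N -> B (s * c i)].
Proof.
move=> pP hc; elim: n => [|n [s [Bs ns h]]].
  by exists 1; split=> //; [exact: sr1|case: pP].
have [a [t [Ba Bt nt cE]]] := hc n; exists (s * t); split; [exact: srM|exact: (notinM pP)|].
move=> i; rewrite ltnS leq_eqVlt => /orP[/eqP->|lt].
  have -> : s * t * c n = s * a by rewrite cE; field; exact: (notin_neq0 pP nt).
  exact: srM.
by rewrite mulrAC; apply: srM => //; apply: h.
Qed.

(** f is not integral over the normal ring B_P, so 1/f is a nonunit of B_P[1/f], and Chevalley's
    theorem makes it a nonunit of a valuation ring. *)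
Lemma nonintegral_valuation P f : prime_ideal B P -> ~ loc B P f ->
  exists V, [/\ valuation_ring V, loc B P `<=` V & ~ V f].
Proof.
move=> pP nf; have sL := loc_subring sB pP.
have f0 : f != 0 by apply/eqP => f0; apply: nf; rewrite f0; apply: sr0.
have sA := adjoin_subring f^-1 sL.
have [||V [vV AV fV]] := @chevalley _ (adjoin (loc B P) f^-1) [set f^-1] sA.
- by move=> _ ->; apply: adjoin_gen.
- rewrite ideal_gen1P // => -[_ [p hp ->] E]; apply: nf.
  pose n := size p.
  have [s [Bs ns hs]] := common_denominator n pP hp.
  have s0 := notin_neq0 pP ns.
  (* Coefficients of a monic equation for s f: the relation 1 = p(1/f) / f is multiplied by (s
     f)^(n+1), where s is a common denominator of the coefficients of p. *)
  pose c j := s ^+ (n - j) * (s * p`_(n - j)).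
  pose q : {poly K} := 'X^(n.+1) - \poly_(j < n.+1) c j.
  have Bc j : B (c j).
    rewrite /c; apply: (srM sB); first exact: (srX sB).
    have [lt|ge] := ltnP (n - j) n; first exact: hs.
    by rewrite [p`__]nth_default // mulr0; apply: sr0.
  have hq : coefs_in B q.
    move=> i; rewrite coefB coefXn coef_poly; apply: (srB sB).
      by case: eqP => _; [exact: sr1|exact: sr0].
    by case: ifP => _ //; exact: sr0.
  have mq : q \is monic.
    by rewrite monicE lead_coefDl ?lead_coefXn // size_polyXn size_polyN ltnS size_poly.
  exists (s * f), s; split=> //; last by field.
  apply: (base_normal bB hq mq); rewrite /root hornerD hornerN hornerXn horner_poly.
  rewrite subr_eq0; apply/eqP.
  have -> : (s * f) ^+ n.+1 = (s * f) ^+ n.+1 * (p.[f^-1] * f^-1) by rewrite -E mulr1.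
  rewrite (@horner_coef_wide _ n.+1 p) ?leqnSn // mulr_suml mulr_sumr.
  rewrite (reindex_inj rev_ord_inj) /=; apply: eq_bigr => i _; rewrite subSS.
  have lin : (i <= n)%N by rewrite -ltnS.
  move: (nat_of_ord i) lin => j lin.
  have nE : n.+1 = ((n - j).+1 + j)%N by rewrite addSn subnK.
  rewrite /c nE; move: (n - j)%N => m; rewrite exprVn exprD !exprMn !exprS; field.
  by rewrite f0 expf_neq0.
exists V; split=> //; first by apply: subset_trans AV; apply: adjoin_sub.
move=> Vf; apply: (nonunits_inv (fV _ erefl)); first by rewrite invr_eq0.
by rewrite invrK.
Qed.

Variables (X : topologicalType) (O : X -> set K).
Hypothesis rO : resolved_by B O.
Let sO := res_subring rO.
Let aO := affineO rO.
Implicit Types (x y z : X) (f : K).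

(** H^0(O_X) = A: a function outside the normal ring [B] is missed by some valuation ring over [B],
    so it cannot be regular at the center of that ring. *)
Lemma global_sections_base f : (forall x, O x f) -> B f.
Proof.
move=> Of; apply: contrapT => nBf; have lB := base_local bB.
have pm := nonunits_prime sB lB.
have [|V [vV BV nVf]] := @nonintegral_valuation (nonunits B) f pm.
  move=> [a [s [Ba Bs ns fE]]]; apply: nBf; rewrite fE.
  by have [_ Bi] := unit_inv Bs ns; apply: srM.
have [y [OV _]] : exists y, O y `<=` V /\ nonunits (O y) `<=` nonunits V.
  by apply: (res_center rO vV); apply: subset_trans BV; apply: loc_sub.
exact/nVf/OV.
Qed.

Definition order_at y (n : int) f := exists pi u,
  [/\ nonunits (O y) = ideal_gen (O y) [set pi], O y u & f = pi ^ n * u].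

Lemma order_atE y p n f : nonunits (O y) = ideal_gen (O y) [set p] -> p != 0 ->
  0 <= n -> order_at y n f <-> O y (f / p ^+ `|n|%N).
Proof.
move=> mp p0 n0; have sy := sO y.
have pn0 : p ^+ `|n|%N != 0 by rewrite expf_neq0.
rewrite -{1}(gez0_abs n0); split=> [[pi [u [mpi Ou ->]]]|Of]; last first.
  by exists p, (f / p ^+ `|n|%N); split=> //; rewrite -exprnP mulrC divfK.
have [r Or piE] : exists2 r, O y r & pi = r * p.
  by apply/ideal_gen1P => //; rewrite -mp mpi; apply: ideal_gen_sub.
rewrite -exprnP piE exprMn; have -> : r ^+ `|n|%N * p ^+ `|n|%N * u / p ^+ `|n|%N = r ^+ `|n|%N * u.
  by field.
by apply: srM => //; apply: srX.
Qed.

Section Cycle.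
Variable Z : X -> int.
Hypotheses (Z0 : forall y, 0 <= Z y) (Zfin : finite_set [set y | Z y != 0]).

(* The stalk of O(-Z) at x *)
Definition cycle_at x f := forall y, closure [set y] x -> divisor_point O y -> order_at y (Z y) f.

(** X is regular, so O(-Z) is invertible. The generator is the product of the local equations of the
    divisors of Z through x; each of them is a unit at the other divisors, and [point_hartogs]
    recovers regularity at x from regularity at divisors. *)
Lemma cycle_generator x : exists g, [/\ g != 0, O x g & forall f, cycle_at x f <-> O x (f / g)].
Proof.
have : forall y, exists p, closure [set y] x -> divisor_point O y ->
   [/\ O x p, p != 0, nonunits (O y) = ideal_gen (O y) [set p]
    & forall f, nonunits (O y) f -> O x f -> exists2 r, O x r & f = r * p].
  move=> y; have [cyx|ncyx] := pselect (closure [set y] x); last by exists 0.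
  have [dy|ndy] := pselect (divisor_point O y); last by exists 0.
  by have [p hp] := divisor_uniformizer bB rO cyx dy; exists p.
move=> /choice[p hp].
have /finite_seqP[s sE] := Zfin.
pose D y := `[< closure [set y] x /\ divisor_point O y >].
pose s' := [seq y <- undup s | D y].
have us' : uniq s' by rewrite filter_uniq ?undup_uniq.
have Ds' y : y \in s' -> D y by rewrite mem_filter => /andP[].
pose g := \prod_(y <- s') p y ^+ `|Z y|%N.
have DP y : D y -> [/\ O x (p y), p y != 0, nonunits (O y) = ideal_gen (O y) [set p y]
    & forall f, nonunits (O y) f -> O x f -> exists2 r, O x r & f = r * p y].
  by move=> /asboolP[cyx dy]; apply: hp.
have g0 : g != 0 by rewrite prodf_seq_neq0; apply/allP => y /Ds'/DP[_ h _ _]; rewrite expf_neq0.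
have Og : O x g by rewrite /g big_seq; apply: (sr_prod (sO x)) => y /Ds'/DP[Op _ _ _]; apply: srX.
have unit_at y z : D y -> D z -> y != z -> p z != 0 /\ O y (p z)^-1.
  move=> Dy Dz /eqP yz; have [Oz z0 mz pz] := DP _ Dz; have [/asboolP[cy dy] /asboolP[cz dz]] := (Dy, Dz).
  apply: unit_inv; first exact: (specialization_sub aO cy).
  move=> mpz; apply: yz; apply/esym; apply: (divisor_distinct rO cz dz cy dy).
  move=> f [mf Of]; have [r Or ->] := pz _ mf Of; split; last by apply: (srM (sO x)).
  by apply: (idM (local_O sO aO y)) => //; apply: (specialization_sub aO cy).
have split_at y : D y -> exists u, [/\ u != 0, O y u, O y u^-1 & g = p y ^+ `|Z y|%N * u].
  move=> Dy; pose u := \prod_(z <- s' | z != y) p z ^+ `|Z z|%N.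
  have hz z : (z \in s') && (z != y) -> O y (p z ^+ `|Z z|%N) /\ O y (p z ^+ `|Z z|%N)^-1.
    move=> /andP[/Ds' Dz zy]; have [|z0 Oi] := unit_at y z Dy Dz; first by rewrite eq_sym.
    have [Oz _ _ _] := DP _ Dz; have /asboolP[cy dy] := Dy.
    by split; [apply: srX => //; apply: (specialization_sub aO cy)|rewrite -exprVn; apply: srX].
  exists u; split.
  - by rewrite prodf_seq_neq0; apply/allP => z /Ds'/DP[_ h _ _]; rewrite expf_neq0 ?implybT.
  - by rewrite /u big_seq_cond; apply: (sr_prod (sO y)) => z /hz[].
  - by rewrite /u -prodfV big_seq_cond; apply: (sr_prod (sO y)) => z /hz[].
  - have [ys|nys] := boolP (y \in s'); first by rewrite /g (bigD1_seq y).
    have Zy : Z y = 0.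
      apply/eqP; apply: contraNT nys => Zy; rewrite mem_filter mem_undup Dy /=.
      by have : [set y | Z y != 0] y by []; rewrite sE.
    rewrite Zy mul1r /g big_seq [RHS]big_seq_cond; apply: eq_bigl => z.
    case zs : (z \in s') => //=; apply/esym; apply: contraNneq nys => <-.
    by rewrite zs.
exists g; split=> // f; split=> [h|Of].
  apply: (point_hartogs bB rO) => y cyx dy; have Dy : D y by apply/asboolP.
  have [u [u0 Ou Oui gE]] := split_at _ Dy; have [_ py0 my _] := DP _ Dy.
  have /(order_atE _ my py0 (Z0 y)) := h _ cyx dy.
  have -> : f / g = (f / p y ^+ `|Z y|%N) * u^-1.
    by rewrite gE invfM mulrA.
  by move=> h'; apply: srM.
move=> y cyx dy; have Dy : D y by apply/asboolP.
have [u [u0 Ou Oui gE]] := split_at _ Dy; have [_ py0 my _] := DP _ Dy.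
apply/(order_atE _ my py0 (Z0 y)).
have -> : f / p y ^+ `|Z y|%N = (f / g) * u by rewrite gE; field; rewrite u0 expf_neq0.
by apply: (srM (sO y)) => //; apply: (specialization_sub aO cyx).
Qed.

Lemma cycle_at_sub x f : cycle_at x f -> O x f.
Proof.
have [g [g0 Og gE]] := cycle_generator x.
by move=> /gE h; rewrite -[f](divfK g0); apply: srM.
Qed.

Definition cycle_sheaf (U : set X) : set K :=
  [set f | forall x, U x -> divisor_point O x -> order_at x (Z x) f].

Lemma cycle_sheafE U f : open U -> cycle_sheaf U f <-> forall x, U x -> cycle_at x f.
Proof.
move=> oU; split=> [h x Ux y cyx dy|h x Ux dx].
  have [z [-> Uz]] := cyx U (open_nbhs_nbhs (conj oU Ux)); exact: h.
by apply: (h x Ux) => //; apply: subset_closure.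
Qed.

(** The neighbourhood avoids the poles of f and the divisors of Z that do not pass through x. *)
Lemma cycle_germ x f : cycle_at x f -> exists W, [/\ open W, W x & cycle_sheaf W f].
Proof.
move=> cf; have Of := cycle_at_sub cf.
have /finite_seqP[s sE] := Zfin.
have [W [oW Wx hW]] := avoiding_nbhd x s.
exists (W `&` [set y | O y f]); split=> //; first by apply: openI => //; exact: open_domain.
move=> y [Wy Oyf] dy; have [Zy|Zy] := eqVneq (Z y) 0.
  have [p [_ p0 mp _]] := divisor_uniformizer bB rO (@subset_closure _ [set y] y erefl) dy.
  by apply/(order_atE _ mp p0); rewrite Zy // divr1.
apply: cf => //; apply: hW => //.
have : [set y | Z y != 0] y by []; by rewrite sE.
Qed.

End Cycle.
End NormalValuations.

(** * General pairs of generators of a reduction *)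

(* By pencil_generic, a generates O(-Z) at the exceptional prime divisors. *)
Record pencil (K : fieldType) (B : set K) (X : topologicalType) (O : X -> set K)
    (Z : X -> int) (a b : K) : Prop := Pencil {
  pencil_neq0 : a != 0 /\ b != 0;
  pencil_nonunits : nonunits B a /\ nonunits B b;
  pencil_cover : forall x, O x (b / a) \/ O x (a / b);
  pencil_left : forall x f, O x (b / a) -> (cycle_at O Z x f <-> O x (f / a));
  pencil_right : forall x f, O x (a / b) -> (cycle_at O Z x f <-> O x (f / b));
  pencil_exceptional : forall x, O x (a / b) -> nonunits (O x) b -> exceptional B O x;
  pencil_generic : forall y, divisor_point O y -> exceptional B O y -> O y (b / a) }.

Section PencilExistence.
Variables (K : fieldType) (B : set K) (k : closedFieldType) (iota : {rmorphism k -> K}).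
Variables (X : topologicalType) (O : X -> set K).
Hypotheses (bB : base_ring B iota) (rO : resolved_by B O).
Let sO := res_subring rO.
Let aO := affineO rO.
Implicit Types (x y z : X) (f : K).

Variable Z : X -> int.
Hypotheses (Z0 : forall y, 0 <= Z y) (Zfin : finite_set [set y | Z y != 0]).

Let J := cycle_sheaf O Z setT.

(** If all global sections were in m_x g, then so would be g, which lies in the stalk that they
    generate. *)
Lemma globally_generated_unit x g :
  (forall f, (exists W, [/\ open W, W x & cycle_sheaf O Z W f]) ->
    submodule_span (O x) (J : set K^o) f) ->
  g != 0 -> (forall f, cycle_at O Z x f <-> O x (f / g)) ->
  exists2 j, J j & ~ nonunits (O x) (j / g).
Proof.
move=> gg g0 gE; apply: contrapT => h.
have Jx j : J j -> cycle_at O Z x j.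
  by move=> Jj; apply: ((cycle_sheafE O Z j (openT : open [set: X])).1 Jj).
have lx := local_O sO aO x.
have : nonunits (O x) (g / g).
  have /gg gs : exists W, [/\ open W, W x & cycle_sheaf O Z W g].
    have cg : cycle_at O Z x g by apply/gE; rewrite divff //; exact: sr1.
    exact: (cycle_germ bB rO Z0 Zfin cg).
  apply: (gs [set f | nonunits (O x) (f / g)]).
    split.
    - by rewrite /= mul0r; exact: id0 lx.
    - by move=> u v hu hv; rewrite /= mulrDl; apply: (idD lx).
    - by move=> s v Os hv; rewrite /= /GRing.scale /= -mulrA; apply: (idM lx).
  by move=> j Jj; apply: contrapT => nj; apply: h; exists j.
by rewrite divff //; apply: nonunits1; exact: sr1.
Qed.

(** The reduction generates the same stalk as I: were a / g and b / g both nonunits, the relation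
    I^(r+1) = Q I^r would put a power of the unit j / g in m_x. *)
Lemma reduction_unit x g a b r j c d :
  g != 0 -> O x (a / g) -> O x (b / g) -> O x (j / g) -> ~ nonunits (O x) (j / g) ->
  j ^+ r.+1 = a * c + b * d -> O x (c / g ^+ r) -> O x (d / g ^+ r) ->
  ~ (nonunits (O x) (a / g) /\ nonunits (O x) (b / g)).
Proof.
move=> g0 Oa Ob Oj nj E Oc Od [ma mb]; have lx := local_O sO aO x.
apply: nj; apply: (primeX (n := r.+1) (sO x) (prime_nonunits sO aO x)) => //.
have -> : (j / g) ^+ r.+1 = (c / g ^+ r) * (a / g) + (d / g ^+ r) * (b / g).
  by rewrite expr_div_n E exprS; field; rewrite g0 expf_neq0.
by apply: (idD lx); apply: (idM lx).
Qed.

(* a and b generate the stalk of O(-Z) at x. *)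
Definition generates a b x := exists g,
  [/\ g != 0, forall f, cycle_at O Z x f <-> O x (f / g), O x (a / g), O x (b / g)
    & ~ (nonunits (O x) (a / g) /\ nonunits (O x) (b / g))].

Lemma generates_change a b x l m : l != m -> generates a b x ->
  generates (a + iota l * b) (a + iota m * b) x.
Proof.
move=> lm [g [g0 gE Oa Ob nab]]; have lx := local_O sO aO x.
have Oc := O_const bB rO x.
have Ol t : O x ((a + iota t * b) / g).
  by rewrite mulrDl -mulrA; apply: (srD (sO x)) => //; apply: (srM (sO x)).
have lm0 : iota l - iota m != 0 by rewrite subr_eq0 fmorph_eq // .
exists g; split=> // -[ml mm]; apply: nab.
have mb : nonunits (O x) (b / g).
  have -> : b / g = iota (l - m)^-1 * ((a + iota l * b) / g - (a + iota m * b) / g).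
    by rewrite fmorphV rmorphB /=; field; rewrite lm0 g0.
  by apply: (idM lx) => //; apply: (idB lx (sO x)).
split=> //; have -> : a / g = (a + iota l * b) / g - iota l * (b / g) by ring.
by apply: (idB lx (sO x)) => //; apply: (idM lx).
Qed.

Lemma at_most_one_bad (P : k -> Prop) : (forall l m, P l -> P m -> l = m) ->
  exists c, forall l, l != c -> ~ P l.
Proof.
move=> h; have [[c Pc]|nP] := pselect (exists c, P c).
  by exists c => l /eqP lc Pl; apply/lc/h.
by exists 0 => l _ Pl; apply: nP; exists l.
Qed.

(** At each point at most one l makes a + l b fail to generate. Avoiding this value is required only
    at the finitely many divisors in the support of Z, and k is infinite; m merely has to give a
    second nonzero member, distinct from the first. *)
Lemma pencil_exists a b : [set: X] !=set0 -> nonunits B a -> nonunits B b ->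
  (forall x, generates a b x) ->
  (forall x, nonunits (O x) a -> nonunits (O x) b -> exceptional B O x) ->
  exists l m, l != m /\ pencil B O Z (a + iota l * b) (a + iota m * b).
Proof.
move=> [x0 _] ma mb gen exc; have lB := base_local bB.
have [c0 hc0] : exists c, forall l, l != c -> a + iota l * b != 0.
  have [|c hc] := @at_most_one_bad (fun l => a + iota l * b = 0); last first.
    by exists c => l lc; apply/eqP; apply: hc.
  move=> l m El Em; apply/eqP/negPn/negP => lm.
  have [g [_ _ _ _]] := generates_change lm (gen x0); rewrite El Em mul0r; apply.
  by split; apply: id0 (local_O sO aO x0).
have /choice[c hc] : forall y, exists c, forall l m, l != c -> l != m -> O y ((a + iota m * b) / (a + iota l * b)).
  move=> y; have [g [g0 gE Oa Ob nab]] := gen y.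
  have Ol t : O y ((a + iota t * b) / g).
    rewrite mulrDl -mulrA; apply: (srD (sO y)) => //; apply: (srM (sO y)) => //.
    exact: O_const bB rO y _.
  have [|c hc] := @at_most_one_bad (fun l => nonunits (O y) ((a + iota l * b) / g)).
    move=> l m ml mm; apply/eqP/negPn/negP => lm.
    have lx := local_O sO aO y; have Oc := O_const bB rO y.
    have lm0 : iota l - iota m != 0 by rewrite subr_eq0 fmorph_eq.
    have mb' : nonunits (O y) (b / g).
      have -> : b / g = iota (l - m)^-1 * ((a + iota l * b) / g - (a + iota m * b) / g).
        by rewrite fmorphV rmorphB /=; field; rewrite lm0 g0.
      by apply: (idM lx) => //; apply: (idB lx (sO y)).
    apply: nab; split=> //; have -> : a / g = (a + iota l * b) / g - iota l * (b / g) by ring.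
    by apply: (idB lx (sO y)) => //; apply: (idM lx).
  exists c => l m lc lm; have [u0 Oi] := unit_inv (Ol l) (hc _ lc).
  have -> : (a + iota m * b) / (a + iota l * b) = ((a + iota m * b) / g) * ((a + iota l * b) / g)^-1.
    rewrite invf_div; field; rewrite g0 andbT.
    by apply: contra_neq u0 => ->; rewrite mul0r.
  by apply: (srM (sO y)).
have /finite_seqP[s sE] := Zfin.
have [l] := exists_notin (c0 :: [seq c y | y <- s]); rewrite inE negb_or => /andP[lc0 ls].
have [m] := exists_notin [:: c0; l]; rewrite !inE negb_or => /andP[mc0 ml].
have lm : l != m by rewrite eq_sym.
exists l, m; split=> //; set a' := a + iota l * b; set b' := a + iota m * b.
have a0 : a' != 0 by apply: hc0.
have b0 : b' != 0 by apply: hc0.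
have mab t : nonunits B (a + iota t * b).
  by apply: (idD lB) => //; apply: (idM lB) => //; apply: base_const bB _.
have unitg x g : g != 0 -> O x (a' / g) -> ~ nonunits (O x) (a' / g) ->
    forall f, O x (f / g) <-> O x (f / a').
  move=> g0 Oa na f; have [u0 Oi] := unit_inv Oa na.
  split=> h.
    have -> : f / a' = (f / g) * (a' / g)^-1 by rewrite invf_div; field; rewrite ?a0 ?g0.
    exact: (srM (sO x)).
  have -> : f / g = (f / a') * (a' / g) by field; rewrite ?a0 ?g0.
  exact: (srM (sO x)).
have unitg' x g : g != 0 -> O x (b' / g) -> ~ nonunits (O x) (b' / g) ->
    forall f, O x (f / g) <-> O x (f / b').
  move=> g0 Oa na f; have [u0 Oi] := unit_inv Oa na.
  split=> h.
    have -> : f / b' = (f / g) * (b' / g)^-1 by rewrite invf_div; field; rewrite ?b0 ?g0.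
    exact: (srM (sO x)).
  have -> : f / g = (f / b') * (b' / g) by field; rewrite ?b0 ?g0.
  exact: (srM (sO x)).
have gen' x : generates a' b' x by apply: generates_change.
split=> //; first by split; apply: mab.
- move=> x; have [g [g0 gE Oa Ob nab]] := gen' x.
  have [na|ma'] := pselect (~ nonunits (O x) (a' / g)).
    by left; apply/(unitg x g g0 Oa na).
  right; apply/(unitg' x g g0 Ob) => // mb'; apply: nab; split=> //; exact: contrapT.
- move=> x f Oba; have [g [g0 gE Oa Ob nab]] := gen' x.
  apply: (iff_trans (gE f)); apply: unitg => // ma'; apply: nab; split=> //.
  have -> : b' / g = (b' / a') * (a' / g) by field; rewrite ?a0 ?g0.
  exact: (idM (local_O sO aO x)).
- move=> x f Oba; have [g [g0 gE Oa Ob nab]] := gen' x.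
  apply: (iff_trans (gE f)); apply: unitg' => // ma'; apply: nab; split=> //.
  have -> : a' / g = (a' / b') * (b' / g) by field; rewrite ?b0 ?g0.
  exact: (idM (local_O sO aO x)).
- move=> x Oab mb'; have lx := local_O sO aO x; have Oc := O_const bB rO x.
  have ma' : nonunits (O x) a'.
    have -> : a' = (a' / b') * b' by rewrite divfK.
    exact: (idM lx).
  have lm0 : iota l - iota m != 0 by rewrite subr_eq0 fmorph_eq.
  have mb'' : nonunits (O x) b.
    have -> : b = iota (l - m)^-1 * (a' - b').
      by rewrite fmorphV rmorphB /= /a' /b'; field.
    by apply: (idM lx) => //; apply: (idB lx (sO x)).
  apply: exc => //; have -> : a = a' - iota l * b by rewrite /a'; ring.
  by apply: (idB lx (sO x)) => //; apply: (idM lx).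
(* Exceptional divisors lie in the support of Z: where Z is zero the stalk contains 1, which
   sections from m_A cannot generate at an exceptional point. *)
- move=> y dy ey; have [Zy|Zy] := eqVneq (Z y) 0; last first.
    apply: hc => //; apply: contraNneq ls => ->; apply/mapP; exists y => //.
    have : [set y | Z y != 0] y by []; by rewrite sE.
  exfalso; have [g [g0 gE Oa Ob nab]] := gen' y; have lx := local_O sO aO y.
  have cyy := @subset_closure _ [set y] y erefl.
  have Og : O y (1 / g).
    apply/gE => z czy dz.
    have -> : z = y.
      apply: (divisor_distinct rO czy dz cyy dy) => f [mf Of]; split=> //.
      exact: (prime_sub_nonunits (sO y) (specialization_prime sO aO czy)).
    have [p [_ p0 mp _]] := divisor_uniformizer bB rO cyy dy.
    by apply/(order_atE rO _ mp p0); rewrite Zy // divr1; exact: sr1.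
  apply: nab; split.
    have -> : a' / g = (1 / g) * a' by rewrite div1r mulrC.
    by apply: (idM lx) => //; apply/ey/mab.
  have -> : b' / g = (1 / g) * b' by rewrite div1r mulrC.
  by apply: (idM lx) => //; apply/ey/mab.
Qed.

End PencilExistence.

(** * The curve on which a / b vanishes *)

Section MinimalPrimes.
Variable K : fieldType.
Implicit Types (S I P : set K).

(** If x y lies in a maximal counterexample J but x and y do not, the primes over J are those over J
    + (x) together with those over J + (y). *)
Lemma finite_minimal_primes S I : subring S -> noetherian S -> ideal S I ->
  exists L : seq (set K), (forall P, List.In P L -> prime_ideal S P /\ I `<=` P) /\
    forall P, prime_ideal S P -> I `<=` P -> exists2 Q, List.In Q L & Q `<=` P.
Proof.
move=> sS nS iI; apply: contrapT => nL.
have [||J [[iJ nJ] Jmax]] := @noetherian_max _ S [set J | ideal S J /\ ~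
   exists L : seq (set K), (forall P, List.In P L -> prime_ideal S P /\ J `<=` P) /\
    forall P, prime_ideal S P -> J `<=` P -> exists2 Q, List.In Q L & Q `<=` P] sS nS.
- by move=> J [].
- by exists I.
have [J1|J1] := pselect (J 1).
  by apply: nJ; exists [::]; split=> // P [_ P1 _] JP; case: P1; apply: JP.
have [pJ|npJ] := pselect (prime_ideal S J).
  apply: nJ; exists [:: J]; split; first by move=> P [<-|[]]; split.
  by move=> P pP JP; exists J => //; left.
have [x [y [Sx Sy Jxy nJx nJy]]] : exists x y, [/\ S x, S y, J (x * y), ~ J x & ~ J y].
  apply: contrapT => h; apply: npJ; split=> // x y Sx Sy Jxy.
  by apply: contrapT => /not_orP[nx ny]; apply: h; exists x, y.
pose J' z : set K := [set w | exists p q, [/\ J p, [set y | exists2 r, S r & y = r * z] q & w = p + q]].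
have ext z : S z -> ~ J z -> exists L : seq (set K), (forall P, List.In P L -> prime_ideal S P /\ J' z `<=` P) /\
    forall P, prime_ideal S P -> J' z `<=` P -> exists2 Q, List.In Q L & Q `<=` P.
  move=> Sz nJz; apply: contrapT => nL'; apply: nJz.
  have J'z : J' z z.
    exists 0, z; split; [exact: id0 iJ| |by rewrite add0r].
    by exists 1; rewrite ?mul1r //; exact: sr1.
  have iJ' : ideal S (J' z) by apply: ideal_sum => //; exact: ideal_principal.
  rewrite -(Jmax (J' z)) //.
  move=> w Jw; exists w, 0; split=> //; last by rewrite addr0.
  by exists 0; rewrite ?mul0r //; exact: sr0.
have JJ' z : J `<=` J' z.
  move=> w Jw; exists w, 0; split=> //; last by rewrite addr0.
  by exists 0; rewrite ?mul0r //; exact: sr0.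
have [L1 [h1 h1']] := ext x Sx nJx; have [L2 [h2 h2']] := ext y Sy nJy.
apply: nJ; exists (L1 ++ L2); split.
  move=> P hP; case: (List.in_app_or _ _ _ hP) => [/h1|/h2] [pP JP]; split=> //; exact: subset_trans JP.
move=> P pP JP; have [iP P1 PM] := pP.
have sub z : P z -> J' z `<=` P.
  by move=> Pz _ [p [_ [Jp [r Sr ->] ->]]]; apply: (idD iP); [exact: JP|exact: (idM iP)].
case: (PM x y Sx Sy (JP _ Jxy)) => [Px|Py].
  have [Q QL QP] := h1' _ pP (sub _ Px).
  by exists Q => //; apply: List.in_or_app; left.
have [Q QL QP] := h2' _ pP (sub _ Py).
by exists Q => //; apply: List.in_or_app; right.
Qed.

End MinimalPrimes.

(** * Closed points and generic points of the curve *)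

Section PolarLocus.
Variables (K : fieldType) (B : set K) (k : closedFieldType) (iota : {rmorphism k -> K}).
Variables (X : topologicalType) (O : X -> set K).
Hypotheses (bB : base_ring B iota) (rO : resolved_by B O).
Let sB := base_subring bB.
Let lB := base_local bB.
Let sO := res_subring rO.
Let BO := res_base rO.
Let aO := affineO rO.
Let lO := local_O sO aO.
Implicit Types (x y z : X) (f : K).
Variables (Z : X -> int) (a b : K).
Hypothesis pab : pencil B O Z a b.

Let a0 : a != 0. Proof. by case: (pencil_neq0 pab). Qed.
Let b0 : b != 0. Proof. by case: (pencil_neq0 pab). Qed.
Let ma : nonunits B a. Proof. by case: (pencil_nonunits pab). Qed.
Let mb : nonunits B b. Proof. by case: (pencil_nonunits pab). Qed.
Let Bb : B b. Proof. by case: mb. Qed.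

Let u := a / b.

Lemma ratio_neq0 : u != 0. Proof. by rewrite mulf_neq0 // invr_eq0. Qed.

Lemma polar_regular x : ~ O x (b / a) -> O x u.
Proof. by move=> nx; case: (pencil_cover pab x). Qed.

Lemma polar_nonunit x : ~ O x (b / a) -> nonunits (O x) u.
Proof.
move=> nx; apply: contrapT => nu; have [_] := unit_inv (polar_regular nx) nu.
by rewrite invf_div.
Qed.

Lemma nonunit_polar x : nonunits (O x) u -> ~ O x (b / a).
Proof. by move=> [_ h] Oba; apply: h; exists (b / a) => //; rewrite mulrA divfK // divff. Qed.

Lemma polar_specialization x y : ~ O x (b / a) -> closure [set x] y -> ~ O y (b / a).
Proof. by move=> nx cxy Oy; apply: nx; apply: (specialization_sub aO cxy). Qed.

Lemma polar_nondivisor x : ~ O x (b / a) -> exceptional B O x -> ~ divisor_point O x.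
Proof. by move=> nx ex dx; apply: nx; apply: (pencil_generic pab). Qed.

Lemma polar_closed x y : ~ O x (b / a) -> exceptional B O x -> closure [set x] y -> y = x.
Proof. by move=> nx ex; apply: (exceptional_closed bB rO mb b0 ex); apply: polar_nondivisor. Qed.

Lemma polar_rational x : ~ O x (b / a) -> exceptional B O x -> rational_point iota O x.
Proof. by move=> nx ex; apply: (exceptional_rational bB rO mb b0 ex); apply: polar_nondivisor. Qed.

Lemma polar_unit x : ~ O x (b / a) -> ~ exceptional B O x -> O x b^-1.
Proof.
move=> nx nex; have [|//] := @unit_inv _ (O x) b (@BO x b Bb).
by move=> mbx; apply: nex; apply: (pencil_exceptional pab (polar_regular nx)).
Qed.

Lemma polar_isolated x y : ~ O x (b / a) -> exceptional B O x -> closure [set y] x ->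
  nonunits (O y) u -> nonunits (O y) b -> y = x.
Proof.
move=> nx ex cyx mu mby; have ny := nonunit_polar mu.
apply/esym/(polar_closed ny) => //.
by apply: (pencil_exceptional pab (polar_regular ny)).
Qed.

(** The ideal (u, b^N) of [O x]; the exponent N is the precision of an approximation at x along the
    curve u = 0. *)
Definition mod_ub x N : set K := [set f | exists c d, [/\ O x c, O x d & f = c * u + d * b ^+ N]].

Lemma mod_ub_ideal x N : ~ O x (b / a) -> ideal (O x) (mod_ub x N).
Proof.
move=> nx; have Ou := polar_regular nx; have ON : O x (b ^+ N) by apply: srX => //; exact: BO.
apply: idealI.
- by move=> _ [c [d [Oc Od ->]]]; apply: (srD (sO x)); apply: (srM (sO x)).
- by exists 0, 0; rewrite !mul0r addr0; split=> //; exact: sr0.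
- move=> _ _ [c [d [Oc Od ->]]] [c' [d' [Oc' Od' ->]]]; exists (c + c'), (d + d').
  by split; [exact: (srD (sO x))|exact: (srD (sO x))|ring].
- move=> s _ Os [c [d [Oc Od ->]]]; exists (s * c), (s * d).
  by split; [exact: (srM (sO x))|exact: (srM (sO x))|ring].
Qed.

(** A prime over (u, b^N) belongs to a generization of x on the curve at which b vanishes; such a
    point is exceptional, hence closed, hence x itself. So (u, b^N) contains a power of each nonunit
    when N is positive, and trivially when N is 0. *)
Lemma polar_radical x N f : ~ O x (b / a) -> exceptional B O x -> nonunits (O x) f ->
  exists n, mod_ub x N (f ^+ n).
Proof.
move=> nx ex mf; have iJ := mod_ub_ideal N nx.
apply: (radical_prime (sO x) iJ); first by case: mf.
move=> P pP JP; have [y [cyx my _]] := prime_point sO aO pP.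
have Ou := polar_regular nx; have Ob := @BO x b Bb.
have Pu : P u by apply: JP; exists 1, 0; split; [exact: sr1|exact: sr0|ring].
have Pb : P b.
  apply: (primeX (n := N) (sO x) pP Ob); apply: JP; exists 0, 1.
  by split; [exact: sr0|exact: sr1|ring].
have yx : y = x by apply: (polar_isolated nx ex cyx); apply/my.
by apply/my; [case: mf|rewrite yx].
Qed.

(** Modulo an ideal containing m_B and the generators, every element of the algebra is a constant.
    Taken with functions vanishing at two places at once, it shows that the values at both places
    agree. *)
Lemma adjoins_constant (s : seq K) T I f : subring T -> ideal T I -> B `<=` T ->
  nonunits B `<=` I -> {in s, forall t, I t} -> adjoins B s f -> exists c, I (f - iota c).
Proof.
move=> sT iI BT mI sI hf.
have Tc c : T (iota c) by apply/BT/(base_const bB).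
suff : [set f | T f /\ exists c, I (f - iota c)] f by case.
move: f hf; apply: adjoins_min.
- split.
  + by split; [exact: sr1|exists 1; rewrite rmorph1 subrr; exact: id0 iI].
  + move=> f g [Tf [c hc]] [Tg [c' hc']]; split; first exact: srB.
    exists (c - c'); have -> : f - g - iota (c - c') = (f - iota c) - (g - iota c').
      by rewrite rmorphB /=; ring.
    exact: (idB iI).
  + move=> f g [Tf [c hc]] [Tg [c' hc']]; split; first exact: srM.
    exists (c * c'); have -> : f * g - iota (c * c') = g * (f - iota c) + iota c * (g - iota c').
      by rewrite rmorphM /=; ring.
    by apply: (idD iI); apply: (idM iI).
- move=> f Bf; split; first exact: BT.
  by have [c hc] := base_residue bB Bf; exists c; apply: mI.
- move=> t ts; split; first by apply: (idS iI); apply: sI.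
  by exists 0; rewrite rmorph0 subr0; apply: sI.
Qed.

(** Generators t of a chart vanish at x and satisfy t^n = c u + d b with c, d regular at x. Where c
    and d remain regular, t vanishes at every exceptional point w of the curve; the functions of the
    chart then have equal values at x and w, so w is a specialization of the closed point x. *)
Lemma polar_exceptional_isolated x : ~ O x (b / a) -> exceptional B O x -> exists W,
  [/\ open W, W x & forall w, W w -> ~ O w (b / a) -> exceptional B O w -> w = x].
Proof.
move=> nx ex; have rx := polar_rational nx ex.
have [U [s [aU Ux UE ms]]] := rational_chart bB rO ex rx.
have [W [oW Wx hW]] : exists W, [/\ open W, W x & forall w, W w -> ~ O w (b / a) ->
    exceptional B O w -> {in s, forall t, O w t -> nonunits (O w) t}].
  elim: s {UE} ms => [|t s IH] ms; first by exists setT; split=> //; exact: openT.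
  have [|W [oW Wx hW]] := IH; first by move=> t' t's; apply: ms; rewrite inE t's orbT.
  have [n [c [d [Oc Od E]]]] : exists n, mod_ub x 1 (t ^+ n).
    by apply: polar_radical => //; apply: ms; rewrite inE eqxx.
  exists (W `&` ([set w | O w c] `&` [set w | O w d])); split=> //.
    by do 2!apply: openI => //; apply: open_domain.
  move=> w [Ww [Owc Owd]] nw ew t'; rewrite inE => /orP[/eqP->|]; last exact: hW.
  move=> Ot; apply: (primeX (n := n) (sO w) (prime_nonunits sO aO w)) => //.
  rewrite E expr1; apply: (idD (lO w)); apply: (idM (lO w)) => //; first exact: polar_nonunit.
  exact: ew.
exists (W `&` U); split=> //; first by apply: openI => //; exact: affine_is_open aU.
move=> w [Ww Uw] nw ew; apply: (polar_closed nx ex); apply/(affine_specialization aU x Uw); split=> //.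
have Gw : structure_sheaf O U `<=` O w by move=> f; apply.
have Gx : structure_sheaf O U `<=` O x by move=> f; apply.
have sG := structure_sheaf_subring sO U.
have BG : B `<=` structure_sheaf O U by rewrite UE; apply: adjoins_sub.
move=> f [Gf mf]; split=> //.
pose I := nonunits (O x) `&` (nonunits (O w) `&` structure_sheaf O U).
have iI : ideal (structure_sheaf O U) I.
  apply: idealI.
  - by move=> g [_ []].
  - by split; [exact: id0 (lO x)|split; [exact: id0 (lO w)|exact: (sr0 sG)]].
  - move=> g h [g1 [g2 g3]] [h1 [h2 h3]].
    by split; [exact: (idD (lO x))|split; [exact: (idD (lO w))|exact: (srD sG)]].
  - move=> g h Gg [h1 [h2 h3]].
    by split; [exact: (idM (lO x) (Gx _ Gg))|split; [exact: (idM (lO w) (Gw _ Gg))|exact: (srM sG)]].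
have [|||c [h1 [h2 _]]] := adjoins_constant sG iI BG (s := s) (f := f).
- by move=> g mg; split; [exact: ex|split; [exact: ew|apply: BG; case: mg]].
- move=> t ts; have Gt : structure_sheaf O U t by rewrite UE; apply: adjoins_gen.
  split; first exact: ms.
  by split=> //; apply: hW => //; apply: Gw.
- by rewrite -UE.
have c0 : c = 0.
  apply/eqP/negPn/negP => c0; have := idB (lO x) (sO x) mf h1; rewrite subKr => mc.
  by apply: (nonunits_inv mc (iota_neq0 iota c0)); rewrite -fmorphV; exact: O_const bB rO x _.
by move: h2; rewrite c0 rmorph0 subr0.
Qed.

Lemma polar_exceptional_finite : exists s : seq X,
  forall x, (~ O x (b / a) /\ exceptional B O x) <-> x \in s.
Proof.
pose E : set X := [set x | ~ O x (b / a) /\ exceptional B O x].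
suff /finite_seqP[s sE] : finite_set E.
  by exists s => x; change (E x <-> x \in s); rewrite sE.
have nbhd p : exists W, [/\ open W, W p & W `&` E `<=` [set p]].
  have [Op|np] := pselect (O p (b / a)).
    exists [set w | O w (b / a)]; split=> //; first exact: open_domain.
    by move=> w [Ow [nw _]].
  have [ep|nep] := pselect (exceptional B O p).
    have [W [oW Wp hW]] := polar_exceptional_isolated np ep.
    by exists W; split=> // w [Ww [nw ew]]; apply: hW.
  have /existsNP[al /not_implyP[mal nal]] := nep.
  have Bal : B al by case: mal.
  have [al0 Oi] := unit_inv (@BO p al Bal) nal.
  exists [set w | O w al^-1]; split=> //; first exact: open_domain.
  by move=> w [Ow [_ ew]]; have := nonunits_inv (ew _ mal) al0.
apply: contrapT => infE.
(* The sets that contain all but finitely many points of [E]. By quasi-compactness this filter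
   clusters at some p, although p has a neighbourhood with at most one point of [E]. *)
pose F : set (set X) := [set A | finite_set (E `\` A)].
have FF : ProperFilter F.
  apply: Build_ProperFilter.
    by rewrite /F /= setD0.
  split; rewrite /F /=.
  - by rewrite setDT; exact: finite_set0.
  - move=> A A' fA fA'; change (finite_set (E `\` (A `&` A'))).
    by rewrite setDIr finite_setU.
  - by move=> A A' AA' fA; apply: sub_finite_set fA => x [Ex nx]; split=> // /AA'.
have [p [_ cp]] := res_compact rO FF filterT.
have [W [oW Wp WE]] := nbhd p.
have FA : F (E `\ p).
  rewrite /F /=; apply: (@sub_finite_set _ _ [set p]); last exact: finite_set1.
  by move=> x [Ex nx]; apply: contrapT => xp; apply: nx; split.
have [x [[Ex xp] Wx]] := cp _ _ FA (open_nbhs_nbhs (conj oW Wp)).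
by apply: xp; apply: WE.
Qed.

Definition nonexceptional_polar (d : X) := ~ O d (b / a) /\ ~ exceptional B O d.

Lemma polar_specializes d : nonexceptional_polar d -> exists x,
  [/\ ~ O x (b / a), exceptional B O x, closure [set d] x & x != d].
Proof.
move=> [nd ned]; have [x [cdx ex _]] := exists_rational_specialization bB rO d.
exists x; split=> //; first exact: polar_specialization cdx.
by apply/eqP => xd; apply: ned; rewrite -xd.
Qed.

Lemma polar_divisor d : nonexceptional_polar d -> divisor_point O d.
Proof.
move=> hd; have [x [nx ex cdx /eqP xd]] := polar_specializes hd.
have [s [ls ds ms]] := point_dims bB rO d.
case: s ls ds ms => [|p [|q [|]]] //= _ ds ms.
  have := polar_nonunit hd.1; rewrite ms => /ideal_gen_nil /eqP; by rewrite (negPf ratio_neq0).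
by exfalso; apply: xd; apply: (dim2_closed bB rO ds cdx).
Qed.

(** Each such point specializes to one of the finitely many closed points x, and there it is given
    by a minimal prime over (u) in the noetherian ring [O x]. *)
Lemma nonexceptional_polar_finite : exists s : seq X, forall d, nonexceptional_polar d -> d \in s.
Proof.
have [s hs] := polar_exceptional_finite.
suff h x : x \in s -> exists l : seq X, forall d, nonexceptional_polar d -> closure [set d] x -> d \in l.
  have {h} [l hl] : exists l : seq X, forall x d, x \in s -> nonexceptional_polar d -> closure [set d] x -> d \in l.
    elim: s h {hs} => [|x s IH] h; first by exists [::].
    have [|l hl] := IH; first by move=> y ys; apply: h; rewrite inE ys orbT.
    have [|l' hl'] := h x; first by rewrite inE eqxx.
    exists (l ++ l') => y d; rewrite inE mem_cat => /orP[/eqP->|ys] hd cd.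
      by rewrite hl' ?orbT.
    by rewrite (hl y).
  exists l => d hd; have [x [nx ex cdx _]] := polar_specializes hd.
  by apply: (hl x) => //; apply/hs.
move=> /hs[nx ex]; have Ou := polar_regular nx.
have nO : noetherian (O x) by case: (res_regular rO x).
have [L [hL hL']] := finite_minimal_primes (sO x) nO (ideal_principal (sO x) Ou).
have key d : nonexceptional_polar d -> closure [set d] x ->
    exists2 P, List.In P L & nonunits (O d) `&` O x = P.
  move=> hd cd; have dd := polar_divisor hd.
  have [pQ _ hQ] := divisor_height_one rO cd dd.
  have [|P PL PQ] := hL' _ pQ.
    move=> _ [r Or ->]; split; last exact: srM.
    by apply: (idM (lO d)); [exact: (specialization_sub aO cd)|exact: (polar_nonunit hd.1)].
  exists P => //; have [pP uP] := hL _ PL; apply/seteqP; split=> //; apply: hQ => //.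
  by exists u; [apply: uP; exists 1; rewrite ?mul1r //; exact: sr1|exact: ratio_neq0].
have [l hl] : exists l : seq X, forall d P, List.In P L -> nonexceptional_polar d ->
    closure [set d] x -> nonunits (O d) `&` O x = P -> d \in l.
  elim: L {hL hL' key} => [|P L [l hl]]; first by exists [::].
  have [[d [hd cd dP]]|nd] := pselect (exists d, [/\ nonexceptional_polar d, closure [set d] x &
     nonunits (O d) `&` O x = P]).
    exists (d :: l) => d' P' [<-|PL] hd' cd' E; last by rewrite inE (hl _ P') ?orbT.
    by rewrite (specialization_unique rO cd' cd (etrans E (esym dP))) inE eqxx.
  exists l => d P' [<-|PL] hd cd E; last exact: hl PL hd cd E.
  by exfalso; apply: nd; exists d.
by exists l => d hd cd; have [P PL E] := key _ hd cd; apply: (hl _ P).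
Qed.

Lemma divisor_power d f : nonexceptional_polar d -> nonunits (O d) f ->
  exists n, exists2 r, O d r & f ^+ n = r * u.
Proof.
move=> hd mf; have dd := polar_divisor hd; have nd := hd.1.
have iJ := ideal_principal (sO d) (polar_regular nd).
apply: (radical_prime (sO d) iJ); first by case: mf.
move=> P pP JP; rewrite (krull_dim1_height_one (sO d) (lO d) dd pP) //.
exists u; last exact: ratio_neq0.
by apply: JP; exists 1; rewrite ?mul1r //; exact: sr1.
Qed.

Lemma divisor_valuation d f : divisor_point O d -> ~ O d f -> nonunits (O d) f^-1.
Proof.
move=> dd nf; have [P [al [be [hP Oal Pbe nPal [be0 fE]]]]] :=
  irreducible_fraction (sO d) (res_regular rO d) (point_dim bB rO (x:=d)) (O_fraction bB rO d) nf.
have [pP P0 _] := hP; have PE := krull_dim1_height_one (sO d) (lO d) dd pP P0.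
move: Pbe nPal; rewrite PE => mbe nal; have [al0 Oi] := unit_inv Oal nal.
by rewrite fE invf_div mulrC; apply: (idM (lO d)).
Qed.

End PolarLocus.

(** * Functions on the curve and integrality over the base *)

Section CurveRing.
Variables (K : fieldType) (B : set K) (k : closedFieldType) (iota : {rmorphism k -> K}).
Variables (X : topologicalType) (O : X -> set K).
Hypotheses (bB : base_ring B iota) (rO : resolved_by B O).
Let sB := base_subring bB.
Let lB := base_local bB.
Let sO := res_subring rO.
Let BO := res_base rO.
Let aO := affineO rO.
Let lO := local_O sO aO.
Variables (Z : X -> int) (a b : K).
Hypothesis pab : pencil B O Z a b.

Let a0 : a != 0. Proof. by case: (pencil_neq0 pab). Qed.
Let b0 : b != 0. Proof. by case: (pencil_neq0 pab). Qed.
Let ma : nonunits B a. Proof. by case: (pencil_nonunits pab). Qed.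
Let mb : nonunits B b. Proof. by case: (pencil_nonunits pab). Qed.
Let Ba : B a. Proof. by case: ma. Qed.
Let Bb : B b. Proof. by case: mb. Qed.
Local Notation u := (a / b).
Local Notation npol := (nonexceptional_polar B O a b).
Implicit Types (d : X) (f t e : K) (p q : {poly K}).

(* Functions regular at the nonexceptional points of the curve u = 0 *)
Definition curve_ring : set K := [set f | forall d, npol d -> O d f].

Lemma curve_subring : subring curve_ring.
Proof.
split; first by move=> d _; apply: sr1.
- by move=> f g hf hg d hd; apply: srB => //; [apply: hf|apply: hg].
- by move=> f g hf hg d hd; apply: srM => //; [apply: hf|apply: hg].
Qed.
Let sC := curve_subring.

Lemma curve_base : B `<=` curve_ring.
Proof. by move=> f Bf d _; apply: BO. Qed.

Lemma curve_u : curve_ring u.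
Proof. by move=> d hd; apply: polar_regular pab _ hd.1. Qed.

Lemma curve_binv : curve_ring b^-1.
Proof. by move=> d [nd ned]; apply: (polar_unit rO pab). Qed.

(** The functions that agree on the curve u = 0 with an element of [B]. *)
Definition base_mod : set K := [set f | exists c o, [/\ B c, curve_ring o & f = c + u * o]].

Lemma base_mod_base : B `<=` base_mod.
Proof. by move=> f Bf; exists f, 0; split=> //; [exact: sr0|rewrite mulr0 addr0]. Qed.

Lemma base_mod_u f : curve_ring f -> base_mod (u * f).
Proof. by move=> hf; exists 0, f; split=> //; [exact: sr0|rewrite add0r]. Qed.

Lemma base_mod_subring : subring base_mod.
Proof.
split; first exact: base_mod_base (sr1 sB).
- move=> _ _ [c [o [Bc Co ->]]] [c' [o' [Bc' Co' ->]]]; exists (c - c'), (o - o').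
  by split; [exact: srB|exact: (srB sC)|ring].
- move=> _ _ [c [o [Bc Co ->]]] [c' [o' [Bc' Co' ->]]].
  exists (c * c'), (c * o' + c' * o + u * (o * o')); split; [exact: srM| |ring].
  have Cc := curve_base Bc; have Cc' := curve_base Bc'; have Cu := curve_u.
  apply: (srD sC); first by apply: (srD sC); apply: (srM sC).
  by apply: (srM sC) => //; apply: (srM sC).
Qed.

(* Away from b, the base ring maps onto the functions on the curve u = 0. *)
Lemma curve_pole f : curve_ring f -> exists n, base_mod (b ^+ n * f).
Proof.
move=> Cf; apply: contrapT => nn.
pose I := [set c | B c /\ B (c * f)].
have iI : ideal B I.
  apply: idealI.
  - by move=> c [].
  - by split; [exact: sr0|rewrite mul0r; exact: sr0].
  - by move=> c c' [h1 h2] [h3 h4]; split; [exact: srD|rewrite mulrDl; exact: (srD sB)].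
  - by move=> s c Bs [h1 h2]; split; [exact: srM|rewrite -mulrA; exact: (srM sB)].
(* The denominators of f together with a. If no power of b lay in this ideal, some prime P over it
   would avoid b, and f would be outside B_P; a valuation ring over B_P that misses f then has its
   center at a nonexceptional point of the curve, where f is regular by hypothesis. *)
pose J := [set x | exists y z, [/\ I y, [set y | exists2 r, B r & y = r * a] z & x = y + z]].
have iJ : ideal B J by apply: ideal_sum => //; apply: ideal_principal.
have [||||P [pP JP bP]] := @exists_prime_avoiding K B J [set x | exists n, x = b ^+ n] sB iJ.
- by exists 0%N.
- by move=> _ _ [n ->] [m ->]; exists (n + m)%N; rewrite exprD.
- by move=> _ [n ->]; apply: srX.
- move=> _ [n ->] [c [_ [[Bc Bcf] [r Br ->] E]]]; apply: nn; exists n.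
  rewrite E mulrDl; apply: (srD base_mod_subring); first exact: base_mod_base.
  have -> : r * a * f = u * (r * b * f) by field.
  by apply: base_mod_u; apply: (srM sC) => //; apply: curve_base; apply: srM.
have [iP P1 PM] := pP.
have nbP : ~ P b by move=> Pb; apply: (bP b) => //; exists 1%N.
have IP : I `<=` P.
  move=> c Ic; apply: JP; exists c, 0; split=> //; last by rewrite addr0.
  by exists 0; rewrite ?mul0r //; exact: sr0.
have Pa : P a.
  apply: JP; exists 0, a; split; [exact: id0 iI| |by rewrite add0r].
  by exists 1; rewrite ?mul1r //; exact: sr1.
have nfP : ~ loc B P f.
  move=> [c [s [Bc Bs ns fE]]]; apply: (ns); apply: IP; split=> //.
  by rewrite fE mulrC divfK // (notin_neq0 pP ns).
have [V [vV LV nVf]] := nonintegral_valuation bB pP nfP.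
have BV : B `<=` V by apply: subset_trans LV; apply: loc_sub.
have [y [OV mV]] := res_center rO vV BV.
have pV := valuation_prime vV; have sV : subring V by case: vV.
have pQ := prime_contract sB BV pV.
have QP : nonunits V `&` B `<=` P.
  move=> s [ms Bs]; apply: contrapT => nPs; apply: (nonunits_inv ms); first exact: (notin_neq0 pP nPs).
  by apply: LV; exists 1, s; split=> //; [exact: sr1|rewrite div1r].
(* The valuation ring lies over P itself: a smaller trace on [B] would be nonzero, as it contains a
   denominator of f, and would give a chain of length 3 ending with P and m_B. *)
have PQ : P `<=` nonunits V `&` B.
  apply: contrapT => nPQ; apply: (base_dim bB (N := nonunits B)).
  exists (nonunits V `&` B), P, (nonunits B); split; first by split=> //; exact: nonunits_prime.
  split=> //; last first.
    by split; [exact: prime_sub_nonunits|move=> /(_ _ mb)].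
  have [g [s [Bg Bs /eqP s0 fE]]] := base_fraction bB f.
  exists s => //; split=> //.
  have f0 : f != 0 by apply/eqP => f0; apply: nVf; rewrite f0; exact: sr0.
  have -> : s = g * f^-1 by rewrite fE invf_div mulrCA divff ?mulr1 //; apply: contra_neq f0 => g0; rewrite fE g0 mul0r.
  by apply: (idM (valuation_local vV)); [exact: BV|exact: valuation_inv].
have may : nonunits (O y) a.
  by apply: (nonunits_dominated OV mV); [exact: BO|case: (PQ _ Pa)].
have nby : ~ nonunits (O y) b.
  by move=> /mV mVb; apply: nbP; apply: QP.
have hy : npol y.
  split.
    move=> Oba; apply: nby; have -> : b = (b / a) * a by rewrite divfK.
    exact: (idM (lO y)).
  by move=> ey; apply: nby; apply: ey.
by apply: nVf; apply: OV; apply: Cf.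
Qed.

Lemma coefs_in_comp (S : set K) p q : subring S -> coefs_in S p -> coefs_in S q -> coefs_in S (p \Po q).
Proof.
move=> sS hp hq; rewrite comp_polyE; elim/big_ind: _ => [i|r s hr hs|i _].
- by rewrite coef0; exact: sr0.
- by apply: coefs_inD => //; exact: srD.
- rewrite -mul_polyC; apply: coefs_inM => //; first by apply: coefs_inC => //; exact: sr0.
  elim: (nat_of_ord i) => [|n IH]; last by rewrite exprS; apply: coefs_inM.
  by apply: coefs_inC; [exact: sr0|exact: sr1].
Qed.

Lemma expV_sub (x : K) m n : x != 0 -> (m <= n)%N -> x^-1 ^+ m = x^-1 ^+ n * x ^+ (n - m).
Proof. by move=> x0 mn; rewrite -{1}(subnK mn) exprD mulrAC -exprMn mulVf // expr1n mul1r. Qed.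

Lemma B_unit_iota (c : k) : c != 0 -> ~ nonunits B (iota c).
Proof.
move=> c0 mc; apply: (nonunits_inv mc (iota_neq0 iota c0)); rewrite -fmorphV.
exact: base_const bB _.
Qed.

Section OnePoint.
Variable d : X.
Hypothesis hd : npol d.

(* The residue of t at the center would be transcendental: otherwise 0, m_d, m_B[t], (m_B, t)
   traces a chain of length 3 in B[t]. *)
Lemma primitive_relation t : O d t ->
  exists p, [/\ coefs_in B p, nonunits (O d) p.[t] & exists i, ~ nonunits B p`_i].
Proof.
move=> Odt; apply: contrapT => h.
have rel p : coefs_in B p -> nonunits (O d) p.[t] -> coefs_in (nonunits B) p.
  by move=> hp mp i; apply: contrapT => ni; apply: h; exists p; split=> //; exists i.
have rel0 p q : coefs_in B p -> coefs_in B q -> p.[t] = q.[t] -> coefs_in (nonunits B) (p - q).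
  move=> hp hq E; apply: rel; last by rewrite hornerD hornerN E subrr; exact: id0 (lO d).
  by apply: coefs_inD => //; [exact: srD|exact: coefs_inN].
have mBB p : coefs_in (nonunits B) p -> coefs_in B p by move=> hp i; case: (hp i).
have sA := adjoin_subring t sB.
have B0 := sr0 sB; have B1 := sr1 sB.
pose Q2 : set K := [set f | exists2 p, coefs_in (nonunits B) p & f = p.[t]].
pose Q3 : set K := [set f | exists p, [/\ coefs_in B p, nonunits B p`_0 & f = p.[t]]].
have iQ2 : ideal (adjoin B t) Q2.
  apply: idealI.
  - by move=> _ [p hp ->]; exists p => //; apply: mBB.
  - by exists 0; rewrite ?horner0 // => i; rewrite coef0; exact: id0 lB.
  - move=> _ _ [p hp ->] [q hq ->]; exists (p + q); last by rewrite hornerD.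
    by apply: coefs_inD => //; apply: (idD lB).
  - move=> _ _ [p hp ->] [q hq ->]; exists (p * q); last by rewrite hornerM.
    exact: coefs_inMl lB hp hq.
have iQ3 : ideal (adjoin B t) Q3.
  apply: idealI.
  - by move=> _ [p [hp _ ->]]; exists p.
  - by exists 0; rewrite horner0 coef0; split=> //; [move=> i; rewrite coef0|exact: id0 lB].
  - move=> _ _ [p [hp mp ->]] [q [hq mq ->]]; exists (p + q); rewrite hornerD coefD; split=> //.
      by apply: coefs_inD => //; exact: srD.
    exact: (idD lB).
  - move=> _ _ [p hp ->] [q [hq mq ->]]; exists (p * q); rewrite hornerM coef0M; split=> //.
      exact: coefs_inM.
    by apply: (idM lB).
have pQ2 : prime_ideal (adjoin B t) Q2.
  split=> //.
    move=> [p hp E]; have h1 : coefs_in B 1 by apply: coefs_inC.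
    have := rel0 1 p h1 (mBB _ hp); rewrite hornerC => /(_ E 0%N); rewrite coefB coefC /= => m1.
    have := idD lB m1 (hp 0%N); rewrite subrK; exact: nonunits1.
  move=> _ _ [p hp ->] [q hq ->] [r hr E].
  have [p' _ hp'] := residue_poly bB hp; have [q' _ hq'] := residue_poly bB hq.
  (* By [rel0] the value at t determines the coefficients modulo m_B, so B[t] modulo m_B is the
     polynomial ring over k, a domain. *)
  have pq0 : p' * q' = 0.
    apply/polyP => i; rewrite coef0; apply/eqP/negPn/negP => /B_unit_iota; apply.
    have hpq : coefs_in (nonunits B) (p * q).
      rewrite -[p * q](subrK r); apply: coefs_inD => //; first exact: idD lB.
      by apply: rel0; [exact: coefs_inM|exact: mBB|rewrite hornerM].
    have : nonunits B ((p * q - map_poly iota p' * map_poly iota q')`_i).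
      have -> : p * q - map_poly iota p' * map_poly iota q' =
          q * (p - map_poly iota p') + map_poly iota p' * (q - map_poly iota q') by ring.
      suff : coefs_in (nonunits B) (q * (p - map_poly iota p') + map_poly iota p' * (q - map_poly iota q')) by apply.
      apply: coefs_inD; first exact: idD lB.
        by apply: (coefs_inMl lB) => // j; rewrite coefB coef_map.
      apply: (coefs_inMl lB) => j; last by rewrite coefB coef_map.
      by rewrite coef_map; exact: base_const bB _.
    rewrite coefB -rmorphM coef_map => m1.
    by have := idB lB sB (hpq i) m1; rewrite subKr.
  have zero (r' : {poly K}) (s' : {poly k}) : (forall i, nonunits B (r'`_i - iota s'`_i)) -> s' = 0 -> coefs_in (nonunits B) r'.
    by move=> hs s0 i; have := hs i; rewrite s0 coef0 rmorph0 subr0.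
  move/eqP: pq0; rewrite mulf_eq0 => /orP[/eqP p0|/eqP q0].
    by left; exists p => //; apply: zero hp' p0.
  by right; exists q => //; apply: zero hq' q0.
have pQ3 : prime_ideal (adjoin B t) Q3.
  split=> //.
    move=> [p [hp mp E]]; have h1 : coefs_in B 1 by apply: coefs_inC.
    have := rel0 1 p h1 hp; rewrite hornerC => /(_ E 0%N); rewrite coefB coefC /= => m1.
    have := idD lB m1 mp; rewrite subrK; exact: nonunits1.
  move=> _ _ [p hp ->] [q hq ->] [r [hr mr E]].
  have := rel0 (p * q) r (coefs_inM sB hp hq) hr; rewrite hornerM => /(_ E 0%N).
  rewrite coefB coef0M => /(idD lB)/(_ mr); rewrite subrK.
  have [_ _ PM] := nonunits_prime sB lB.
  by move=> /PM[//|//|m1|m1]; [left; exists p|right; exists q].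
have Q3t : Q3 t.
  exists 'X; rewrite hornerX coefX; split=> //; [exact: coefs_inX|exact: id0 lB].
apply: (dimension_adjoin sB (base_noetherian bB) (base_fraction bB t) pQ3 Q3t (base_dim bB (N := _))).
have AO : adjoin B t `<=` O d by apply: adjoin_min.
have pQ1 := prime_contract sA AO (prime_nonunits sO aO d).
have mad : nonunits (O d) a.
  have -> : a = b * u by field.
  by apply: (idM (lO d)); [exact: BO|exact: (polar_nonunit pab hd.1)].
have nbd : ~ nonunits (O d) b.
  by move=> mbd; apply: (nonunits_inv mbd b0); exact: curve_binv.
exists (nonunits (O d) `&` adjoin B t), Q2, Q3; split=> //; split=> //.
- by exists a => //; split=> //; exact: adjoin_sub.
- split; first by move=> f [mf [p hp fE]]; exists p => //; apply: rel => //; rewrite -fE.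
  have Q2b : Q2 b by exists b%:P; [apply: coefs_inC => //; exact: id0 lB|rewrite hornerC].
  by move=> /(_ _ Q2b)[].
- split; first by move=> _ [p hp ->]; exists p; split=> //; exact: mBB.
  move=> /(_ _ Q3t)[p hp E].
  have := rel0 'X p (coefs_inX sB) (mBB _ hp); rewrite hornerX => /(_ E 1%N).
  rewrite coefB coefX /= => /(idD lB)/(_ (hp 1%N)); rewrite subrK; exact: nonunits1.
Qed.

(** If t has a pole at d, then 1/(t - l) vanishes there and the polynomial X serves. Otherwise t
    satisfies, modulo m_d, a relation p that is nonzero modulo m_B. For l off the roots of its
    reduction, p(l) is a unit of [B]; expanding p around l, reversing it and dividing by p(l) gives
    a monic relation for 1/(t - l). *)
Lemma integral_transform t : exists s : seq k, forall l, l \notin s ->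
  [/\ t - iota l != 0, O d (t - iota l)^-1 &
    exists q, [/\ coefs_in B q, q \is monic & nonunits (O d) q.[(t - iota l)^-1]]].
Proof.
have B0 := sr0 sB; have B1 := sr1 sB; have Oc := O_const bB rO d.
have [Odt|nOt] := pselect (O d t); last first.
  have dd := polar_divisor bB rO pab hd.
  have mt := divisor_valuation bB rO dd nOt.
  exists [::] => l _.
  have t0 : t != 0 by apply/eqP => t0; apply: nOt; rewrite t0; exact: sr0.
  have tl0 : t - iota l != 0.
    by apply/eqP => /eqP; rewrite subr_eq0 => /eqP tE; apply: nOt; rewrite tE.
  have [y Oy yE] := local_unit (sO d) (lO d) (idM (lO d) (Oc l) mt).
  have E : (t - iota l)^-1 = y * t^-1.
    apply: (mulIf tl0); rewrite mulVf //; transitivity ((1 - iota l * t^-1) * y); first by rewrite yE.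
    by field.
  have me : nonunits (O d) (t - iota l)^-1 by rewrite E; apply: (idM (lO d)).
  split=> //; first by case: me.
  exists 'X; rewrite hornerX; split=> //; [exact: coefs_inX|exact: monicX].
have [p [hp mp [i ni]]] := primitive_relation Odt.
have [p' _ hp'] := residue_poly bB hp.
have p'0 : p' != 0.
  by apply/eqP => p'0; apply: ni; have := hp' i; rewrite p'0 coef0 rmorph0 subr0.
have [s hs] := bad_values p'0; exists s => l /hs nr.
have Bl : B (iota l) by exact: base_const bB _.
have nB : ~ nonunits B p.[iota l].
  move=> mB; have := residue_horner sB (fun x h => h) lB (fun x h => h) Bl hp'.
  move=> /(idB lB sB mB); rewrite subKr horner_map /=.
  by apply: B_unit_iota; move: nr; rewrite /root.
have Bv : B p.[iota l] by apply: horner_in.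
have [v0 Bvi] := unit_inv Bv nB.
pose P := p \Po ('X + (iota l)%:P).
have hP : coefs_in B P.
  by apply: coefs_in_comp => //; apply: coefs_inD; [exact: srD|exact: coefs_inX|exact: coefs_inC].
have PE c : P.[c] = p.[c + iota l] by rewrite horner_comp !hornerE.
have Pt : P.[t - iota l] = p.[t] by rewrite PE subrK.
have P0 : P`_0 = p.[iota l] by rewrite -horner_coef0 PE add0r.
have ntl : ~ nonunits (O d) (t - iota l).
  move=> mtl; apply: (nonunits_inv _ v0 (@BO d _ Bvi)) => //.
  have [r rE] : exists r : {poly K}, P = r * 'X + (P`_0)%:P.
    have : root (P - (P`_0)%:P) 0 by rewrite /root hornerD hornerN hornerC horner_coef0 subrr.
    by move=> /factor_theorem[r]; rewrite subr0 => E; exists r; rewrite -E subrK.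
  have hr : coefs_in B r.
    by move=> j; have := hP j.+1; rewrite rE coefD coefMX coefC /= addr0.
  have : nonunits (O d) (P.[t - iota l] - r.[t - iota l] * (t - iota l)).
    apply: (idB (lO d) (sO d)); first by rewrite Pt.
    apply: (idM (lO d)) => //; apply: (horner_in (sO d)); first by move=> j; apply: BO.
    by case: mtl.
  by rewrite rE hornerD hornerM hornerX hornerC [X in X - _]addrC addrK P0.
have [tl0 Oe] := unit_inv (srB (sO d) Odt (Oc l)) ntl.
split=> //; set e := (t - iota l)^-1 in Oe *.
pose N := size P; pose c j := p.[iota l]^-1 * P`_(N - j).
exists (\poly_(j < N.+1) c j); split.
- by move=> j; rewrite coef_poly; case: ifP => // _; apply: srM.
- by rewrite monicE /lead_coef size_poly_eq ?coef_poly /= ?ltnSn /c subnn P0 mulVf // oner_eq0.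
- rewrite horner_poly.
  have -> : \sum_(j < N.+1) c j * e ^+ j = p.[iota l]^-1 * e ^+ N * p.[t].
    rewrite -Pt (@horner_coef_wide _ N.+1 P) ?leqnSn // mulr_sumr (reindex_inj rev_ord_inj) /=.
    apply: eq_bigr => j _; rewrite subSS /c; have jN : (j <= N)%N by rewrite -ltnS.
    by rewrite /e (expV_sub tl0 (leq_subr j N)) subKn // -!mulrA; congr (_ * _); rewrite mulrCA.
  by apply: (idM (lO d)) => //; apply: (srM (sO d)); [exact: BO|apply: (srX (sO d))].
Qed.

End OnePoint.

Definition integral_on_curve e :=
  curve_ring e /\ exists q o, [/\ coefs_in B q, q \is monic, (1 < size q)%N, curve_ring o & q.[e] = u * o].

(** The relations at the finitely many points d are multiplied, each raised to a power that makes
    its value divisible by u in the one-dimensional ring [O d]. *)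
Lemma integral_transform_curve t : exists s : seq k, forall l, l \notin s ->
  integral_on_curve (t - iota l)^-1.
Proof.
have [D hD] := nonexceptional_polar_finite bB rO pab.
suff [s hs] : exists s : seq k, forall l, l \notin s ->
    (forall d, d \in D -> npol d -> O d (t - iota l)^-1) /\
    exists q, [/\ coefs_in B q, q \is monic, (1 < size q)%N & forall d, d \in D -> npol d ->
      exists2 r, O d r & q.[(t - iota l)^-1] = u * r].
  exists s => l /hs[h1 [q [hq mq sq h2]]].
  split; first by move=> d hd; apply: h1 => //; apply: hD.
  exists q, (q.[(t - iota l)^-1] / u); split=> //; last by field; rewrite ?a0 ?b0.
  move=> d hd; have [r Or ->] := h2 d (hD d hd) hd.
  have -> : u * r / u = r by field; rewrite ?a0 ?b0.
  exact: Or.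
elim: D {hD} => [|d D [s hs]].
  exists [::] => l _; split=> //; exists 'X; split=> //; [exact: coefs_inX|exact: monicX|].
  by rewrite size_polyX.
have [nd|hd] := pselect (~ npol d).
  exists s => l /hs[h1 [q [hq mq sq h2]]]; split.
    by move=> d'; rewrite inE => /orP[/eqP->|d'D]; [|exact: h1].
  by exists q; split=> // d'; rewrite inE => /orP[/eqP->|d'D]; [|exact: h2].
move/contrapT: hd => hd.
have [s' hs'] := integral_transform hd t; exists (s ++ s') => l.
rewrite mem_cat negb_or => /andP[/hs[h1 [q [hq mq sq h2]]] /hs'[tl0 Oe [q' [hq' mq' mqe]]]].
have [n [r Or E]] := divisor_power bB rO pab hd mqe.
split.
  by move=> d'; rewrite inE => /orP[/eqP->|d'D]; [|exact: h1].
have Xn m : coefs_in B (q' ^+ m).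
  elim: m => [|m IH]; last by rewrite exprS; apply: coefs_inM.
  by apply: coefs_inC; [exact: sr0|exact: sr1].
exists (q * q' ^+ n); split.
- exact: coefs_inM.
- by rewrite rpredM // rpredX.
- rewrite size_Mmonic ?monic_neq0 // ?rpredX // (leq_trans sq) // -subn1.
  by rewrite -addnBA ?leq_addr // lt0n size_poly_eq0 monic_neq0 // rpredX.
- have Be d' p : npol d' -> O d' (t - iota l)^-1 -> coefs_in B p -> O d' p.[(t - iota l)^-1].
    by move=> _ Oe' hp; apply: (horner_in (sO d')) => // i; apply: BO.
  move=> d'; rewrite inE => /orP[/eqP->|d'D] hd'.
    exists (q.[(t - iota l)^-1] * r); last by rewrite hornerM horner_exp E; ring.
    by apply: (srM (sO d)) => //; apply: Be.
  have [r' Or' E'] := h2 _ d'D hd'.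
  exists (r' * (q' ^+ n).[(t - iota l)^-1]); last by rewrite hornerM E'; ring.
  by apply: (srM (sO d')) => //; apply: Be => //; apply: h1.
Qed.

(** Division by the monic q expresses elements of S[e], modulo u, through the powers of e below the
    degree of q. Only these finitely many powers need [curve_pole], so one exponent works for all of
    S[e]. *)
Lemma bounded_pole_step S e c : subring S -> B `<=` S -> S `<=` curve_ring ->
  (forall f, S f -> base_mod (b ^+ c * f)) -> integral_on_curve e ->
  exists c', forall f, adjoin S e f -> base_mod (b ^+ c' * f).
Proof.
move=> sS BS SC hc [Ce [q [o [hq mq sq Co qE]]]].
have S0 := sr0 sS; pose n := (size q).-1.
have nE : size q = n.+1 by rewrite prednK // ltnW.
have red p : coefs_in S p -> exists g o', [/\ coefs_in S g, (size g <= n)%N, curve_ring o'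
    & p.[e] = g.[e] + u * o'].
  elim/poly_ind: p => [|p c0 IH] hp.
    exists 0, 0; rewrite !horner0 size_poly0 mulr0 addr0; split=> //; last exact: sr0.
  have Sc0 : S c0 by have := hp 0%N; rewrite coefD coefMX coefC /= add0r.
  have [|g [o' [hg sg Co' E]]] := IH.
    by move=> i; have := hp i.+1; rewrite coefD coefMX coefC /= addr0.
  pose h := g * 'X + c0%:P.
  have hh : coefs_in S h.
    apply: coefs_inD; [exact: srD|apply: coefs_inM => //; exact: coefs_inX|exact: coefs_inC].
  have sh : (size h <= n.+1)%N.
    rewrite (leq_trans (size_polyD _ _)) // geq_max; apply/andP; split.
      by rewrite (leq_trans (size_polyMleq _ _)) // size_polyX addn2 ltnS.
    by rewrite (leq_trans (size_polyC_leq1 _)).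
  exists (h - (h`_n)%:P * q), (e * o' + h`_n * o); split.
  - apply: coefs_inD; [exact: srD|by []|apply: coefs_inN => //].
    by apply: coefs_inM => //; [exact: coefs_inC|move=> i; apply: BS].
  - apply/leq_sizeP => j; rewrite leq_eqVlt => /orP[/eqP<-|nj].
      rewrite coefB mul_polyC coefZ; have := mq; rewrite monicE /lead_coef -/n => /eqP ->.
      by rewrite mulr1 subrr.
    rewrite coefB mul_polyC coefZ [q`_j]nth_default ?nE // mulr0 subr0.
    exact: nth_default (leq_trans sh nj).
  - by apply: (srD sC); apply: (srM sC) => //; apply: SC.
  - have hE : h.[e] = g.[e] * e + c0 by rewrite /h !hornerE.
    rewrite hornerMXaddC (hornerD h) hornerN hornerM hornerC hE qE E.
    by move: (h`_n) => hn; ring.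
have [m hm] : exists m, forall i, (i < n)%N -> base_mod (b ^+ m * e ^+ i).
  elim: (n) => [|i [m hm]]; first by exists 0%N.
  have [m' hm'] := curve_pole (srX sC i Ce); exists (m + m')%N => j.
  have BMb l : base_mod (b ^+ l) by apply: base_mod_base; exact: srX.
  rewrite ltnS leq_eqVlt => /orP[/eqP->|ji].
    by rewrite exprD -mulrA; apply: (srM base_mod_subring).
  by rewrite addnC exprD -mulrA; apply: (srM base_mod_subring) => //; apply: hm.
exists (c + m)%N => _ [p hp ->]; have [g [o' [hg sg Co' ->]]] := red p hp.
rewrite mulrDr; apply: (srD base_mod_subring); last first.
  rewrite mulrCA; apply: base_mod_u; apply: (srM sC) => //; apply: curve_base; exact: srX.
rewrite (horner_coef_wide _ sg) mulr_sumr; apply: (sr_sum base_mod_subring) => i _.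
have -> : b ^+ (c + m) * (g`_i * e ^+ i) = (b ^+ c * g`_i) * (b ^+ m * e ^+ i) by rewrite exprD; ring.
by apply: (srM base_mod_subring); [exact: hc|exact: hm].
Qed.

(** [curve_pole] gives an exponent for each function separately; the approximation needs one for a
    whole algebra, in order to fix its precision beforehand. *)
Lemma bounded_pole (E : seq K) : {in E, forall e, integral_on_curve e} ->
  adjoins B E `<=` curve_ring /\ exists c, forall f, adjoins B E f -> base_mod (b ^+ c * f).
Proof.
move=> hE; split.
  by apply: adjoins_min => //; [exact: curve_base|move=> e /hE[]].
suff main S c : subring S -> B `<=` S -> S `<=` curve_ring ->
    (forall f, S f -> base_mod (b ^+ c * f)) -> exists c', forall f, adjoins S E f -> base_mod (b ^+ c' * f).
  apply: (main B 0%N) => //; first exact: curve_base.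
  by move=> f Bf; rewrite mul1r; exact: base_mod_base.
elim: E S c hE => [|e E IH] S c hE sS BS SC hc /=; first by exists c.
have he : integral_on_curve e by apply: hE; rewrite inE eqxx.
have [c' hc'] := bounded_pole_step sS BS SC hc he.
apply: (IH _ c') => //.
- by move=> e' e'E; apply: hE; rewrite inE e'E orbT.
- exact: adjoin_subring.
- by move=> f Bf; apply: adjoin_sub => //; apply: BS.
- by apply: adjoin_min => //; case: he.
Qed.

End CurveRing.

(** * Simultaneous approximation on the curve *)

Section SemilocalApproximation.
Variables (K : fieldType) (B : set K) (k : closedFieldType) (iota : {rmorphism k -> K}).
Variables (X : topologicalType) (O : X -> set K).
Hypotheses (bB : base_ring B iota) (rO : resolved_by B O).
Let sB := base_subring bB.
Let lB := base_local bB.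
Let sO := res_subring rO.
Let BO := res_base rO.
Let aO := affineO rO.
Let lO := local_O sO aO.
Variables (Z : X -> int) (a b : K).
Hypothesis pab : pencil B O Z a b.

Let a0 : a != 0. Proof. by case: (pencil_neq0 pab). Qed.
Let b0 : b != 0. Proof. by case: (pencil_neq0 pab). Qed.
Let Bb : B b. Proof. by case: (pencil_nonunits pab) => _ []. Qed.
Local Notation u := (a / b).
Local Notation npol := (nonexceptional_polar B O a b).
Local Notation CR := (curve_ring B O a b).
Local Notation polar := (fun x => ~ O x (b / a)).
Let sC := curve_subring rO a b.
Implicit Types (x y : X) (f t e : K).

Section PointData.
Variable x : X.
Hypotheses (nx : polar x) (ex : exceptional B O x).
Let Ou := polar_regular pab nx.
Let Oc := O_const bB rO x.

Lemma constant_unit c f : c != 0 -> nonunits (O x) f -> f - iota c != 0 /\ O x (f - iota c)^-1.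
Proof.
move=> c0 mf; have Of : O x f by case: mf.
apply: unit_inv; first exact: (srB (sO x)).
move=> /(idB (lO x) (sO x) mf); rewrite subKr => mc.
by apply: (nonunits_inv mc (iota_neq0 iota c0)); rewrite -fmorphV.
Qed.

(** Each t is traded for 1/(t - l), which is integral on the curve for general l and is a unit at x
    because l is nonzero. *)
Lemma point_data_list (T : seq K) : {in T, forall t, nonunits (O x) t} -> exists E : seq K,
  {in E, forall e, integral_on_curve B O a b e /\
    exists t l, [/\ nonunits (O x) t, l != 0 & e = (t - iota l)^-1]} /\
  {in T, forall t, exists2 l, l != 0 & (t - iota l)^-1 \in E}.
Proof.
elim: T => [|t T IH] mT; first by exists [::].
have [|E [h1 h2]] := IH; first by move=> s sT; apply: mT; rewrite inE sT orbT.
have [s hs] := integral_transform_curve bB rO pab t.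
have [l] := exists_notin (0 :: s); rewrite inE negb_or => /andP[l0 ls].
exists ((t - iota l)^-1 :: E); split=> e; rewrite inE => /orP[/eqP->|].
- by split; [exact: hs|exists t, l; split=> //; apply: mT; rewrite inE eqxx].
- exact: h1.
- by exists l => //; rewrite inE eqxx.
- by move=> /h2[m m0 mE]; exists m => //; rewrite inE mE orbT.
Qed.

(** The functions of [E], through their values at x, single out x as the center of valuation rings
    dominating [B]. *)
Definition dominated_via (E : seq K) := forall V, valuation_ring V -> B `<=` V ->
  nonunits B `<=` nonunits V -> {in E, forall e, V e} ->
  (forall e c, e \in E -> nonunits (O x) (e - iota c) -> nonunits V (e - iota c)) ->
  O x `<=` V /\ nonunits (O x) `<=` nonunits V.

Definition dense_in (E : seq K) := forall N f, O x f ->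
  exists2 g, adjoins B E g & mod_ub O a b x N (f - g).

(** With c the value of f at x, z = 1 - f / c is nilpotent modulo (u, b^N). The inverse is a finite
    geometric series in z divided by c, plus the remainder f^-1 z^n, which lies in that ideal and
    hence in [S]. *)
Lemma geometric_inverse S N f : subring S -> B `<=` S -> mod_ub O a b x N `<=` S -> S `<=` O x ->
  S f -> ~ nonunits (O x) f -> S f^-1.
Proof.
move=> sS BS IS SO Sf nf; have [f0 Ofi] := unit_inv (SO _ Sf) nf.
have iI := mod_ub_ideal rO pab N nx.
have [c mc] := polar_rational bB rO pab nx ex (SO _ Sf).
have c0 : c != 0 by apply/eqP => c0; move: mc; rewrite c0 rmorph0 subr0.
have ic0 := iota_neq0 iota c0.
have Sc l : S (iota l) by apply/BS/(base_const bB).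
pose z := 1 - f / iota c.
have zE : z = - (iota c)^-1 * (f - iota c) by rewrite /z; field.
have mz : nonunits (O x) z.
  by rewrite zE; apply: (idM (lO x)) => //; apply: (srN (sO x)); rewrite -fmorphV.
have Sz : S z by apply: srB; [|exact: sr1|apply: srM => //; rewrite -fmorphV].
have [n zn] := polar_radical bB rO pab N nx ex mz.
have fE : f = iota c * (1 - z) by rewrite /z; field.
have z1 : 1 - z != 0 by apply: contra_neq f0 => z1; rewrite fE z1 mulr0.
have -> : f^-1 = (iota c)^-1 * (\sum_(i < n) z ^+ i) + f^-1 * z ^+ n.
  have gE : 1 - z ^+ n = (1 - z) * \sum_(i < n) z ^+ i.
    by rewrite -opprB subrX1 -mulNr opprB.
  have -> : \sum_(i < n) z ^+ i = (1 - z ^+ n) / (1 - z) by rewrite gE mulrC mulKf.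
  by move: (z ^+ n) => w; rewrite fE; field; rewrite z1 ic0.
apply: srD => //; first by apply: srM; rewrite -?fmorphV //; apply: (sr_sum sS) => i _; apply: srX.
by apply: IS; apply: (idM iI).
Qed.

Lemma point_data : exists E : seq K, [/\ {in E, forall e, integral_on_curve B O a b e},
  {in E, forall e, O x e}, dominated_via E & dense_in E].
Proof.
have rx := polar_rational bB rO pab nx ex.
have [U [s [aU Ux UE ms]]] := rational_chart bB rO ex rx.
have [E [hE sE]] := point_data_list ms.
have OE : {in E, forall e, O x e}.
  by move=> e /hE[_ [t [l [mt l0 ->]]]]; case: (constant_unit l0 mt).
have Gx : structure_sheaf O U `<=` O x by move=> f; apply.
exists E; split=> //; first by move=> e /hE[].
- move=> V vV BV mBV EV rV; have sV : subring V by case: vV.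
  have lV := valuation_local vV.
  have Vc c : V (iota c) by apply/BV/(base_const bB).
  have ms' : {in s, forall t, nonunits V t}.
    move=> t ts; have [l l0 eE] := sE _ ts; have mt := ms _ ts.
    have [tl0 Oe] := constant_unit l0 mt; have il0 := iota_neq0 iota l0.
    set e := (t - iota l)^-1 in eE Oe.
    (* The value of e at x, where t vanishes, is -1 / l. *)
    have h : nonunits V (e - iota (- l^-1)).
      apply: rV => //; have -> : e - iota (- l^-1) = (e / iota l) * t.
        by rewrite rmorphN fmorphV opprK /e; field; rewrite tl0 il0.
      by apply: (idM (lO x)) => //; apply: (srM (sO x)) => //; rewrite -fmorphV.
    have [|e0 Vei] := unit_inv (EV _ eE).
      move=> me; have := idB lV sV me h; rewrite subKr => mc.
      apply: (nonunits_inv mc); first by rewrite fmorph_eq0 oppr_eq0 invr_eq0.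
      by rewrite -fmorphV; apply: Vc.
    have -> : t = (iota l * e^-1) * (e - iota (- l^-1)).
      by rewrite rmorphN fmorphV opprK /e; field; rewrite ?tl0 ?il0 ?oner_eq0.
    by apply: (idM lV) => //; apply: srM.
  have sG := structure_sheaf_subring sO U.
  have GV : structure_sheaf O U `<=` V.
    by rewrite UE; apply: adjoins_min => // t ts; case: (ms' _ ts).
  have BG : B `<=` structure_sheaf O U by rewrite UE; apply: adjoins_sub.
  pose I := nonunits (O x) `&` (nonunits V `&` structure_sheaf O U).
  have iI : ideal (structure_sheaf O U) I.
    apply: idealI.
    - by move=> g [_ []].
    - by split; [exact: id0 (lO x)|split; [exact: id0 lV|exact: (sr0 sG)]].
    - move=> g h [g1 [g2 g3]] [h1 [h2 h3]].
      by split; [exact: (idD (lO x))|split; [exact: (idD lV)|exact: (srD sG)]].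
    - move=> g h Gg [h1 [h2 h3]].
      by split; [exact: (idM (lO x) (Gx _ Gg))|split; [exact: (idM lV (GV _ Gg))|exact: (srM sG)]].
  have cst f : structure_sheaf O U f -> exists c, nonunits (O x) (f - iota c) /\ nonunits V (f - iota c).
    move=> Gf; have [|||c [h1 [h2 _]]] := adjoins_constant bB sG iI BG (s := s) (f := f).
    - by move=> g mg; split; [exact: ex|split; [exact: mBV|apply: BG; case: mg]].
    - move=> t ts; have Gt : structure_sheaf O U t by rewrite UE; apply: adjoins_gen.
      by split; [exact: ms|split=> //; exact: ms'].
    - by rewrite -UE.
    by exists c.
  have in_m f : structure_sheaf O U f -> nonunits (O x) f -> nonunits V f.
    move=> Gf mf; have [c [h1 h2]] := cst _ Gf.
    have c0 : c = 0.
      apply/eqP/negPn/negP => c0; have := idB (lO x) (sO x) mf h1; rewrite subKr => mc.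
      by apply: (nonunits_inv mc (iota_neq0 iota c0)); rewrite -fmorphV.
    by move: h2; rewrite c0 rmorph0 subr0.
  have out_m f : structure_sheaf O U f -> ~ nonunits (O x) f -> V f^-1.
    move=> Gf nf; have [c [h1 h2]] := cst _ Gf.
    have c0 : c != 0 by apply/eqP => c0; move: h1; rewrite c0 rmorph0 subr0.
    have [] // := @unit_inv _ V f (GV _ Gf); move=> mf.
    have := idB lV sV mf h2; rewrite subKr => mc.
    by apply: (nonunits_inv mc (iota_neq0 iota c0)); rewrite -fmorphV.
  have OxE := affine_local aU Ux.
  split=> f; first rewrite OxE.
    move=> [g [h [Gg Gh nh ->]]]; apply: srM => //; first exact: GV.
    by apply: out_m => // mh; apply: nh.
  move=> mf; have := mf.1; rewrite {1}OxE => -[g [h [Gg Gh nh fE]]].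
  have nmh : ~ nonunits (O x) h by move=> mh; apply: nh.
  have [h0 _] := unit_inv (Gx _ Gh) nmh.
  rewrite fE mulrC; apply: (idM lV); first exact: out_m.
  apply: in_m => //; have -> : g = h * f by rewrite fE mulrC divfK.
  by apply: (idM (lO x)) => //; exact: Gx.
- move=> N; have iI := mod_ub_ideal rO pab N nx.
  have sR : subring (adjoins B E) by apply: adjoins_subring.
  have RO : adjoins B E `<=` O x by apply: adjoins_min.
  pose S := [set f | O x f /\ exists2 g, adjoins B E g & mod_ub O a b x N (f - g)].
  have RS : adjoins B E `<=` S.
    by move=> f Rf; split; [exact: RO|exists f; rewrite ?subrr //; exact: id0 iI].
  have IS : mod_ub O a b x N `<=` S.
    by move=> f If; split; [exact: (idS iI)|exists 0; [exact: sr0|rewrite subr0]].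
  have SO : S `<=` O x by move=> f [].
  have sS : subring S.
    split; first by apply: RS; exact: sr1.
    - move=> f f' [Of [g Rg h]] [Of' [g' Rg' h']]; split; first exact: srB.
      exists (g - g'); first exact: srB.
      have -> : f - f' - (g - g') = (f - g) - (f' - g') by ring.
      exact: (idB iI).
    - move=> f f' [Of [g Rg h]] [Of' [g' Rg' h']]; split; first exact: srM.
      exists (g * g'); first exact: srM.
      have -> : f * f' - g * g' = f' * (f - g) + g * (f' - g') by ring.
      by apply: (idD iI); apply: (idM iI) => //; exact: RO.
  have BS : B `<=` S by apply: subset_trans RS; apply: adjoins_sub.
  have inv f : S f -> ~ nonunits (O x) f -> S f^-1.
    by move=> Sf nf; exact: (geometric_inverse sS BS IS SO Sf nf).
  (* The approximable functions [S] contain each e and the inverses of those elements that are units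
     of [O x]; so they contain t = l + 1/e, then the chart, then its localization [O x]. *)
  suff OS : O x `<=` S by move=> f /OS[].
  have sS' : {in s, forall t, S t}.
    move=> t ts; have [l l0 eE] := sE _ ts; have mt := ms _ ts.
    have [tl0 Oe] := constant_unit l0 mt.
    rewrite -[t](subrK (iota l)); apply: srD => //; last by apply: BS; exact: base_const bB _.
    rewrite -[_ - _]invrK; apply: inv; first by apply: RS; apply: adjoins_gen.
    move=> me; apply: (nonunits_inv me); first by rewrite invr_eq0.
    by rewrite invrK; apply: srB => //; case: mt.
  have GS : structure_sheaf O U `<=` S by rewrite UE; apply: adjoins_min.
  rewrite (affine_local aU Ux) => _ [g [h [Gg Gh nh ->]]].
  apply: srM => //; first exact: GS.
  by apply: inv; [exact: GS|move=> mh; apply: nh].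
Qed.

End PointData.

Definition branch_ring x : set K := [set f | forall d, npol d -> closure [set d] x -> O d f].

Lemma branch_subring x : subring (branch_ring x).
Proof.
split; first by move=> d _ _; apply: sr1.
- by move=> f g hf hg d hd cd; apply: srB => //; [apply: hf|apply: hg].
- by move=> f g hf hg d hd cd; apply: srM => //; [apply: hf|apply: hg].
Qed.

Lemma branch_curve x : CR `<=` branch_ring x.
Proof. by move=> f hf d hd _; apply: hf. Qed.

Lemma branch_local x : O x `<=` branch_ring x.
Proof. by move=> f Of d _ cd; apply: (specialization_sub aO cd). Qed.

(** Weaker than [mod_ub]: the coefficient of u is regular only along the branches of the curve
    through x. Functions built for several closed points may have poles at x, and multiplication by
    them preserves only this much control. *)
Definition near x N : set K :=
  [set f | exists c o, [/\ O x c, branch_ring x o & f = c * b ^+ N + u * o]].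

Lemma nearD x N f g : near x N f -> near x N g -> near x N (f + g).
Proof.
move=> [c [o [Oc bo ->]]] [c' [o' [Oc' bo' ->]]]; exists (c + c'), (o + o').
by split; [exact: (srD (sO x))|exact: (srD (branch_subring x))|ring].
Qed.

Lemma near0 x N : near x N 0.
Proof.
exists 0, 0; split; [exact: sr0|exact: (sr0 (branch_subring x))|by rewrite mul0r mulr0 addr0].
Qed.

Lemma nearN x N f : near x N f -> near x N (- f).
Proof.
move=> [c [o [Oc bo ->]]]; exists (- c), (- o).
by split; [exact: (srN (sO x))|exact: (srN (branch_subring x))|ring].
Qed.

Lemma near_mod_ub x N f : mod_ub O a b x N f -> near x N f.
Proof.
by move=> [c [d [Oc Od ->]]]; exists d, c; split=> //; [exact: branch_local|ring].
Qed.

Variable xs : seq X.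
Hypotheses (uxs : uniq xs) (hxs : {in xs, forall x, polar x /\ exceptional B O x}).

(** The Chinese remainder theorem in the algebra generated over [B] by the functions attached to all
    the points: it approximates each local ring, and uniqueness of centers makes the ideals of
    distinct points comaximal. *)
Lemma semilocal_approximation N (ga : X -> K) : {in xs, forall x, O x (ga x)} ->
  exists2 f, CR f & {in xs, forall x, near x N (f - ga x)}.
Proof.
move=> Oga.
have /choice[Ex hEx] : forall x, exists E : seq K, polar x /\ exceptional B O x ->
  [/\ {in E, forall e, integral_on_curve B O a b e},
  {in E, forall e, O x e}, dominated_via x E & dense_in x E].
  move=> x; have [[nx ex]|h] := pselect (polar x /\ exceptional B O x); last by exists [::].
  by have [E hE] := point_data nx ex; exists E.
pose E := flatten [seq Ex x | x <- xs].
have EP e : e \in E -> exists2 x, x \in xs & e \in Ex x by move=> /flatten_mapP[x]; exists x.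
have ExE x e : x \in xs -> e \in Ex x -> e \in E by move=> xs' ee; apply/flatten_mapP; exists x.
have iE : {in E, forall e, integral_on_curve B O a b e}.
  by move=> e /EP[x xs' ee]; have [h _ _ _] := hEx x (hxs xs'); apply: h.
have [RC [c hc]] := bounded_pole bB rO pab iE.
pose R := adjoins B E.
have sR : subring R by apply: adjoins_subring.
have BR : B `<=` R by apply: adjoins_sub.
have ExR x : x \in xs -> adjoins B (Ex x) `<=` R.
  move=> xs'; apply: adjoins_min => // e ee; apply: adjoins_gen => //; exact: ExE ee.
(* The exponent N + c leaves precision N once b^c has cleared the poles of an element of [R]. *)
pose H x : set K := [set h | R h /\ mod_ub O a b x (N + c) h].
pose G x := ideal_gen R (H x).
have HR x : H x `<=` R by move=> h [].
have iG x : ideal R (G x) by apply: ideal_gen_ideal.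
have Gnear x h : polar x -> G x h -> near x N h.
  move=> nx Gh; suff : [set h | forall r, R r -> near x N (r * h)] h.
    by move=> /(_ 1 (sr1 sR)); rewrite mul1r.
  apply: Gh.
    split.
    - by move=> r _; rewrite mulr0; exact: near0.
    - by move=> v w hv hw r Rr; rewrite mulrDr; apply: nearD; [exact: hv|exact: hw].
    - move=> s v Rs hv r Rr; rewrite /GRing.scale /= mulrA; apply: hv; exact: srM.
  move=> h' [Rh' [al [be [Oal Obe ->]]]] r Rr.
  have [b' [o [Bb' Co E']]] := hc r Rr.
  exists (be * b'), (al * r + be * b ^+ N * o); split.
  - by apply: (srM (sO x)) => //; exact: BO.
  - have hb := branch_subring x; have hl := @branch_local x.
    apply: (srD hb); apply: (srM hb).
    + exact: hl.
    + by apply: branch_curve; exact: RC.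
    + by apply: (srM hb); apply: hl => //; apply: (srX (sO x)); exact: BO.
    + exact: branch_curve.
  - have -> : r * (al * u + be * b ^+ (N + c)) = u * (al * r) + be * b ^+ N * (b ^+ c * r).
      by rewrite exprD; ring.
    by rewrite E'; ring.
(* A valuation ring with both [H x] and [H y] among its nonunits would have x and y as centers. *)
have comax x y : x \in xs -> y \in xs -> x != y -> ideal_gen R (H x `|` H y) 1.
  move=> xs' ys xy; apply: contrapT => n1.
  have [|V [vV RV HV]] := @chevalley _ R (H x `|` H y) sR _ n1.
    by move=> f [[]|[]].
  have sV : subring V by case: vV.
  have lV := valuation_local vV; have pV := valuation_prime vV.
  have dom z : z \in xs -> H z `<=` nonunits V -> O z `<=` V /\ nonunits (O z) `<=` nonunits V.
    move=> zs HzV; have [nz ez] := hxs zs; have [_ OE dz _] := hEx z (conj nz ez).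
    have powV f : R f -> nonunits (O z) f -> nonunits V f.
      move=> Rf mf; have [n hn] := polar_radical bB rO pab (N + c) nz ez mf.
      apply: (primeX (n := n) sV pV); first exact: RV.
      by apply: HzV; split=> //; apply: srX.
    apply: dz => //.
    - by apply: subset_trans RV.
    - by move=> f mf; apply: powV; [apply: BR; case: mf|exact: ez].
    - by move=> e ee; apply: RV; apply: adjoins_gen => //; apply: ExE ee.
    - move=> e l ee; apply: powV; apply: srB => //.
        by apply: adjoins_gen => //; apply: ExE ee.
      by apply: BR; exact: base_const bB _.
  have [OxV mxV] := dom x xs' (fun h hh => HV h (or_introl hh)).
  have [OyV myV] := dom y ys (fun h hh => HV h (or_intror hh)).
  by move/eqP: xy; apply; apply: (res_center_unique rO vV).
(* The product, over the points y other than x, of elements that are 1 modulo [G x] and lie in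
   [G y]. *)
have idem x : x \in xs -> exists e, [/\ R e, G x (1 - e) & {in xs, forall y, y != x -> G y e}].
  move=> xs'.
  suff main (l : seq X) : {subset l <= xs} -> exists e, [/\ R e, G x (1 - e) & {in l, forall y, y != x -> G y e}].
    by apply: main.
  elim: l => [|y l IH] sl.
    by exists 1; split=> //; [exact: sr1|rewrite subrr; exact: id0 (iG x)].
  have [|e [Re Ge le]] := IH; first by move=> z zl; apply: sl; rewrite inE zl orbT.
  have [yx|yx] := eqVneq y x.
    exists e; split=> // z; rewrite inE => /orP[/eqP->|zl]; last exact: le.
    by rewrite yx eqxx.
  have ys : y \in xs by apply: sl; rewrite inE eqxx.
  have [e' [Re' Gxe Gye]] : exists e', [/\ R e', G x (1 - e') & G y e'].
    have : [set w | exists p q, [/\ G x p, G y q & w = p + q]] 1.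
      apply: (comax _ _ ys xs' yx); first by have [] := ideal_sum sR (iG x) (iG y).
      move=> h [Hh|Hh]; last by exists h, 0; rewrite addr0; split=> //; [exact: ideal_gen_sub|exact: id0 (iG y)].
      by exists 0, h; rewrite add0r; split=> //; [exact: id0 (iG x)|exact: ideal_gen_sub].
    move=> [p [q [Gp Gq E1]]]; exists q; split=> //; first exact: (idS (iG y)).
    by rewrite E1 addrK.
  exists (e * e'); split; first exact: srM.
    have -> : 1 - e * e' = (1 - e) + e * (1 - e') by ring.
    by apply: (idD (iG x)) => //; apply: (idM (iG x)).
  move=> z; rewrite inE => /orP[/eqP-> _|zl zx]; first exact: (idM (iG y)).
  by apply: (idMr (iG z)) => //; apply: le.
have /choice[e he] : forall x, exists e, x \in xs -> [/\ R e, G x (1 - e) & {in xs, forall y, y != x -> G y e}].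
  by move=> x; have [/idem[e]|] := boolP (x \in xs); [exists e|exists 0].
have /choice[rho hrho] : forall x, exists r, x \in xs -> R r /\ near x N (ga x - r).
  move=> x; have [xs'|] := boolP (x \in xs); last by exists 0.
  have [nx ex] := hxs xs'; have [_ _ _ dx] := hEx x (conj nx ex).
  have [r Er Nr] := dx N _ (Oga _ xs'); exists r => _; split; first exact: (ExR x).
  exact: near_mod_ub.
exists (\sum_(x <- xs) e x * rho x).
  rewrite big_seq; apply: (sr_sum sC) => x xs'; apply: RC; apply: (srM sR).
    by have [] := he _ xs'.
  by have [] := hrho _ xs'.
move=> x xs'; have [nx ex] := hxs xs'.
rewrite (bigD1_seq x) //=; have [Rr Nr] := hrho _ xs'; have [Re Ge _] := he _ xs'.
have -> : e x * rho x + \sum_(i <- xs | i != x) e i * rho i - ga x =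
   - (rho x * (1 - e x)) - (ga x - rho x) + \sum_(i <- xs | i != x) e i * rho i by ring.
apply: nearD.
  apply: nearD; last exact: nearN.
  by apply: nearN; apply: Gnear => //; apply: (idM (iG x)).
rewrite big_seq_cond; apply: (big_ind (near x N)); [exact: near0|exact: nearD|].
move=> y /andP[ys yx]; apply: Gnear => //; have [Ry _ hy] := he _ ys.
by apply: (idMr (iG x)); [by have [] := hrho _ ys|apply: hy => //; rewrite eq_sym].
Qed.

End SemilocalApproximation.

(** * Multiplication by a on the first cohomology *)

Section Cohomology.
Variables (K : fieldType) (B : set K) (k : closedFieldType) (iota : {rmorphism k -> K}).
Variables (X : topologicalType) (O : X -> set K).
Hypotheses (bB : base_ring B iota) (rO : resolved_by B O).
Let sB := base_subring bB.
Let lB := base_local bB.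
Let sO := res_subring rO.
Let aO := affineO rO.
Variables (Z : X -> int) (a b : K).
Hypothesis pab : pencil B O Z a b.

Let a0 : a != 0. Proof. by case: (pencil_neq0 pab). Qed.
Let b0 : b != 0. Proof. by case: (pencil_neq0 pab). Qed.
Let mb : nonunits B b. Proof. by case: (pencil_nonunits pab). Qed.
Local Notation u := (a / b).
Local Notation npol := (nonexceptional_polar B O a b).
Local Notation polar := (fun x => ~ O x (b / a)).
Local Notation F1 := (cycle_sheaf O Z).
Local Notation F0 := (structure_sheaf O).

(** [cech_cocycles], and below [cech_coboundaries], over an arbitrary field [K]; for a fraction
    field they agree by conversion. *)
Definition cocycles (F : set X -> set K) : set (X -> X -> K^o) :=
  [set f | (forall x y z, f x y + f y z = f x z) /\
     exists2 U : X -> set X, pointed_cover U & forall x y, F (U x `&` U y) (f x y)].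

Definition coboundaries (F : set X -> set K) : set (X -> X -> K^o) :=
  [set f | exists (U : X -> set X) (g : X -> K), [/\ pointed_cover U,
     forall x, F (U x) (g x) & forall x y, f x y = g y - g x]].

Lemma cycle_at_a x f : O x (b / a) -> cycle_at O Z x f <-> O x (f / a).
Proof. by move=> h; exact: (pencil_left pab f h). Qed.

Lemma cycle_at_b x f : O x (a / b) -> cycle_at O Z x f <-> O x (f / b).
Proof. by move=> h; exact: (pencil_right pab f h). Qed.

Lemma cycle_at_local x : exists g, forall f, cycle_at O Z x f <-> O x (f / g).
Proof.
by case: (pencil_cover pab x) => h; [exists a|exists b] => f; [exact: cycle_at_a|exact: cycle_at_b].
Qed.

Lemma cycle_atB x f g : cycle_at O Z x f -> cycle_at O Z x g -> cycle_at O Z x (f - g).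
Proof.
have [t tE] := cycle_at_local x; rewrite !tE mulrBl; exact: (srB (sO x)).
Qed.

Lemma cycle_at0 x : cycle_at O Z x 0.
Proof. by have [t tE] := cycle_at_local x; rewrite tE mul0r; exact: sr0. Qed.

(* If b^p kills the class of f, then f is the coboundary of ga / b^p. At the points of the curve
   u = 0, the cochain ga / b^p is replaced by its difference h with b psi, psi having the same
   poles along the curve: then h is a section of O(-Z) and f - dh is divisible by a. *)
Lemma multiplication_surjective p f :
  quotient_has_length B (cocycles F1) (coboundaries F1) p -> cocycles F1 f ->
  exists2 g, cocycles F0 g & coboundaries F1 (fun x y => f x y - a * g x y).
Proof.
move=> lF1 cf; have [fE [U pU fU]] := cf.
have [U' [ga [pU' gaU E]]] := finite_length_nilpotent sB lB mb lF1 cf.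
have {}E x y : b ^+ p * f x y = ga y - ga x by rewrite -E.
have oU x : open (U x) by case: (pU x).
have oU' x : open (U' x) by case: (pU' x).
have gax x : cycle_at O Z x (ga x).
  by apply: ((cycle_sheafE O Z (ga x) (oU' x)).1 (gaU x)); case: (pU' x).
have fat x y w : U x w -> U y w -> cycle_at O Z w (f x y).
  move=> Ux Uy; apply: ((cycle_sheafE O Z (f x y) (openI (oU x) (oU y))).1 (fU x y)).
  by split.
have [s sP] := polar_exceptional_finite bB rO pab.
pose xs := undup s.
have xsP x : (polar x /\ exceptional B O x) <-> x \in xs by rewrite mem_undup.
have [D hD] := nonexceptional_polar_finite bB rO pab.
have uxs : uniq xs by apply: undup_uniq.
have hxs : {in xs, forall x, polar x /\ exceptional B O x} by move=> x /xsP.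
have Oga : {in xs, forall x, O x (ga x / b)}.
  by move=> x /hxs[nx ex]; apply/(cycle_at_b _ (polar_regular pab nx)).
have [eta Ceta neta] := semilocal_approximation bB rO pab uxs hxs p Oga.
have /choice[co hco] : forall x, exists co : K * K, x \in xs ->
    [/\ O x co.1, branch_ring B O a b x co.2 & eta - ga x / b = co.1 * b ^+ p + u * co.2].
  move=> x; have [/neta[c [o [Oc bo Eq]]]|] := boolP (x \in xs); last by exists (0, 0).
  by exists (c, o).
pose psi := eta / b ^+ p.
(* At a closed point x of the curve, ga / b^p - b psi is the regular section - b [(co x).1] plus
   this term, which is divisible by a along the branches through x. *)
pose eps x := if x \in xs then - (a * ((co x).2 / b ^+ p)) else 0.
have bp0 : b ^+ p != 0 by rewrite expf_neq0.
pose h x := if `[< O x (b / a) >] then 0 else ga x / b ^+ p - b * psi - eps x.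
have hreg x : O x (b / a) -> h x = 0 by rewrite /h => Ox; case: asboolP.
have hpol x : polar x -> h x = ga x / b ^+ p - b * psi - eps x by rewrite /h => Ox; case: asboolP.
have npolP x : polar x -> x \notin xs -> npol x.
  by move=> nx xx; split=> // ex; move/negP: xx; apply; apply/xsP.
have Ohb x : polar x -> O x (h x / b).
  move=> nx; rewrite hpol //; have [xx|xx] := boolP (x \in xs).
    rewrite /eps xx; have [Oc _ Eq] := hco x xx.
    have -> : (ga x / b ^+ p - b * psi - - (a * ((co x).2 / b ^+ p))) / b = - (co x).1.
      apply: (mulfI bp0).
      have -> : b ^+ p * ((ga x / b ^+ p - b * psi - - (a * ((co x).2 / b ^+ p))) / b) =
          - (eta - ga x / b) + u * (co x).2.
        by rewrite /psi; move: (b ^+ p) bp0 => w w0; field; rewrite w0 b0.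
      by rewrite Eq; ring.
    exact: (srN (sO x)).
  have hx := npolP x nx xx; rewrite /eps (negPf xx) subr0.
  have Obi : O x b^-1 by apply: (curve_binv rO pab).
  have Ob : O x (b ^+ p)^-1 by rewrite -exprVn; apply: (srX (sO x)).
  have Og : O x (ga x / b).
    by apply/(cycle_at_b _ (polar_regular pab nx)).
  have -> : (ga x / b ^+ p - b * psi) / b = (ga x / b) * (b ^+ p)^-1 - psi.
    by move: (b ^+ p) bp0 => w w0; field; rewrite w0 b0.
  apply: (srB (sO x)); first exact: (srM (sO x)).
  by apply: (srM (sO x)) => //; exact: Ceta.
(* [W x] stays in X_a when x is there. It contains no closed point of the curve except possibly x,
   and the generic points of the curve inside it specialize to x, so the data at x control them. *)
have /choice[W hW] : forall x, exists W, [/\ open W, W x, W `<=` U x,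
    (O x (b / a) -> W `<=` [set w | O w (b / a)]) /\
    (polar x -> forall w, W w -> O w (a / b) /\ O w (h x / b)) &
    (forall y, y \in xs -> W y -> x = y) /\ (forall y, npol y -> W y -> closure [set y] x)].
  move=> x; have [V [oV Vx hV]] := avoiding_nbhd x (xs ++ D).
  have cl y : y \in xs -> V y -> x = y.
    move=> yx Vy; have [ny ey] := hxs y yx; apply: (polar_closed bB rO pab ny ey).
    by apply: hV => //; rewrite mem_cat yx.
  have cl' y : npol y -> V y -> closure [set y] x.
    by move=> hy Vy; apply: hV => //; rewrite mem_cat hD ?orbT.
  have Ux : U x x by case: (pU x).
  have [Ox|nx] := pselect (O x (b / a)).
    exists (V `&` (U x `&` [set w | O w (b / a)])); split=> //.
    - by do 2!apply: openI => //; apply: open_domain.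
    - by move=> w [_ []].
    - by split=> // _ w [_ []].
    - by split=> y hy [Vy _]; [exact: cl|exact: cl'].
  exists (V `&` (U x `&` ([set w | O w (a / b)] `&` [set w | O w (h x / b)]))); split=> //.
  - by do 3!apply: openI => //; apply: open_domain.
  - by split=> //; split=> //; split; [exact: (polar_regular pab nx)|exact: Ohb].
  - by move=> w [_ []].
  - by split=> // _ w [_ [_ []]].
  - by split=> y hy [Vy _]; [exact: cl|exact: cl'].
have oW x : open (W x) by case: (hW x).
have hat x w : W x w -> cycle_at O Z w (h x).
  move=> Ww; have [_ _ _ [hr hp] _] := hW x.
  have [Ox|nx] := pselect (O x (b / a)); first by rewrite hreg //; exact: cycle_at0.
  by have [Ow Owh] := hp nx w Ww; apply/cycle_at_b.
exists (fun x y => (f x y - (h y - h x)) / a); last first.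
  exists W, h; split.
  - by move=> x; have [oWx Wx _ _ _] := hW x.
  - by move=> x; apply/cycle_sheafE => // w; exact: hat.
  - by move=> x y /=; field.
split; first by move=> x y z; rewrite -(fE x y z); field.
exists W; first by move=> x; have [oWx Wx _ _ _] := hW x.
move=> x y w [Wx Wy].
have [_ _ WU [hr hp] [hx1 hx2]] := hW x; have [_ _ WU' [hr' hp'] [hy1 hy2]] := hW y.
have cw : cycle_at O Z w (f x y - (h y - h x)).
  apply: cycle_atB; first by apply: fat; [exact: WU|exact: WU'].
  by apply: cycle_atB; apply: hat.
have [Ow|nw] := pselect (O w (b / a)); first by apply/cycle_at_a.
have nx : polar x by move=> Ox; apply: nw; apply: (hr Ox).
have ny : polar y by move=> Oy; apply: nw; apply: (hr' Oy).
have -> : f x y - (h y - h x) = eps y - eps x.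
  have -> : f x y = (ga y - ga x) / b ^+ p by rewrite -E mulrC mulKf.
  by rewrite !hpol //; ring.
(* A closed point of the curve lying in both [W x] and [W y] equals x and y, and then the two terms
   cancel. *)
have [wx|wx] := boolP (w \in xs).
  by rewrite (hx1 w wx Wx) (hy1 w wx Wy) subrr mul0r; exact: sr0.
have hw := npolP w nw wx.
have Oe z : closure [set w] z -> O w (eps z / a).
  move=> cwz; rewrite /eps; case: ifP => zx; last by rewrite mul0r; exact: sr0.
  have [_ bo _] := hco z zx.
  have -> : - (a * ((co z).2 / b ^+ p)) / a = - ((co z).2 * (b ^+ p)^-1).
    by move: (b ^+ p) bp0 => v v0; field; rewrite v0 a0.
  apply: (srN (sO w)); apply: (srM (sO w)); first exact: bo.
  by rewrite -exprVn; apply: (srX (sO w)); apply: (curve_binv rO pab).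
by rewrite mulrBl; apply: (srB (sO w)); apply: Oe; [exact: hy2|exact: hx2].
Qed.

(* A surjection between modules of the same length: otherwise the inverse images of a
   composition series of H^1(O(-Z)), preceded by 0, form too long a chain in H^1(O). *)
Lemma multiplication_injective p g :
  quotient_has_length B (cocycles F0) (coboundaries F0) p ->
  quotient_has_length B (cocycles F1) (coboundaries F1) p ->
  cocycles F0 g -> coboundaries F1 (fun x y => a * g x y) -> coboundaries F0 g.
Proof.
move=> lF0 lF1 cg bg; apply: contrapT => nbg.
have [C0 [C00 C0p sC0 _]] := lF0; have [C [C10 C1p sC simC]] := lF1.
have sb0 : submodule B (coboundaries F0) by rewrite -C00; apply: sC0.
have sc0 : submodule B (cocycles F0) by rewrite -C0p; apply: sC0.
pose D i : set (X -> X -> K^o) := if i is j.+1 then [set g | cocycles F0 g /\ C j (a *: (g : X -> X -> K^o))] else coboundaries F0.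
have bC i : (i <= p)%N -> coboundaries F1 `<=` C i.
  elim: i => [|i IH] ip; first by rewrite C10.
  apply: subset_trans (IH (ltnW ip)) _; by have [[]] := simC i ip.
have Cc i : (i <= p)%N -> C i `<=` cocycles F1.
  move=> ip; rewrite -(subKn ip); elim: (p - i)%N (leq_subr i p) => [|j IH] jp; first by rewrite subn0 C1p.
  apply: subset_trans (IH (ltnW jp)).
  have [|[h _] _] := simC (p - j.+1)%N; first by rewrite ltn_subrL (leq_trans _ jp).
  by rewrite subnSK in h.
apply: (length_chain_bound (D := D) sB lF0).
- case=> [|i] ip //=; have [s0 sD sZ] := sC i ip; have [t0 tD tZ] := sc0; split.
  + by split=> //; rewrite scaler0.
  + by move=> v w [cv Cv] [cw Cw]; split; [exact: tD|rewrite scalerDr; exact: sD].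
  + move=> r v Br [cv Cv]; split; first exact: tZ.
    by rewrite scalerA mulrC -scalerA; exact: sZ.
- by [].
- by move=> v [].
case=> [|i] ip /=.
  split; last by move=> h; apply: nbg; apply: h; split=> //; rewrite C10.
  move=> v bv; split.
    have [U [w [pU wU vE]]] := bv; split.
      by move=> x y z; rewrite !vE; ring.
    exists U => // x y z [Ux Uy]; rewrite vE.
    by apply: (srB (sO z)); apply: wU.
  rewrite C10; have [U [w [pU wU vE]]] := bv; exists U, (fun x => a * w x); split=> //.
    move=> x; have oUx : open (U x) by case: (pU x).
    apply/(cycle_sheafE O Z _ oUx) => y Uy; have Ow : O y (w x) by apply: wU.
    case: (pencil_cover pab y) => hy.
      apply/cycle_at_a => //; have -> : a * w x / a = w x by field.
      exact: Ow.
    apply/cycle_at_b => //; have -> : a * w x / b = u * w x by rewrite mulrAC.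
    exact: (srM (sO y)).
  by move=> x y; transitivity (a * v x y) => //; rewrite vE mulrBr.
have [[CC nCC] _] := simC i ip.
split; first by move=> v [cv Cv]; split=> //; apply: CC.
have [v [Cv nCv]] : exists v, C i.+1 v /\ ~ C i v.
  by apply: contrapT => h; apply: nCC => v Cv; apply: contrapT => nv; apply: h; exists v.
have [w cw] := multiplication_surjective lF1 (Cc _ ip _ Cv).
rewrite -[fun _ => _]/(v - a *: (w : X -> X -> K^o)) => bw.
have [_ sD0 _] := sC _ (ltnW ip).
move=> h; apply: nCv; rewrite -[v](subrK (a *: (w : X -> X -> K^o))).
apply: sD0; first exact: (bC _ (ltnW ip)).
have [] // := h w; split=> //; rewrite -[a *: _](subKr v).
by apply: (submoduleB sB (sC _ ip)) => //; apply: (bC _ ip).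
Qed.

Lemma pencil_split p w :
  quotient_has_length B (cocycles F0) (coboundaries F0) p ->
  quotient_has_length B (cocycles F1) (coboundaries F1) p ->
  (forall x, O x (a / b) -> O x w) ->
  exists al be, [/\ b / a * w = al + be, forall x, O x (b / a) -> O x al
    & forall x, O x (a / b) -> O x be].
Proof.
move=> lF0 lF1 hw.
(* The covering by X_a and X_b, indexed by points: a point selects X_a whenever it lies there. *)
pose U x := if `[< O x (b / a) >] then [set y | O y (b / a)] else [set y | O y (a / b)].
pose chi x : K := if `[< O x (b / a) >] then 0 else b / a * w.
have pU : pointed_cover U.
  move=> x; rewrite /U; case: asboolP => h; first by split=> //; exact: open_domain.
  by split; [exact: open_domain|exact: (polar_regular pab h)].
pose g : X -> X -> K^o := fun x y => chi y - chi x.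
have cg : cocycles F0 g.
  split; first by move=> x y z; rewrite /g; ring.
  exists U => // x y z; rewrite /U /g /chi; case: asboolP => hx; case: asboolP => hy /= [h1 h2].
  - by rewrite subrr; exact: sr0.
  - by rewrite subr0; apply: (srM (sO z)) => //; exact: hw.
  - by rewrite sub0r; apply: (srN (sO z)); apply: (srM (sO z)) => //; exact: hw.
  - by rewrite subrr; exact: sr0.
have bg : coboundaries F1 (fun x y => a * g x y).
  exists U, (fun x => a * chi x); split=> //; last by move=> x y; rewrite /g mulrBr.
  move=> x; apply/cycle_sheafE; first by case: (pU x).
  rewrite /U /chi; case: asboolP => h y /= hy; first by rewrite mulr0; exact: cycle_at0.
  apply/cycle_at_b => //; have -> : a * (b / a * w) / b = w by field; rewrite a0 b0.
  exact: hw.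
have [U' [g' [pU' gU' gE]]] := multiplication_injective lF0 lF1 cg bg.
have [[x0 _]|nX] := pselect (exists x : X, True); last first.
  exists 0, (b / a * w); split; first by rewrite add0r.
    by move=> x; case: nX; exists x.
  by move=> x; case: nX; exists x.
(* [g'] and [chi] have the same coboundary, so they differ by one constant c; regularity of [g']
   makes -c regular on X_a and c + (b / a) w regular on X_b. *)
pose c := g' x0 - chi x0.
have cE x : g' x = c + chi x by rewrite -[LHS](subrK (g' x0)) -gE /g /c; ring.
have Og x : O x (g' x) by apply: gU'; case: (pU' x).
exists (- c), (c + b / a * w); split; first by ring.
  move=> x hx; have := Og x; rewrite cE /chi; case: asboolP => // _.
  by rewrite addr0; apply: (srN (sO x)).
move=> x hx; have := Og x; rewrite cE /chi; case: asboolP => // hba.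
rewrite addr0 => Oc; apply: (srD (sO x)) => //; apply: (srM (sO x)) => //; exact: hw.
Qed.

(* The sections of O(-nZ) *)
Definition power_sections n : set K := [set f |
  (forall x, O x (b / a) -> O x (f / a ^+ n)) /\ (forall x, O x (a / b) -> O x (f / b ^+ n))].

Lemma power_sections_split p n f :
  quotient_has_length B (cocycles F0) (coboundaries F0) p ->
  quotient_has_length B (cocycles F1) (coboundaries F1) p ->
  power_sections n.+2 f ->
  exists f1 f2, [/\ power_sections n.+1 f1, power_sections n.+1 f2 & f = a * f1 + b * f2].
Proof.
move=> lF0 lF1 [fa fb]; have [al [be [E Oal Obe]]] := pencil_split lF0 lF1 fb.
have an0 m : a ^+ m != 0 by rewrite expf_neq0.
have bn0 m : b ^+ m != 0 by rewrite expf_neq0.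
have E' : f = a * b ^+ n.+1 * (al + be).
  rewrite -E [b ^+ n.+2]exprS; have := bn0 n.+1; move: (b ^+ n.+1) => v v0; field.
  by rewrite a0 b0 v0.
have OP x (c : K) m : O x c -> O x (c ^+ m) by apply: (srX (sO x)).
have E1 : al = f / (a * b ^+ n.+1) - be.
  rewrite E'; have := bn0 n.+1; move: (b ^+ n.+1) => v v0; field.
  by rewrite a0 v0.
have E2 : be = f / (a * b ^+ n.+1) - al.
  rewrite E'; have := bn0 n.+1; move: (b ^+ n.+1) => v v0; field.
  by rewrite a0 v0.
exists (b ^+ n.+1 * be), (a * b ^+ n * al); split.
- split=> x hx.
  + have -> : b ^+ n.+1 * be / a ^+ n.+1 = f / a ^+ n.+2 - (b / a) ^+ n.+1 * al.
      rewrite {1}E2 expr_div_n [a ^+ n.+2]exprS; have := bn0 n.+1; have := an0 n.+1.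
      move: (b ^+ n.+1) (a ^+ n.+1) => v t t0 v0; field.
      by rewrite a0 v0 t0.
    by apply: (srB (sO x)); [exact: fa|apply: (srM (sO x)); [exact: OP|exact: Oal]].
  + have -> : b ^+ n.+1 * be / b ^+ n.+1 = be by rewrite mulrC mulKf.
    exact: Obe.
- split=> x hx.
  + have -> : a * b ^+ n * al / a ^+ n.+1 = (b / a) ^+ n * al.
      rewrite expr_div_n exprS; have := an0 n; move: (b ^+ n) (a ^+ n) => v t t0; field.
      by rewrite a0 t0.
    by apply: (srM (sO x)); [exact: OP|exact: Oal].
  + have -> : a * b ^+ n * al / b ^+ n.+1 = f / b ^+ n.+2 - a / b * be.
      rewrite {1}E1 ![b ^+ _.+1]exprS; have := bn0 n; move: (b ^+ n) => v v0; field.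
      by rewrite a0 b0 v0.
    by apply: (srB (sO x)); [exact: fb|apply: (srM (sO x)) => //; exact: Obe].
- by rewrite E' exprS; ring.
Qed.

End Cohomology.

(** * Transfer to the fraction field *)

Section InjectiveImage.
Variables (A : idomainType) (K : fieldType) (f : {rmorphism A -> K}).
Hypothesis inj : injective f.
Local Notation B := (range f).
Implicit Types (I J P : set K).

Lemma range_subring : subring B.
Proof.
split; first by exists 1; rewrite ?rmorph1.
- by move=> _ _ [x _ <-] [y _ <-]; exists (x - y); rewrite ?rmorphB.
- by move=> _ _ [x _ <-] [y _ <-]; exists (x * y); rewrite ?rmorphM.
Qed.

Lemma preimage_ideal I : ideal B I -> ideal [set: A] (f @^-1` I).
Proof.
move=> iI; apply: idealI => //=.
- by rewrite rmorph0; exact: id0 iI.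
- by move=> x y; rewrite rmorphD; exact: (idD iI).
- by move=> s x _ Ix; rewrite rmorphM; apply: (idM iI) => //; exists s.
Qed.

Lemma image_preimage I : ideal B I -> I = f @` (f @^-1` I).
Proof.
move=> iI; apply/seteqP; split=> [x Ix|_ [x Ix <-] //].
by have [y _ yE] := idS iI Ix; exists y => //=; rewrite yE.
Qed.

Lemma preimage_prime P : prime_ideal B P -> prime_ideal [set: A] (f @^-1` P).
Proof.
move=> [iP P1 PM]; split; [exact: preimage_ideal|by rewrite /= rmorph1|].
by move=> x y _ _; rewrite /= rmorphM; apply: PM; [exists x|exists y].
Qed.

Lemma preimage_proper I J : ideal B I -> ideal B J -> proper I J ->
  proper (f @^-1` I) (f @^-1` J).
Proof.
move=> iI iJ [IJ nJI]; split; first by move=> x; apply: IJ.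
move=> h; apply: nJI; rewrite (image_preimage iJ) => _ [x Jx <-]; exact: h.
Qed.

Lemma range_noetherian : noetherian [set: A] -> noetherian B.
Proof.
move=> nA I iI; have [s sE] := nA _ (preimage_ideal iI).
exists [seq f x | x <- s]; apply/seteqP; split; last first.
  apply: ideal_gen_min => // _ /mapP[x xs ->].
  have : (f @^-1` I) x by rewrite sE; apply: ideal_gen_sub.
  by [].
move=> x; rewrite {1}(image_preimage iI) sE => -[{}x hx <-].
have := hx (f @^-1` ideal_gen B [set` [seq f x | x <- s]]); apply.
  have [h0 hD hZ] := ideal_gen_submod B [set` [seq f x | x <- s]]; split.
  - by rewrite /= rmorph0.
  - by move=> u v hu hv; rewrite /= rmorphD; apply: hD.
  - by move=> c v _ hv; rewrite /= rmorphM; apply: hZ => //; exists c.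
by move=> y ys; apply: ideal_gen_sub; apply/mapP; exists y.
Qed.

Lemma nonunits_range x : nonunits B (f x) <-> nonunits [set: A] x.
Proof.
split=> -[h nu]; split=> //.
- by move=> [y _ xy]; apply: nu; exists (f y); [exists y|rewrite -rmorphM xy rmorph1].
- by move=> [_ [y _ <-] xy]; apply: nu; exists y => //; apply: inj; rewrite rmorphM xy rmorph1.
Qed.

Lemma range_local : local_ring [set: A] -> local_ring B.
Proof.
move=> lA; apply: idealI.
- by move=> x [].
- by rewrite -(rmorph0 f); apply/nonunits_range; exact: id0 lA.
- move=> x y mx my; have [[a _ aE] _] := mx; have [[b _ bE] _] := my.
  move: mx my; rewrite -aE -bE -rmorphD !nonunits_range; exact: (idD lA).
- move=> _ y [a _ <-] my; have [[b _ bE] _] := my.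
  move: my; rewrite -bE -rmorphM !nonunits_range; exact: (idM lA).
Qed.

Lemma range_chain3 N : krull_dim [set: A] 2 -> ~ chain3 B N.
Proof.
move=> [_ nc] [P1 [P2 [P3 [[p1 p2 p3] [[x P1x x0] P12 P23 _]]]]]; apply: nc.
have i0 : ideal B [set 0] by apply: ideal_zero; exact: range_subring.
exists (fun n => f @^-1` (nth [set 0] [:: [set 0]; P1; P2; P3] n)); split.
  case=> [|[|[|[|n]]]] //= _; try exact: preimage_prime.
  split; [exact: preimage_ideal|by move=> /= /eqP; rewrite rmorph1 oner_eq0|].
  move=> u v _ _ /= /eqP; rewrite rmorphM mulf_eq0 => /orP[]/eqP h; by [left|right].
case=> [|[|[|n]]] //= _; try by apply: preimage_proper => //; apply: prime_ideal_ideal.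
apply: preimage_proper => //; first exact: prime_ideal_ideal.
split=> [_ ->|h]; first by apply: (id0 (prime_ideal_ideal p1)).
by move/eqP: x0; apply; exact: h.
Qed.

End InjectiveImage.

Section FractionField.
Variable A : idomainType.
Local Notation K := {fraction A}.
Local Notation AK := (range (@tofrac A)).

Lemma tofrac_inj : injective (@tofrac A).
Proof. by move=> x y /eqP; rewrite tofrac_eq => /eqP. Qed.

Lemma fraction_ratio (f : K) : exists a s : A, s != 0 /\ f = tofrac a / tofrac s.
Proof.
elim/quotW: f => x; exists (\n_x), (\d_x); split; first exact: denom_ratioP.
rewrite -[RHS]/(FracField.mul _ (FracField.inv _)) !piE; apply/eqmodP => /=.
rewrite FracField.equivfE /= /FracField.mulf /FracField.invf.
by rewrite !numden_Ratio ?oner_eq0 ?mulf_neq0 ?oner_eq0 ?denom_ratioP // mul1r mulr1 mulrC.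
Qed.

Variables (k : closedFieldType) (i : {rmorphism k -> A}).
Definition constants : {rmorphism k -> K} := GRing.RMorphism.clone _ _ (@tofrac A \o i) _.

Lemma fraction_base_ring : noetherian [set: A] -> krull_dim [set: A] 2 -> normal_domain A ->
  local_ring [set: A] -> (forall a : A, exists c : k, nonunits [set: A] (a - i c)) ->
  base_ring AK constants.
Proof.
move=> nA dA norA lA resA.
have inj := tofrac_inj; split.
- exact: range_subring.
- exact: range_noetherian.
- exact: range_local.
- by move=> N; apply: range_chain3.
- move=> p x hp mp rp; apply: norA.
  have /choice[c hc] : forall j, exists c, tofrac c = p`_j by move=> j; have [c _ cE] := hp j; exists c.
  pose q := \poly_(j < size p) c j.
  have qE : map_poly (@tofrac A) q = p.
    apply/polyP => j; rewrite coef_map coef_poly; case: ltnP => pj; first exact: hc.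
    by rewrite (nth_default _ pj) /= (rmorph0 (@tofrac A)).
  exists q; last by rewrite qE.
  apply/eqP/inj; rewrite -lead_coef_map_inj // ?qE ?(rmorph1 (@tofrac A)).
    exact/eqP.
- by move=> c; exists (i c).
- move=> _ [a _ <-]; have [c hc] := resA a; exists c.
  by rewrite -rmorphB; apply/nonunits_range.
- move=> f; have [a [s [s0 ->]]] := fraction_ratio f; exists (tofrac a), (tofrac s).
  by split=> //; move=> /eqP; rewrite tofrac_eq0 (negPf s0).
Qed.

Variables (X : topologicalType) (O : X -> set K).

(** The valuative criterion is applied to the identity of [K] at the generic point, whose local ring
    is [K]; as every point is a specialization of it, the center is unique among all points. *)
Lemma resolution_resolved_by : resolution O -> resolved_by AK O.
Proof.
move=> [[X0 irr sO aO] AO [[cX ft] prop] rO].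
have sB := range_subring (@tofrac A).
have fO x f : loc (O x) [set 0] f.
  have [a [s [s0 ->]]] := fraction_ratio f; exists (tofrac a), (tofrac s).
  by split=> //; [apply: AO; exists a|apply: AO; exists s|move=> /eqP; rewrite tofrac_eq0 (negPf s0)].
have [e [Oe ce]] := generic_point sO aO X0 irr fO.
have center V : valuation_ring V -> AK `<=` V ->
    exists! y, [/\ closure [set e] y, O y `<=` V & nonunits (O y) `<=` nonunits V].
  move=> vV AV; have [|f [_ nf]|a|y [[cy h1 h2] uy]] := prop K V vV e id.
  - by split.
  - by apply: contrapT => /eqP f0; apply: nf; exists f^-1; rewrite ?Oe // divff.
  - by apply: AV; exists a.
  - by exists y; split=> // z [cz h3 h4]; apply: uy.
split=> //.
- by move=> x; have [U [aU Ux [s UE]]] := ft x; exists U, s; split=> //; rewrite UE subalgebra_genE.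
- by move=> V vV AV; have [y [[_ h1 h2] _]] := center V vV AV; exists y.
- move=> V y z vV Oy my Oz mz; have [|w [_ uw]] := center V vV; first by apply: subset_trans Oy.
  by rewrite -(uw y) // -(uw z).
Qed.

End FractionField.

(** * Powers of the ideal of a cycle *)

Lemma krull_dim_le (R : comPzRingType) (S : set R) m n : krull_dim S m -> krull_dim S n -> (m <= n)%N.
Proof.
move=> [[C [pC sC]] _] [_ nc]; rewrite leqNgt; apply/negP => nm; apply: nc.
by exists C; split=> j jn; [apply: pC|apply: sC]; apply: leq_trans nm.
Qed.

Lemma integral_relation_div (K : fieldType) (h c : K) (d : nat -> K) n : h != 0 ->
  (c / h) ^+ n + \sum_(1 <= j < n.+1) d j / h ^+ j * (c / h) ^+ (n - j) =
    (c ^+ n + \sum_(1 <= j < n.+1) d j * c ^+ (n - j)) / h ^+ n.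
Proof.
move=> h0; rewrite mulrDl expr_div_n; congr (_ + _); rewrite mulr_suml.
apply: eq_big_nat => j /andP[_ jn]; rewrite expr_div_n.
have -> : h ^+ n = h ^+ j * h ^+ (n - j) by rewrite -exprD subnKC.
by rewrite invfM mulrACA.
Qed.

Section Powers.
Variables (A : idomainType) (k : closedFieldType) (i : {rmorphism k -> A}).
Local Notation K := {fraction A}.
Local Notation AK := (range (@tofrac A)).
Local Notation tf := (@tofrac A).
Variables (X : topologicalType) (O : X -> set K).
Hypotheses (bB : base_ring AK (constants i)) (rO : resolved_by AK O).
Let sO := res_subring rO.
Let BO := res_base rO.
Variable Z : X -> int.
Local Notation I := (cycle_ideal O Z).

Lemma tofrac_O x c : O x (tf c). Proof. by apply: BO; exists c. Qed.

Lemma ideal_pow_order x (J : set A) g n c : (forall c, J c -> O x (tf c / g)) ->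
  ideal_pow [set: A] J n c -> O x (tf c / g ^+ n).
Proof.
move=> hJ; elim: n c => [|n IH] c; first by rewrite expr0 divr1 => _; exact: tofrac_O.
apply: (ideal_mul_min (M := [set c | O x (tf c / g ^+ n.+1)])); last first.
  move=> u v Ju /IH hv /=; rewrite tofracM exprS invfM mulrACA.
  by apply: (srM (sO x)) => //; exact: hJ.
apply: idealI => //=.
- by rewrite tofrac0 mul0r; exact: sr0.
- by move=> u v hu hv; rewrite tofracD mulrDl; apply: (srD (sO x)).
- by move=> s u _ hu; rewrite tofracM -mulrA; apply: (srM (sO x)) => //; exact: tofrac_O.
Qed.

Variables a b : A.
Hypothesis pab : pencil AK O Z (tf a) (tf b).
Let a0 : tf a != 0. Proof. by case: (pencil_neq0 pab). Qed.
Let b0 : tf b != 0. Proof. by case: (pencil_neq0 pab). Qed.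

Definition power_ideal n : set A := [set c | power_sections O (tf a) (tf b) n (tf c)].

Lemma power_ideal_ideal n : ideal [set: A] (power_ideal n).
Proof.
apply: idealI => //=.
- by rewrite /power_ideal /= tofrac0; split=> x _; rewrite mul0r; exact: sr0.
- move=> u v [ua ub] [va vb]; rewrite /power_ideal /= tofracD.
  by split=> x h; rewrite mulrDl; apply: (srD (sO x)); auto.
- move=> s u _ [ua ub]; rewrite /power_ideal /= tofracM.
  by split=> x h; rewrite -mulrA; apply: (srM (sO x)); auto; exact: tofrac_O.
Qed.

Lemma power_idealM m n u v : power_ideal m u -> power_ideal n v -> power_ideal (m + n) (u * v).
Proof.
move=> [ua ub] [va vb]; split=> x h; rewrite tofracM exprD invfM mulrACA; apply: (srM (sO x)); auto.
Qed.

Lemma power_ideal1 : power_ideal 1 = I.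
Proof.
apply/seteqP; split=> c.
  move=> [ca cb]; apply/(cycle_sheafE O Z (tf c) openT) => x _.
  by case: (pencil_cover pab x) => h; [apply/(pencil_left pab) => //; exact: ca|apply/(pencil_right pab) => //; exact: cb].
move=> /(cycle_sheafE O Z (tf c) openT) h; split=> x hx; rewrite expr1.
  by apply/(pencil_left pab) => //; exact: h.
by apply/(pencil_right pab) => //; exact: h.
Qed.

Lemma power_sections_sub n : power_sections O (tf a) (tf b) n `<=` AK.
Proof.
move=> f [fa fb]; apply: (global_sections_base bB rO) => x.
have [h|h] := pencil_cover pab x.
  rewrite -[f](divfK (expf_neq0 n a0)); apply: (srM (sO x)); first exact: fa.
  by apply: (srX (sO x)); exact: tofrac_O.
rewrite -[f](divfK (expf_neq0 n b0)); apply: (srM (sO x)); first exact: fb.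
by apply: (srX (sO x)); exact: tofrac_O.
Qed.

(** Dividing the integral equation of c by h^n turns it into one for c / h over the normal ring
    [O x]. *)
Lemma integral_over_regular x (h : K) (J : set A) c : (forall n d, ideal_pow [set: A] J n d -> O x (tf d / h ^+ n)) ->
  h != 0 -> integral_over_ideal [set: A] J c -> O x (tf c / h).
Proof.
move=> hJ h0 [n [d [n0 hd E]]].
apply: (@point_normal _ _ _ _ _ _ bB rO x _ n (fun j => tf (d j) / h ^+ j)) => //.
  by move=> j hj; apply: hJ; exact: hd.
rewrite integral_relation_div //; have {}E := congr1 tf E.
rewrite rmorph0 rmorphD rmorphXn /= raddf_sum /= in E.
under [X in _ ^+ n + X]eq_bigr do rewrite -rmorphXn -rmorphM /=.
by rewrite E mul0r.
Qed.

Section Conclusion.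
Variables (p : nat) (Q : set A).
Hypotheses (lF0 : geometric_genus O p) (lF1 : H1_length (sheaf_of_cycle O Z) p).
Hypotheses (iQ : ideal [set: A] Q) (QI : Q `<=` I) (Qa : Q a) (Qb : Q b).

Lemma power_ideal_split n : power_ideal n.+2 `<=` ideal_mul [set: A] Q (power_ideal n.+1).
Proof.
move=> c hc; have [f1 [f2 [h1 h2 E]]] := power_sections_split bB rO pab lF0 lF1 hc.
have [c1 _ c1E] := power_sections_sub h1; have [c2 _ c2E] := power_sections_sub h2.
have -> : c = a * c1 + b * c2.
  by apply: tofrac_inj; rewrite E -c1E -c2E -!tofracM -tofracD.
by apply: ideal_genD; apply: ideal_mulS => //; rewrite /power_ideal /= ?c1E ?c2E.
Qed.

Lemma ideal_pow_power n : ideal_pow [set: A] I n.+1 = power_ideal n.+1.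
Proof.
elim: n => [|n IH].
  rewrite power_ideal1; apply/seteqP; split=> c.
    apply: ideal_mul_min; first by rewrite -power_ideal1; exact: power_ideal_ideal.
    move=> u v; rewrite -power_ideal1 => hu _; exact: (idMr (power_ideal_ideal 1)).
  by move=> hc; rewrite -[c]mulr1; apply: ideal_mulS.
rewrite -[LHS]/(ideal_mul [set: A] I (ideal_pow [set: A] I n.+1)) IH.
apply/seteqP; split.
  apply: ideal_mul_min; first exact: power_ideal_ideal.
  by move=> u v; rewrite -power_ideal1 => hu; exact: power_idealM hu.
apply: subset_trans (@power_ideal_split n) _; apply: ideal_genS => _ [u [v [hu hv ->]]].
by exists u, v; split=> //; exact: QI.
Qed.

Lemma power_integrally_closed n : integrally_closed_ideal [set: A] (ideal_pow [set: A] I n.+1).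
Proof.
rewrite ideal_pow_power => c _ hc; split=> x h.
  apply: (integral_over_regular _ (expf_neq0 _ a0) hc) => m d.
  by apply: ideal_pow_order => e [ea _]; exact: ea.
apply: (integral_over_regular _ (expf_neq0 _ b0) hc) => m d.
by apply: ideal_pow_order => e [_ eb]; exact: eb.
Qed.

Lemma square_reduction : ideal_pow [set: A] I 2 = ideal_mul [set: A] I Q.
Proof.
rewrite ideal_pow_power; apply/seteqP; split.
  apply: subset_trans (@power_ideal_split 0) _; rewrite power_ideal1; apply: ideal_genS.
  by move=> _ [u [v [hu hv ->]]]; exists v, u; rewrite mulrC.
apply: ideal_mul_min; first exact: power_ideal_ideal.
by move=> u v hu hv; apply: (@power_idealM 1 1); rewrite power_ideal1 //; exact: QI.
Qed.

Lemma cycle_ideal_colon : I `<=` colon [set: A] Q I.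
Proof.
move=> u hu; split=> // v hv.
have : ideal_mul [set: A] I Q (u * v).
  rewrite -square_reduction ideal_pow_power.
  by apply: (@power_idealM 1 1); rewrite power_ideal1.
apply: ideal_mul_min => // s t _; exact: (idM iQ).
Qed.

End Conclusion.
End Powers.

Lemma ideal_mul_gen2 (A : comPzRingType) (a b : A) (J : set A) c : ideal [set: A] J ->
  ideal_mul [set: A] (ideal_gen [set: A] [set` [:: a; b]]) J c ->
  exists u v, [/\ J u, J v & c = a * u + b * v].
Proof.
move=> iJ; apply: (ideal_mul_min (M := [set c | exists u v, [/\ J u, J v & c = a * u + b * v]])).
  apply: idealI => //.
  - by exists 0, 0; rewrite !mulr0 addr0; split=> //; exact: id0 iJ.
  - move=> _ _ [u [v [hu hv ->]]] [u' [v' [hu' hv' ->]]]; exists (u + u'), (v + v').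
    by split; [exact: (idD iJ)|exact: (idD iJ)|ring].
  - move=> s _ _ [u [v [hu hv ->]]]; exists (s * u), (s * v).
    by split; [exact: (idM iJ)|exact: (idM iJ)|ring].
move=> x y /(ideal_gen_seq2P _ _ _ (setT_subring A))[s [t [_ _ ->]]] Jy; exists (s * y), (t * y).
by split; [exact: (idM iJ)|exact: (idM iJ)|ring].
Qed.

Theorem corollary3p6 (A : idomainType)
    (A_excellent : excellent A) (A_dim2 : krull_dim [set: A] 2)
    (A_normal : normal_domain A) (A_local : local_ring [set: A])
    (k : closedFieldType) (i : {rmorphism k -> A})
    (k_residue : forall a : A, exists c : k, nonunits [set: A] (a - i c))
    (X : topologicalType) (O : X -> set {fraction A})
    (X_resolution : resolution O)
    (Z : X -> int) (Z_pg : pg_cycle O Z)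
    (Q : set A) (Q_red : minimal_reduction [set: A] (cycle_ideal O Z) Q) :
  [/\ forall n : nat, (1 <= n)%N ->
        integrally_closed_ideal [set: A]
          (ideal_pow [set: A] (cycle_ideal O Z) n),
      ideal_pow [set: A] (cycle_ideal O Z) 2 =
        ideal_mul [set: A] (cycle_ideal O Z) Q
    & cycle_ideal O Z `<=` colon [set: A] Q (cycle_ideal O Z)].
Proof.
have [nA _ _ _] := A_excellent.
have bB := fraction_base_ring nA A_dim2 A_normal A_local k_residue.
have rO := resolution_resolved_by X_resolution.
have [[X0 _ _ _] _ _ _] := X_resolution.
have [[[Zfin _] Z0 _] gg [p gp lp]] := Z_pg.
have [[[iQ Qm Qprim] [s ds QE]] QI [r rE]] := Q_red.
have sO := res_subring rO; have aO := affineO rO.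
(* The number of generators of the parameter ideal is the dimension of A, so there are exactly
   two. *)
case: s ds QE => [|a [|b [|? ?]]] /= ds QE;
  try by [move: (krull_dim_le A_dim2 ds)|move: (krull_dim_le ds A_dim2)].
have Qa : Q a by rewrite QE; apply: ideal_gen_sub; rewrite /= inE eqxx.
have Qb : Q b by rewrite QE; apply: ideal_gen_sub; rewrite /= !inE eqxx orbT.
have Icy c x : cycle_ideal O Z c -> cycle_at O Z x (tofrac c).
  by move=> /(cycle_sheafE O Z _ openT); apply.
have mrange c : Q c -> nonunits (range (@tofrac A)) (tofrac c).
  by move=> Qc; apply/(nonunits_range (@tofrac_inj A)); exact: Qm.
have iI : ideal [set: A] (cycle_ideal O Z).
  have cI c : (forall x, cycle_at O Z x (tofrac c)) -> cycle_ideal O Z c.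
    by move=> h; apply/(cycle_sheafE O Z _ openT) => x _.
  apply: idealI => //=.
  - apply: cI => x; have [g [_ _ gE]] := cycle_generator bB rO Z0 Zfin x.
    by rewrite gE tofrac0 mul0r; exact: sr0.
  - move=> u v Iu Iv; apply: cI => x; have [g [_ _ gE]] := cycle_generator bB rO Z0 Zfin x.
    rewrite gE tofracD mulrDl; apply: (srD (sO x)); apply/gE; exact: Icy.
  - move=> t u _ Iu; apply: cI => x; have [g [_ _ gE]] := cycle_generator bB rO Z0 Zfin x.
    rewrite gE tofracM -mulrA; apply: (srM (sO x)); first exact: tofrac_O rO _ _.
    by apply/gE; exact: Icy.
(* Global generation gives a section j in I that generates the stalk at x, and the reduction
   relation for j^(r+1) passes this on to a and b. *)
have gen x : generates O Z (tofrac a) (tofrac b) x.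
  have [g [g0 _ gE]] := cycle_generator bB rO Z0 Zfin x.
  have Og c : cycle_ideal O Z c -> O x (tofrac c / g) by move=> /(Icy _ x)/gE.
  exists g; split=> //; [exact/Og/QI|exact/Og/QI|].
  have [j Jj nj] := globally_generated_unit bB rO Z0 Zfin (@gg x) g0 gE.
  have [c _ cE] : range (@tofrac A) j.
    apply: (global_sections_base bB rO) => y; apply: (cycle_at_sub bB rO Z0 Zfin).
    exact: ((cycle_sheafE O Z _ openT).1 Jj).
  have Ic : cycle_ideal O Z c by rewrite /cycle_ideal /= cE.
  have := ideal_powX (setT_subring A) r.+1 Ic; rewrite rE QE.
  case/ideal_mul_gen2; first exact: (ideal_pow_ideal (setT_subring A)).
  move=> u [v [Iu Iv E]].
  apply: (reduction_unit (r := r) rO g0 (Og _ (QI _ Qa)) (Og _ (QI _ Qb)) _ nj).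
  - by rewrite -cE; exact: Og.
  - by rewrite -cE -tofracXn E tofracD !tofracM.
  - exact: (ideal_pow_order rO Og).
  - exact: (ideal_pow_order rO Og).
(* Each nonunit of A has a power in Q = (a, b), so it vanishes wherever a and b both do. *)
have exc x : nonunits (O x) (tofrac a) -> nonunits (O x) (tofrac b) ->
    exceptional (range (@tofrac A)) O x.
  move=> ma mb _ [[c _ <-] nc].
  have [|n] := Qprim c; first by apply/(nonunits_range (@tofrac_inj A)).
  rewrite QE => /(ideal_gen_seq2P _ _ _ (setT_subring A))[u [v [_ _ E]]].
  have lx := local_O sO aO x.
  apply: (primeX (sO x) (prime_nonunits sO aO x) (n := n)); first exact: tofrac_O rO _ _.
  rewrite -tofracXn E tofracD !tofracM.
  by apply: (idD lx); apply: (idM lx) => //; exact: tofrac_O rO _ _.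
have [l [m [_ pab]]] := pencil_exists bB rO Zfin X0 (mrange _ Qa) (mrange _ Qb) gen exc.
have Qc t : Q (a + i t * b) by apply: (idD iQ) => //; apply: (idM iQ).
have cE t : tofrac a + constants i t * tofrac b = tofrac (a + i t * b).
  by rewrite tofracD tofracM.
rewrite !cE in pab.
split.
- by case=> // n _; apply: (power_integrally_closed bB rO pab gp lp QI).
- exact: (square_reduction bB rO pab gp lp QI).
- exact: (cycle_ideal_colon bB rO pab gp lp iQ QI).
Qed.
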